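(* Let $g\ge 2$ and let $\mathcal F$ be a canonical fundamental $(8g-4)$-gon for a Fuchsian group $\Gamma$ with $S=\Gamma\backslash\mathbb D$ a closed surface of genus $g$. For every multi-parameter $\bar A=\{A_1,\dots,A_{8g-4}\}$ with $A_k\in[P_k,Q_k]$ for each $k$, the boundary map $f_{\bar A}:\mathbb S\to\mathbb S$ has topological entropy \[ h_{\mathrm{top}}(f_{\bar A})=\log\!\big(4g-3+\sqrt{(4g-3)^2-1}\big). \]
   Context: $\mathbb D$ is the unit disk with the hyperbolic metric $2|dz|/(1-|z|^2)$ and $\mathbb S=\partial\mathbb D$. A fundamental $(8g-4)$-gon $\mathcal F$ for $\Gamma$ has sides labelled $1,\dots,8g-4$ counterclockwise, side $k$ joining vertices $V_k$ and $V_{k+1}$ (indices mod $8g-4$). The side pairing is $\sigma(k)=4g-k \bmod (8g-4)$ if $k$ is odd and $\sigma(k)=2-k\bmod(8g-4)$ if $k$ is even; $T_k\in\Gamma$ is the Möbius transformation mapping side $k$ onto side $\sigma(k)$, and $\Gamma$ is generated by $T_1,\dots,T_{8g-4}$. The polygon is canonical if sides $k$ and $\sigma(k)$ have equal length and the angles at vertices $V_k$ and $V_{\sigma(k)+1}$ sum to $\pi$ (such polygons exist for every closed genus-$g$ hyperbolic surface, obtained by cutting along $2g$ closed geodesics). $P_k$ and $Q_{k+1}$ denote the initial and terminal endpoints on $\mathbb S$ of the oriented complete geodesic extending side $k$; the counterclockwise order on $\mathbb S$ is $P_1,Q_1,P_2,Q_2,\dots,P_{8g-4},Q_{8g-4}$,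 and $[P_k,Q_k]$ denotes the counterclockwise arc. For $\bar A=\{A_k\}$ with $A_k\in[P_k,Q_k]$, the boundary map is $f_{\bar A}(x)=T_k(x)$ for $x\in[A_k,A_{k+1})$. Topological entropy for such piecewise continuous, piecewise monotone circle maps is in the sense of Bowen (separated sets). *)

(* Defs.v *)
From Stdlib Require Import Reals Arith List.
From Coquelicot Require Import Coquelicot.

Open Scope R_scope.

Definition cdot (u v : C) : R := Re u * Re v + Im u * Im v.
Definition ccross (u v : C) : R := Re u * Im v - Im u * Re v.
Definition cexp_i (t : R) : C := (cos t, sin t).

Definition mob := (C * C)%type.
Definition is_disk_mob (m : mob) : Prop :=
  (Cmod (fst m))^2 - (Cmod (snd m))^2 = 1.
Definition mob_act (m : mob) (z : C) : C :=
  ((fst m * z + snd m) / (Cconj (snd m) * z + Cconj (fst m)))%C.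
Definition mob_inv (m : mob) : mob := (Cconj (fst m), (- snd m)%C).

Fixpoint word_act (T : nat -> mob) (w : list (nat * bool)) (z : C) : C :=
  match w with
  | nil => z
  | (k, inv) :: w' =>
      mob_act (if inv then mob_inv (T k) else T k) (word_act T w' z)
  end.
Definition word_ok (N : nat) (w : list (nat * bool)) : Prop :=
  forall p, In p w -> (1 <= fst p <= N)%nat.

(** * Hyperbolic geometry in the disk with metric 2|dz|/(1-|z|^2) *)
Definition in_disk (z : C) : Prop := Cmod z < 1.
(* hyperbolic distance: 2 artanh (|z-w|/|1 - conj(w) z|) *)
Definition hdist (z w : C) : R :=
  let r := Cmod (z - w)%C / Cmod (RtoC 1 - Cconj w * z)%C in
  ln ((1 + r) / (1 - r)).
(* The disk automorphism sending v to 0 has positive real derivative at v,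
   so the unit tangent direction at v of the geodesic from v to w is the
   direction of (w - v)/(1 - conj v w). *)
Definition tangent_dir (v w : C) : C := ((w - v) / (RtoC 1 - Cconj v * w))%C.
Definition angle_between (u v : C) : R := acos (cdot u v / (Cmod u * Cmod v)).
Definition hangle (v w1 w2 : C) : R :=
  angle_between (tangent_dir v w1) (tangent_dir v w2).

(** Klein model map: geodesics of the Poincare disk become straight chords,
    with the same ideal endpoints. *)
Definition klein (z : C) : C := ((RtoC (2 / (1 + (Cmod z)^2))) * z)%C.

(** Ideal endpoints of the oriented complete geodesic through a then b
    (a <> b in the disk): the two intersections with the unit circle of the
    Klein chord line a' + t d, backward (t < 0) and forward (t > 1). *)
Definition chord_param (a b : C) (sgn : R) : R :=
  let a' := klein a in let d := (klein b - klein a)%C in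
  (- cdot a' d + sgn * sqrt ((cdot a' d)^2 - (Cmod d)^2 * ((Cmod a')^2 - 1)))
    / (Cmod d)^2.
Definition geod_start (a b : C) : C :=
  (klein a + RtoC (chord_param a b (-1)) * (klein b - klein a))%C.
Definition geod_end (a b : C) : C :=
  (klein a + RtoC (chord_param a b 1) * (klein b - klein a))%C.

(** * The (8g-4)-gon data.  Vertices are a sequence V : nat -> C, periodic of
    period N = 8g-4; side k (1 <= k <= N) joins V k and V (k+1). *)
Definition Nsides (g : nat) : nat := 8 * g - 4.

(* side pairing: sigma(k) = 4g - k mod N (k odd), 2 - k mod N (k even);
   the value 0 stands for the label N (all data are N-periodic). *)
Definition sigma (g k : nat) : nat :=
  if Nat.odd k then (4 * g + Nsides g - k) mod Nsides g
  else (2 + Nsides g - k) mod Nsides g.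

Definition periodic {A} (N : nat) (u : nat -> A) : Prop :=
  forall k, u (k + N)%nat = u k.

Definition Pt (V : nat -> C) (k : nat) : C := geod_start (V k) (V (S k)).
Definition Qt (V : nat -> C) (k : nat) : C := geod_end (V (pred k)) (V k).

Definition ccw_convex_polygon (N : nat) (V : nat -> C) : Prop :=
  (forall k, in_disk (V k)) /\
  forall k j, (1 <= k <= N)%nat -> (1 <= j <= N)%nat -> j <> k -> j <> (k mod N + 1)%nat ->
    ccross (klein (V (S k)) - klein (V k))%C (klein (V j) - klein (V k))%C > 0.

(* closed polygon F and its interior (convex: intersection of half-planes) *)
Definition in_polygon (N : nat) (V : nat -> C) (z : C) : Prop :=
  in_disk z /\ forall k, (1 <= k <= N)%nat ->
    ccross (klein (V (S k)) - klein (V k))%C (klein z - klein (V k))%C >= 0.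
Definition in_polygon_int (N : nat) (V : nat -> C) (z : C) : Prop :=
  in_disk z /\ forall k, (1 <= k <= N)%nat ->
    ccross (klein (V (S k)) - klein (V k))%C (klein z - klein (V k))%C > 0.

Definition fundamental_polygon (g : nat) (V : nat -> C) (T : nat -> mob) : Prop :=
  let N := Nsides g in
  periodic N V /\ ccw_convex_polygon N V /\
  (forall k, (1 <= k <= N)%nat -> is_disk_mob (T k)) /\
  (forall k, (1 <= k <= N)%nat ->
     mob_act (T k) (V k) = V (S (sigma g k)) /\
     mob_act (T k) (V (S k)) = V (sigma g k)) /\
  (forall z, in_disk z -> exists w, word_ok N w /\ in_polygon N V (word_act T w z)) /\
  (forall w z, word_ok N w -> in_polygon_int N V z ->
     in_polygon_int N V (word_act T w z) ->
     forall u, in_disk u -> word_act T w u = u) /\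
  (* Gamma acts freely on the disk (torsion-free: quotient is a surface) *)
  (forall w z, word_ok N w -> in_disk z -> word_act T w z = z ->
     forall u, in_disk u -> word_act T w u = u).

Definition canonical (g : nat) (V : nat -> C) : Prop :=
  forall k, (1 <= k <= Nsides g)%nat ->
    hdist (V k) (V (S k)) = hdist (V (sigma g k)) (V (S (sigma g k))) /\
    hangle (V k) (V (pred k)) (V (S k)) +
    hangle (V (S (sigma g k))) (V (sigma g k)) (V (S (S (sigma g k)))) = PI.

Definition on_circle (z : C) : Prop := Cmod z = 1.
Definition arc_cc (a b x : C) : Prop :=
  exists t s, 0 <= t <= s /\ s < 2 * PI /\
    x = (a * cexp_i t)%C /\ b = (a * cexp_i s)%C.
Definition arc_co (a b x : C) : Prop :=
  exists t s, 0 <= t < s /\ s < 2 * PI /\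
    x = (a * cexp_i t)%C /\ b = (a * cexp_i s)%C.

Definition is_boundary_map (N : nat) (T : nat -> mob) (A : nat -> C) (f : C -> C) : Prop :=
  forall k x, (1 <= k <= N)%nat -> on_circle x -> arc_co (A k) (A (S k)) x ->
    f x = mob_act (T k) x.

(** * Bowen topological entropy on S (Euclidean metric on S), via
      (n,eps)-separated sets:
      h(f) = sup_{eps>0} limsup_n (1/n) log s(n,eps),
      limsup_n a_n = inf_N sup_{n>=N} a_n, and s(n,eps) the sup of the
      cardinalities of (n,eps)-separated subsets of S. *)
Definition n_separated (f : C -> C) (n : nat) (eps : R) (x y : C) : Prop :=
  exists i, (i < n)%nat /\ Cmod (Nat.iter i f x - Nat.iter i f y)%C > eps.
Definition sep_set (f : C -> C) (n : nat) (eps : R) (E : list C) : Prop :=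
  (forall x, In x E -> on_circle x) /\
  forall i j, (i < j < length E)%nat ->
    n_separated f n eps (nth i E (RtoC 0)) (nth j E (RtoC 0)).
Definition tail_sup (f : C -> C) (eps : R) (N : nat) : Rbar :=
  Rbar_lub (fun r => exists n E, (N <= n)%nat /\ (1 <= n)%nat /\ E <> nil /\
              sep_set f n eps E /\ r = Finite (ln (INR (length E)) / INR n)).
Definition sep_limsup (f : C -> C) (eps : R) : Rbar :=
  Rbar_glb (fun y => exists N, y = tail_sup f eps N).
Definition htop (f : C -> C) : Rbar :=
  Rbar_lub (fun h => exists eps, 0 < eps /\ h = sep_limsup f eps).

(* Main.v *)
(* Write [N = 8g - 4] and let [lam > 1] be the root of [lam^2 = (N - 2) lam - 1], which is the number under
   the logarithm.  Everything is independent of the cut points because one single map [Phi] of the circle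
   expands every [T_k] by [lam] on the whole arc from [P_k] to [Q_(k+1)], and all boundary maps are assembled
   from these branches.  The function [Phi] is the fixed point of the transfer operator of the Markov map
   with cuts [P_k], with [Phi]-length [1] for the arcs [P_k Q_k] and [lam - 1] for the arcs [Q_k P_(k+1)];
   that the slope is still [lam] on [P_(k+1) Q_(k+1)] follows from the vertex relations of the group.

   Upper bound: a cylinder whose image has [Phi]-length [l] splits into at most [2 + l] pieces, so there are
   [O(lam^n)] cylinders of order [n], and each contains only [O(n / eps)] separated points.  Lower bound: the
   two images of a discontinuity are almost antipodal, so points whose orbits stay close share their
   itinerary, and [lam^n] points equally spaced for [Phi] are separated.

   The combinatorics needs the cyclic order [P_1, Q_1, P_2, ...].  In the Klein model, with disk
   automorphisms acting as Lorentz maps, its main point is that the lines of sides [k - 1] and [k + 1]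
   do not meet beyond side [k]: applying [T_k], they would enclose the polygon in a triangle over side
   [sigma k], which the equality of opposite angles of the polygon forbids. *)
Require Import Defs.
From Stdlib Require Import Reals ZArith Arith List Lia Lra Psatz ClassicalEpsilon.
From Coquelicot Require Import Coquelicot.
Open Scope R_scope.

(** * Cyclic grids and the conjugacy to constant slope *)

(** For arbitrary cut points the boundary map has in general no Markov partition, so there is no
    transition matrix whose spectral radius could be computed; the entropy is read off from a length
    that every branch multiplies by the same factor. The equation for [lam] says that the prescribed
    lengths are consistent: [T_k] maps [P_k Q_k], of length 1, onto an arc between consecutive
    points [Q], of length [lam], and maps [P_k P_(k+1)], of length [lam], onto the arc from
    [Q_(sigma k + 1)] around to [P_(sigma k - 1)], of length [(N - 2) lam - 1].

    [Phi] is only shown to be nondecreasing and continuous. This is enough: the upper bound uses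
    monotonicity to count pieces, and the lower bound uses continuity to turn distance of
    [Phi]-values into distance of points.

    Everything is lifted to the line, with the sides labelled by all integers. The cyclic order
    becomes the order of the reals, and labels are never reduced modulo [N]; the price is the
    bookkeeping of full turns. *)

Definition grid (N : Z) (a : Z -> R) : Prop :=
  (0 < N)%Z /\ (forall k, a k < a (k + 1)%Z) /\
  (forall k, a (k + N)%Z = a k + 2 * PI).

Lemma grid_lt N a j k : grid N a -> (j < k)%Z -> a j < a k.
Proof.
  intros (_ & Hinc & _) Hjk.
  replace k with (j + 1 + Z.of_nat (Z.to_nat (k - j - 1)))%Z by lia.
  induction (Z.to_nat (k - j - 1)) as [|n IH].
  - replace (j + 1 + Z.of_nat 0)%Z with (j + 1)%Z by lia. apply Hinc.
  - replace (j + 1 + Z.of_nat (S n))%Z with (j + 1 + Z.of_nat n + 1)%Z by lia.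
    eapply Rlt_trans; [exact IH | apply Hinc].
Qed.

Lemma grid_le N a j k : grid N a -> (j <= k)%Z -> a j <= a k.
Proof.
  intros Ha Hjk. destruct (Z.eq_dec j k) as [->|]; [lra|].
  apply Rlt_le, (grid_lt N); [exact Ha | lia].
Qed.

Lemma grid_lt_inv N a j k : grid N a -> a j < a k -> (j < k)%Z.
Proof.
  intros Ha Hlt. destruct (Z_lt_le_dec j k) as [|Hkj]; [assumption|].
  pose proof (grid_le N a k j Ha Hkj). lra.
Qed.

Lemma grid_per N a k m : grid N a -> a (k + m * N)%Z = a k + 2 * PI * IZR m.
Proof.
  intros (HN & _ & Hper).
  assert (Hnat : forall n k, a (k + Z.of_nat n * N)%Z = a k + 2 * PI * INR n).
  { induction n as [|n IH]; intros j.
    - simpl. rewrite Z.add_0_r. lra.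
    - rewrite Nat2Z.inj_succ, S_INR.
      replace (j + Z.succ (Z.of_nat n) * N)%Z with (j + Z.of_nat n * N + N)%Z by lia.
      rewrite Hper, IH. lra. }
  destruct (Z_le_gt_dec 0 m) as [Hm|Hm].
  - rewrite <- (Z2Nat.id m Hm), Hnat, INR_IZR_INZ. reflexivity.
  - pose proof (Hnat (Z.to_nat (- m)) (k + m * N)%Z) as H.
    rewrite INR_IZR_INZ, Z2Nat.id, opp_IZR in H by lia.
    replace (k + m * N + - m * N)%Z with k in H by lia. lra.
Qed.

Lemma grid_piece_exists N a t : grid N a -> exists k, a k <= t < a (k + 1)%Z.
Proof.
  intros Ha. pose proof PI_RGT_0 as HPI.
  set (m := Int_part ((t - a 0%Z) / (2 * PI))).
  assert (Hm : a (m * N)%Z <= t < a (m * N + N)%Z).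
  { destruct (base_Int_part ((t - a 0%Z) / (2 * PI))) as [H1 H2]. fold m in H1, H2.
    replace (m * N)%Z with (0 + m * N)%Z by lia.
    replace (0 + m * N + N)%Z with (0 + (m + 1) * N)%Z by lia.
    rewrite !(grid_per N) by assumption. rewrite plus_IZR.
    assert (Ht : t = a 0%Z + (2 * PI) * ((t - a 0%Z) / (2 * PI))) by (field; lra).
    set (x := (t - a 0%Z) / (2 * PI)) in *. rewrite Ht. split; nra. }
  destruct Ha as (HN & _ & _).
  assert (Hfin : forall n, t < a (m * N + Z.of_nat n)%Z -> exists k, a k <= t < a (k + 1)%Z).
  { induction n as [|n IH]; intros Hn.
    - rewrite Z.add_0_r in Hn. lra.
    - destruct (Rlt_le_dec t (a (m * N + Z.of_nat n)%Z)) as [H|H]; [exact (IH H)|].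
      exists (m * N + Z.of_nat n)%Z. split; [exact H|].
      replace (m * N + Z.of_nat n + 1)%Z with (m * N + Z.of_nat (S n))%Z by lia. exact Hn. }
  apply (Hfin (Z.to_nat N)). rewrite Z2Nat.id by lia. apply Hm.
Qed.

Definition piece (a : Z -> R) (t : R) : Z :=
  epsilon (inhabits 0%Z) (fun k => a k <= t < a (k + 1)%Z).

Lemma piece_spec N a t : grid N a -> a (piece a t) <= t < a (piece a t + 1)%Z.
Proof. intros Ha. unfold piece. apply epsilon_spec, (grid_piece_exists N), Ha. Qed.

Lemma piece_unique N a t k : grid N a -> a k <= t < a (k + 1)%Z -> piece a t = k.
Proof.
  intros Ha Hk. pose proof (piece_spec N a t Ha) as Hp.
  assert (piece a t < k + 1)%Z by (apply (grid_lt_inv N a); [assumption | lra]).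
  assert (k < piece a t + 1)%Z by (apply (grid_lt_inv N a); [assumption | lra]).
  lia.
Qed.

Lemma piece_shift N a t m : grid N a -> piece a (t + 2 * PI * IZR m) = (piece a t + m * N)%Z.
Proof.
  intros Ha. apply (piece_unique N); [exact Ha|].
  replace (piece a t + m * N + 1)%Z with (piece a t + 1 + m * N)%Z by lia.
  rewrite !(grid_per N) by exact Ha. pose proof (piece_spec N a t Ha). lra.
Qed.

Set Implicit Arguments.

(** All that the dynamical part needs to know about the polygon. [tau k] lifts [T_k], and [sg] lifts
    the side pairing; it reverses the labels, which explains the signs in [bl_sg_per] and
    [bl_tau_per]. The summand [N] in [bl_pk1] and [bl_qk1] selects the lift that lies above the
    images of [p k] and [q k]. [bl_rel] is the vertex relation on an overlap arc, up to full turns,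
    and [bl_gap] places the two images of such an arc about half a turn apart. *)
Record boundary_lift (N : Z) (lam : R) (p q : Z -> R) (sg : Z -> Z) (tau : Z -> R -> R) : Prop := {
  bl_N : (12 <= N)%Z;
  bl_lam : 3 <= lam;
  bl_char : lam ^ 2 = (IZR N - 2) * lam - 1;
  bl_pq : forall k, p k < q k;
  bl_qp : forall k, q k < p (k + 1)%Z;
  bl_p_per : forall k, p (k + N)%Z = p k + 2 * PI;
  bl_q_per : forall k, q (k + N)%Z = q k + 2 * PI;
  bl_sg_per : forall k, sg (k + N)%Z = (sg k - N)%Z;
  bl_tau_per : forall k t, tau (k + N)%Z (t + 2 * PI) = tau k t - 2 * PI;
  bl_inc : forall k t u, t < u -> tau k t < tau k u;
  bl_lip : exists L, 0 < L /\ forall k t u, t <= u -> tau k u - tau k t <= L * (u - t);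
  bl_pk : forall k, tau k (p k) = q (sg k + 1)%Z;
  bl_qk : forall k, tau k (q k) = q (sg k + 2)%Z;
  bl_pk1 : forall k, tau k (p (k + 1)%Z) = p (sg k - 1 + N)%Z;
  bl_qk1 : forall k, tau k (q (k + 1)%Z) = p (sg k + N)%Z;
  bl_rel : forall k, exists c : Z, forall t, p (k + 1)%Z <= t <= q (k + 1)%Z ->
    tau (sg (k + 1) + 1)%Z (tau (k + 1)%Z t) =
    tau (sg k - 1 + N)%Z (tau k t) + 2 * PI * IZR c;
  bl_gap : forall k, exists m : Z, (sg k - 1 + N - (sg (k + 1) + 1) = m * N + N / 2 - 1)%Z
}.

Unset Implicit Arguments.

Section Conjugacy.
Context (N : Z) (lam : R) (p q : Z -> R) (sg : Z -> Z) (tau : Z -> R -> R).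
Context (B : boundary_lift N lam p q sg tau).

Lemma bl_grid_p : grid N p.
Proof.
  split; [pose proof (bl_N B); lia|]. split; [|apply B].
  intros k. pose proof (bl_pq B k). pose proof (bl_qp B k). lra.
Qed.

Lemma bl_inc_le k t u : t <= u -> tau k t <= tau k u.
Proof.
  intros [H| ->]; [|lra]. apply Rlt_le, (bl_inc B), H.
Qed.

Lemma div_lam_mul x : (x / lam) * lam = x.
Proof. pose proof (bl_lam B). field. lra. Qed.

Definition step_fun (t : R) : R :=
  let k := piece p t in IZR k * lam + (if Rlt_dec t (q k) then 0 else 1).

(** The transfer operator: the slope equation [phi (tau k t) - phi (tau k (p k)) = lam * (phi t -
    phi (p k))], solved for the value at [t] with the prescribed values at [p k] and at
    [tau k (p k) = q (sg k + 1)]. *)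
Definition pull (phi : R -> R) (t : R) : R :=
  let k := piece p t in
  IZR k * lam + (phi (tau k t) - IZR (sg k + 1) * lam - 1) / lam.

Definition normalized (phi : R -> R) : Prop :=
  (forall k, phi (p k) = IZR k * lam) /\
  (forall k, phi (q k) = IZR k * lam + 1) /\
  (forall t u, t <= u -> phi t <= phi u) /\
  (forall t, phi (t + 2 * PI) = phi t + IZR N * lam).

Lemma piece_p k : piece p (p k) = k.
Proof. apply (piece_unique N); [exact bl_grid_p|]. pose proof (proj1 (proj2 bl_grid_p) k). lra. Qed.

Lemma piece_q k : piece p (q k) = k.
Proof.
  apply (piece_unique N); [exact bl_grid_p|].
  pose proof (bl_pq B k). pose proof (bl_qp B k). lra.
Qed.

Lemma piece_mono t u : t <= u -> (piece p t <= piece p u)%Z.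
Proof.
  intros Htu. pose proof (piece_spec N p t bl_grid_p). pose proof (piece_spec N p u bl_grid_p).
  apply Z.lt_succ_r, (grid_lt_inv N p); [exact bl_grid_p|]. unfold Z.succ. lra.
Qed.

Lemma piece_period t : piece p (t + 2 * PI) = (piece p t + N)%Z.
Proof.
  replace (t + 2 * PI) with (t + 2 * PI * IZR 1) by lra.
  rewrite (piece_shift N p t 1 bl_grid_p). lia.
Qed.

Lemma step_fun_normalized : normalized step_fun.
Proof.
  pose proof (bl_lam B) as Hlam.
  repeat split.
  - intros k. unfold step_fun. rewrite piece_p.
    pose proof (bl_pq B k). destruct (Rlt_dec (p k) (q k)); lra.
  - intros k. unfold step_fun. rewrite piece_q.
    destruct (Rlt_dec (q k) (q k)); lra.
  - intros t u Htu. unfold step_fun.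
    destruct (Z.eq_dec (piece p t) (piece p u)) as [->|Hne].
    + destruct (Rlt_dec t _), (Rlt_dec u _); lra.
    + pose proof (piece_mono t u Htu).
      assert (IZR (piece p t) + 1 <= IZR (piece p u)) by (rewrite <- plus_IZR; apply IZR_le; lia).
      destruct (Rlt_dec t _), (Rlt_dec u _); nra.
  - intros t. unfold step_fun. rewrite piece_period, plus_IZR, (bl_q_per B).
    destruct (Rlt_dec t _), (Rlt_dec (t + 2 * PI) _); lra.
Qed.

Lemma pull_val phi k t : p k <= t < p (k + 1)%Z ->
  pull phi t = IZR k * lam + (phi (tau k t) - IZR (sg k + 1) * lam - 1) / lam.
Proof. intros Ht. unfold pull. rewrite (piece_unique N p t k bl_grid_p Ht). reflexivity. Qed.

Lemma pull_bounds phi t : normalized phi ->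
  IZR (piece p t) * lam <= pull phi t <= (IZR (piece p t) + 1) * lam.
Proof.
  intros (Hp & Hq & Hm & _). unfold pull. set (k := piece p t).
  pose proof (piece_spec N p t bl_grid_p) as Ht. fold k in Ht.
  pose proof (bl_lam B) as Hlam. pose proof (bl_char B) as Hch.
  assert (H1 : IZR (sg k + 1) * lam + 1 <= phi (tau k t)).
  { rewrite <- Hq, <- (bl_pk B). apply Hm, bl_inc_le, Ht. }
  assert (H2 : phi (tau k t) <= IZR (sg k - 1 + N) * lam).
  { rewrite <- Hp, <- (bl_pk1 B). apply Hm, bl_inc_le. lra. }
  rewrite plus_IZR in H1. rewrite plus_IZR, minus_IZR in H2. rewrite plus_IZR.
  set (x := phi (tau k t) - (IZR (sg k) + 1) * lam - 1).
  (* The upper bound is the equation of [lam]: the image of the whole piece has length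
     [(N - 2) * lam - 1 = lam ^ 2]. *)
  assert (0 <= x <= lam * lam) by (unfold x; split; nra).
  assert (0 <= x / lam <= lam).
  { pose proof (div_lam_mul x). split; nra. }
  lra.
Qed.

Lemma pull_normalized phi : normalized phi -> normalized (pull phi).
Proof.
  intros Hphi. pose proof Hphi as (Hp & Hq & Hm & Hper).
  pose proof (bl_lam B) as Hlam. pose proof (bl_char B) as Hch.
  repeat split.
  - intros k. unfold pull. rewrite piece_p, (bl_pk B), Hq.
    replace (_ / lam) with 0; [lra|]. field. lra.
  - intros k. unfold pull. rewrite piece_q, (bl_qk B), Hq, !plus_IZR.
    field. lra.
  - intros t u Htu. destruct (Z.eq_dec (piece p t) (piece p u)) as [He|Hne].
    + unfold pull. rewrite He. set (k := piece p u).
      pose proof (Hm _ _ (bl_inc_le k t u Htu)).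
      assert (0 <= (phi (tau k u) - phi (tau k t)) / lam).
      { apply Rdiv_le_0_compat; lra. }
      unfold Rdiv in *. nra.
    + pose proof (piece_mono t u Htu).
      assert (IZR (piece p t) + 1 <= IZR (piece p u)) by (rewrite <- plus_IZR; apply IZR_le; lia).
      pose proof (pull_bounds phi t Hphi). pose proof (pull_bounds phi u Hphi). nra.
  - intros t. unfold pull.
    rewrite piece_period, (bl_tau_per B), (bl_sg_per B).
    set (k := piece p t). set (x := tau k t).
    replace (phi x) with (phi (x - 2 * PI) + IZR N * lam)
      by (rewrite <- Hper; f_equal; lra).
    rewrite !plus_IZR, minus_IZR. field. lra.
Qed.

Fixpoint approx (n : nat) : R -> R :=
  match n with O => step_fun | S n => pull (approx n) end.

Lemma approx_normalized n : normalized (approx n).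
Proof. induction n; [apply step_fun_normalized | apply pull_normalized; assumption]. Qed.

(** [step_fun] is the least normalized function and [pull] is monotone, so the iterates increase.
    Pointwise convergence then needs no contraction estimate. *)
Lemma approx_incr n t : approx n t <= approx (S n) t.
Proof.
  revert t. induction n as [|n IH]; intros t.
  - pose proof (approx_normalized 1) as (Hp & Hq & Hm & _). change (approx 0 t) with (step_fun t).
    unfold step_fun. set (k := piece p t).
    pose proof (piece_spec N p t bl_grid_p) as Ht. fold k in Ht.
    destruct (Rlt_dec t (q k)).
    + pose proof (Hm _ _ (proj1 Ht)) as H. rewrite Hp in H. lra.
    + assert (q k <= t) as Hqt by lra. pose proof (Hm _ _ Hqt) as H. rewrite Hq in H. lra.
  - change (pull (approx n) t <= pull (approx (S n)) t). unfold pull.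
    set (k := piece p t). pose proof (IH (tau k t)). pose proof (bl_lam B).
    apply Rplus_le_compat_l, Rmult_le_compat_r; [|lra].
    apply Rlt_le, Rinv_0_lt_compat. lra.
Qed.

Lemma approx_bound n t : approx n t <= (IZR (piece p t) + 1) * lam.
Proof.
  eapply Rle_trans; [apply approx_incr|]. apply (pull_bounds (approx n) t), approx_normalized.
Qed.

Definition phi_lim (t : R) : R := real (Lim_seq (fun n => approx n t)).

Lemma phi_lim_is t : is_lim_seq (fun n => approx n t) (phi_lim t).
Proof.
  apply Lim_seq_correct'.
  apply ex_finite_lim_seq_incr with (M := (IZR (piece p t) + 1) * lam).
  - intros n. apply approx_incr.
  - intros n. apply approx_bound.
Qed.

Lemma lim_real_unique (u : nat -> R) (x y : R) : is_lim_seq u x -> is_lim_seq u y -> x = y.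
Proof.
  intros H1 H2. apply is_lim_seq_unique in H1. apply is_lim_seq_unique in H2.
  rewrite H1 in H2. injection H2. auto.
Qed.

Lemma phi_lim_normalized : normalized phi_lim.
Proof.
  repeat split.
  - intros k. apply (lim_real_unique (fun n => approx n (p k))); [apply phi_lim_is|].
    apply is_lim_seq_ext with (fun _ => IZR k * lam); [|apply is_lim_seq_const].
    intros n. symmetry. apply (approx_normalized n).
  - intros k. apply (lim_real_unique (fun n => approx n (q k))); [apply phi_lim_is|].
    apply is_lim_seq_ext with (fun _ => IZR k * lam + 1); [|apply is_lim_seq_const].
    intros n. symmetry. apply (approx_normalized n).
  - intros t u Htu.
    apply (is_lim_seq_le (fun n => approx n t) (fun n => approx n u) (phi_lim t) (phi_lim u));
      [|apply phi_lim_is|apply phi_lim_is].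
    intros n. apply (approx_normalized n), Htu.
  - intros t. apply (lim_real_unique (fun n => approx n (t + 2 * PI))); [apply phi_lim_is|].
    apply is_lim_seq_ext with (fun n => approx n t + IZR N * lam).
    + intros n. symmetry. apply (approx_normalized n).
    + apply (is_lim_seq_plus' _ (fun _ => IZR N * lam)); [apply phi_lim_is | apply is_lim_seq_const].
Qed.

Lemma phi_lim_eq t : phi_lim t = pull phi_lim t.
Proof.
  apply (lim_real_unique (fun n => approx (S n) t)).
  - apply (is_lim_seq_incr_1 (fun n => approx n t)), phi_lim_is.
  - simpl. unfold pull. set (k := piece p t).
    apply (is_lim_seq_plus' (fun _ => IZR k * lam)); [apply is_lim_seq_const|].
    apply (is_lim_seq_scal_r _ (/ lam) (phi_lim (tau k t) - IZR (sg k + 1) * lam - 1)).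
    apply (is_lim_seq_minus' _ (fun _ => 1)); [|apply is_lim_seq_const].
    apply (is_lim_seq_minus' _ (fun _ => IZR (sg k + 1) * lam)); [|apply is_lim_seq_const].
    apply phi_lim_is.
Qed.

Lemma phi_slope_main k t u : p k <= t -> t <= u -> u <= p (k + 1)%Z ->
  phi_lim (tau k u) - phi_lim (tau k t) = lam * (phi_lim u - phi_lim t).
Proof.
  intros H1 H2 H3.
  pose proof (bl_lam B) as Hlam. pose proof (bl_char B) as Hch.
  pose proof phi_lim_normalized as (Hp & Hq & _).
  assert (Hval : forall x, p k <= x <= p (k + 1)%Z ->
    phi_lim (tau k x) = lam * (phi_lim x - IZR k * lam) + IZR (sg k + 1) * lam + 1).
  { intros x [Hx1 [Hx2| ->]].
    - rewrite (phi_lim_eq x), (pull_val phi_lim k x) by lra. field. lra.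
    (* The right end belongs to the next piece, so its value comes from the normalization and the
       equation of [lam], not from [pull]. *)
    - rewrite (bl_pk1 B), !Hp, !plus_IZR, minus_IZR. nra. }
  rewrite !Hval by lra. ring.
Qed.

Lemma phi_shift t m : phi_lim (t + 2 * PI * IZR m) = phi_lim t + IZR m * (IZR N * lam).
Proof.
  pose proof phi_lim_normalized as (_ & _ & _ & Hper).
  assert (Hnat : forall n t, phi_lim (t + 2 * PI * INR n) = phi_lim t + INR n * (IZR N * lam)).
  { induction n as [|n IH]; intros x.
    - simpl. rewrite Rmult_0_r, Rplus_0_r. lra.
    - rewrite S_INR. replace (x + 2 * PI * (INR n + 1)) with (x + 2 * PI * INR n + 2 * PI) by ring.
      rewrite Hper, IH. ring. }
  destruct (Z_le_gt_dec 0 m) as [Hm|Hm].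
  - rewrite <- (Z2Nat.id m Hm), <- INR_IZR_INZ. apply Hnat.
  - pose proof (Hnat (Z.to_nat (- m)) (t + 2 * PI * IZR m)) as H.
    rewrite INR_IZR_INZ, Z2Nat.id, opp_IZR in H by lia.
    replace (t + 2 * PI * IZR m + 2 * PI * - IZR m) with t in H by ring. lra.
Qed.

(** On an overlap arc the fixed point equation governs [tau (k + 1)], not [tau k]. By the vertex
    relation, [lam] times the defect of [tau k] at [x] is the defect of [tau s] at
    [y = tau (k + 1) x], which is again a defect on an overlap arc or zero. Each round therefore
    improves the a priori bound by a factor [lam]. *)
Lemma overlap_defect_bound n k x : p (k + 1)%Z <= x <= q (k + 1)%Z ->
  Rabs (phi_lim (tau k x) - phi_lim (tau k (p (k + 1)%Z))
        - lam * (phi_lim x - phi_lim (p (k + 1)%Z))) <= lam * (/ lam) ^ n.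
Proof.
  pose proof (bl_lam B) as Hlam.
  pose proof phi_lim_normalized as (Hp & Hq & Hm & _).
  revert k x. induction n as [|n IH]; intros k x Hx.
  - rewrite pow_O, Rmult_1_r.
    assert (H1 : 0 <= phi_lim (tau k x) - phi_lim (tau k (p (k + 1)%Z)) <= lam).
    { pose proof (Hm _ _ (bl_inc_le k _ _ (proj1 Hx))).
      pose proof (Hm _ _ (bl_inc_le k _ _ (proj2 Hx))) as H2.
      rewrite (bl_qk1 B), Hp, plus_IZR in H2.
      rewrite (bl_pk1 B), Hp, plus_IZR, minus_IZR in *. lra. }
    assert (H2 : 0 <= phi_lim x - phi_lim (p (k + 1)%Z) <= 1).
    { pose proof (Hm _ _ (proj1 Hx)). pose proof (Hm _ _ (proj2 Hx)). rewrite Hq, Hp in *. lra. }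
    apply Rabs_le. nra.
  - set (s := (sg (k + 1) + 1)%Z). set (r := (sg k - 1 + N)%Z).
    set (y := tau (k + 1)%Z x).
    assert (Hy : q s <= y <= q (s + 1)%Z).
    { unfold y, s. replace (sg (k + 1) + 1 + 1)%Z with (sg (k + 1) + 2)%Z by lia.
      rewrite <- (bl_pk B), <- (bl_qk B).
      split; apply bl_inc_le, Hx. }
    assert (Hr : p r <= tau k x <= p (r + 1)%Z).
    { unfold r. replace (sg k - 1 + N + 1)%Z with (sg k + N)%Z by lia.
      rewrite <- (bl_pk1 B), <- (bl_qk1 B).
      split; apply bl_inc_le, Hx. }
    assert (Hys : tau (k + 1)%Z (p (k + 1)%Z) = q s) by apply (bl_pk B).
    assert (Hrk : tau k (p (k + 1)%Z) = p r) by apply (bl_pk1 B).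
    assert (E1 : phi_lim y - phi_lim (q s) = lam * (phi_lim x - phi_lim (p (k + 1)%Z))).
    { rewrite <- Hys. apply phi_slope_main; try lra.
      pose proof (bl_qp B (k + 1)%Z). lra. }
    assert (E2 : phi_lim (tau r (tau k x)) - phi_lim (tau r (p r))
                 = lam * (phi_lim (tau k x) - phi_lim (p r))).
    { apply phi_slope_main; lra. }
    assert (E3 : phi_lim (tau s y) - phi_lim (tau s (q s))
                 = phi_lim (tau r (tau k x)) - phi_lim (tau r (p r))).
    { destruct (bl_rel B k) as [c Hc]. fold s r in Hc.
      rewrite <- Hys, <- Hrk. unfold y.
      rewrite !Hc by lra. rewrite !phi_shift. ring. }
    pose proof (proj1 (proj2 bl_grid_p) s) as Hps.
    pose proof (bl_pq B s). pose proof (bl_qp B s).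
    (* Up to [p (s + 1)] the slope of [tau s] is already known and the defect is zero; beyond that
       point only the part on the next overlap arc counts. *)
    assert (E4 : Rabs (phi_lim (tau s y) - phi_lim (tau s (q s)) - lam * (phi_lim y - phi_lim (q s)))
                 <= lam * (/ lam) ^ n).
    { destruct (Rle_lt_dec y (p (s + 1)%Z)) as [Hle|Hgt].
      - rewrite (phi_slope_main s (q s) y) by lra. rewrite Rminus_diag, Rabs_R0.
        apply Rmult_le_pos; [lra|]. apply pow_le, Rlt_le, Rinv_0_lt_compat. lra.
      - pose proof (IH s y ltac:(lra)) as H'.
        pose proof (phi_slope_main s (q s) (p (s + 1)%Z)) as H''.
        replace (phi_lim (tau s y) - phi_lim (tau s (q s)) - lam * (phi_lim y - phi_lim (q s)))
          with (phi_lim (tau s y) - phi_lim (tau s (p (s + 1)%Z)) -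
                lam * (phi_lim y - phi_lim (p (s + 1)%Z))); [exact H'|].
        specialize (H'' ltac:(lra) ltac:(lra) ltac:(lra)). nra. }
    rewrite Hrk.
    set (X := phi_lim (tau k x) - phi_lim (p r)) in *.
    set (Y := phi_lim x - phi_lim (p (k + 1)%Z)) in *.
    rewrite E3, E2, E1 in E4.
    replace (lam * (/ lam) ^ S n) with (/ lam * (lam * (/ lam) ^ n)) by (simpl; ring).
    replace (X - lam * Y) with (/ lam * (lam * X - lam * (lam * Y))) by (field; lra).
    rewrite Rabs_mult, (Rabs_pos_eq (/ lam)) by (apply Rlt_le, Rinv_0_lt_compat; lra).
    apply Rmult_le_compat_l; [apply Rlt_le, Rinv_0_lt_compat; lra | exact E4].
Qed.

Lemma geometric_le_0 C x : (forall n, x <= C * (/ lam) ^ n) -> x <= 0.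
Proof.
  intros H. pose proof (bl_lam B) as Hlam.
  apply (is_lim_seq_le (fun _ => x) (fun n => C * (/ lam) ^ n) x 0 H).
  - apply is_lim_seq_const.
  - replace (Finite 0) with (Rbar_mult C 0) by (simpl; f_equal; ring).
    apply is_lim_seq_scal_l, is_lim_seq_geom. rewrite Rabs_pos_eq.
    + rewrite <- Rinv_1. apply Rinv_lt_contravar; lra.
    + apply Rlt_le, Rinv_0_lt_compat. lra.
Qed.

Lemma phi_slope k t u : p k <= t -> t <= u -> u <= q (k + 1)%Z ->
  phi_lim (tau k u) - phi_lim (tau k t) = lam * (phi_lim u - phi_lim t).
Proof.
  assert (Hov : forall x, p (k + 1)%Z <= x <= q (k + 1)%Z ->
    phi_lim (tau k x) - phi_lim (tau k (p (k + 1)%Z)) = lam * (phi_lim x - phi_lim (p (k + 1)%Z))).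
  { intros x Hx. apply Rminus_diag_uniq.
    set (e := _ - lam * _).
    assert (Rabs e <= 0) as He.
    { apply (geometric_le_0 lam). intros n. apply overlap_defect_bound, Hx. }
    pose proof (Rabs_pos e). pose proof (Rle_abs e). pose proof (Rle_abs (- e)).
    rewrite Rabs_Ropp in *. lra. }
  intros H1 H2 H3.
  destruct (Rle_lt_dec u (p (k + 1)%Z)) as [Hu|Hu]; [apply phi_slope_main; lra|].
  destruct (Rle_lt_dec t (p (k + 1)%Z)) as [Ht|Ht].
  - pose proof (Hov u ltac:(lra)). pose proof (phi_slope_main k t (p (k + 1)%Z) H1 Ht ltac:(lra)). lra.
  - pose proof (Hov u ltac:(lra)). pose proof (Hov t ltac:(lra)). lra.
Qed.

Lemma grid_gap a : grid N a -> exists d, 0 < d /\ forall k, d <= a (k + 1)%Z - a k.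
Proof.
  intros Ha. pose proof Ha as (HN & Hinc & _).
  assert (Hfin : forall n, exists d, 0 < d /\
            forall k, (0 <= k < Z.of_nat n)%Z -> d <= a (k + 1)%Z - a k).
  { induction n as [|n (d & Hd & IH)].
    - exists 1. split; [lra|]. intros k Hk. lia.
    - exists (Rmin d (a (Z.of_nat n + 1)%Z - a (Z.of_nat n))). split.
      + apply Rmin_glb_lt; [exact Hd|]. pose proof (Hinc (Z.of_nat n)). lra.
      + intros k Hk. destruct (Z.eq_dec k (Z.of_nat n)) as [->|]; [apply Rmin_r|].
        eapply Rle_trans; [apply Rmin_l | apply IH; lia]. }
  destruct (Hfin (Z.to_nat N)) as (d & Hd & H). exists d. split; [exact Hd|].
  intros k. rewrite Z2Nat.id in H by lia.
  specialize (H (k mod N)%Z (Z.mod_pos_bound k N HN)).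
  pose proof (Z.div_mod k N ltac:(lia)) as Hk.
  replace (a k) with (a (k mod N + k / N * N)%Z) by (f_equal; lia).
  replace (a (k + 1)%Z) with (a (k mod N + 1 + k / N * N)%Z) by (f_equal; lia).
  rewrite !(grid_per N) by exact Ha. lra.
Qed.

(* One step of [tau] divides the oscillation by [lam], while crossing a point [p k] costs at most
   a factor 2. *)
Lemma phi_modulus n : exists d, 0 < d /\ forall t u, t <= u -> u - t < d ->
  phi_lim u - phi_lim t <= 2 * lam * (2 / lam) ^ n.
Proof.
  pose proof (bl_lam B) as Hlam.
  pose proof phi_lim_normalized as (Hp & Hq & Hm & _).
  destruct (grid_gap p bl_grid_p) as (g & Hg & Hgap).
  assert (Hnext : forall t u, t <= u -> u - t < g -> u < p (piece p t + 2)%Z).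
  { intros t u Htu Hd. pose proof (piece_spec N p t bl_grid_p).
    pose proof (Hgap (piece p t + 1)%Z) as H'.
    replace (piece p t + 1 + 1)%Z with (piece p t + 2)%Z in H' by lia. lra. }
  induction n as [|n (d & Hd & IH)].
  - exists g. split; [exact Hg|]. intros t u Htu Hd.
    pose proof (Hm _ _ (Rlt_le _ _ (Hnext t u Htu Hd))) as H1.
    pose proof (Hm _ _ (proj1 (piece_spec N p t bl_grid_p))) as H2.
    rewrite Hp in H1, H2. rewrite plus_IZR in H1. simpl. lra.
  - destruct (bl_lip B) as (L & HL & Hlip).
    exists (Rmin g (d / L)). split.
    { apply Rmin_glb_lt; [exact Hg|]. apply Rdiv_lt_0_compat; assumption. }
    intros t u Htu Hsm.
    assert (Hug : u - t < g) by (eapply Rlt_le_trans; [exact Hsm | apply Rmin_l]).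
    assert (HuL : L * (u - t) < d).
    { assert (u - t < d / L) as H by (eapply Rlt_le_trans; [exact Hsm | apply Rmin_r]).
      apply Rmult_lt_compat_l with (r := L) in H; [|exact HL].
      replace (L * (d / L)) with d in H by (field; lra). exact H. }
    assert (Hone : forall k x y, p k <= x -> x <= y -> y <= p (k + 1)%Z -> t <= x -> y <= u ->
              lam * (phi_lim y - phi_lim x) <= 2 * lam * (2 / lam) ^ n).
    { intros k x y H1 H2 H3 H4 H5. rewrite <- (phi_slope_main k) by lra.
      apply IH; [apply bl_inc_le; exact H2|]. pose proof (Hlip k x y H2).
      assert (L * (y - x) <= L * (u - t)) by (apply Rmult_le_compat_l; lra). lra. }
    set (k := piece p t). pose proof (piece_spec N p t bl_grid_p) as Ht. fold k in Ht.
    pose proof (Hnext t u Htu Hug) as Hu. fold k in Hu.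
    set (X := 2 * lam * (2 / lam) ^ n) in *.
    assert (HX : 0 <= X) by (specialize (Hone k t t); lra).
    replace (2 * lam * (2 / lam) ^ S n) with (2 * (X / lam)) by (unfold X; simpl; field; lra).
    assert (HXl : X = lam * (X / lam)) by (field; lra).
    assert (0 <= X / lam) by (apply Rdiv_le_0_compat; lra).
    destruct (Rle_lt_dec u (p (k + 1)%Z)) as [Hle|Hlt].
    + pose proof (Hone k t u ltac:(lra) Htu Hle ltac:(lra) ltac:(lra)). nra.
    + pose proof (Hone k t (p (k + 1)%Z) ltac:(lra) ltac:(lra) ltac:(lra) ltac:(lra) ltac:(lra)).
      assert (lam * (phi_lim u - phi_lim (p (k + 1)%Z)) <= X).
      { apply (Hone (k + 1)%Z); try lra. replace (k + 1 + 1)%Z with (k + 2)%Z by lia. lra. }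
      nra.
Qed.

Lemma phi_unif_cont eta : 0 < eta -> exists d, 0 < d /\ forall t u, Rabs (u - t) < d ->
  Rabs (phi_lim u - phi_lim t) < eta.
Proof.
  intros Heta. pose proof (bl_lam B) as Hlam.
  pose proof phi_lim_normalized as (_ & _ & Hm & _).
  assert (H0 : 0 <= 2 / lam) by (apply Rdiv_le_0_compat; lra).
  (* The factor 2 lost in each round of [phi_modulus] is harmless because [lam >= 3]. *)
  destruct (pow_lt_1_zero (2 / lam)) with (y := eta / (2 * lam)) as [n Hn].
  - rewrite Rabs_pos_eq by exact H0. apply Rmult_lt_reg_r with lam; [lra|].
    unfold Rdiv. rewrite Rmult_assoc, Rinv_l; lra.
  - apply Rdiv_lt_0_compat; lra.
  - destruct (phi_modulus n) as (d & Hd & Hmod). exists d. split; [exact Hd|].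
    specialize (Hn n (le_n n)). rewrite Rabs_pos_eq in Hn by (apply pow_le; exact H0).
    assert (Hsm : 2 * lam * (2 / lam) ^ n < eta).
    { apply Rmult_lt_compat_l with (r := 2 * lam) in Hn; [|lra].
      replace (2 * lam * (eta / (2 * lam))) with eta in Hn by (field; lra). exact Hn. }
    intros t u Htu. apply Rabs_def2 in Htu.
    destruct (Rle_lt_dec t u) as [Hle|Hlt].
    + pose proof (Hmod t u Hle ltac:(lra)). pose proof (Hm t u Hle). apply Rabs_def1; lra.
    + pose proof (Hmod u t ltac:(lra) ltac:(lra)). pose proof (Hm u t ltac:(lra)). apply Rabs_def1; lra.
Qed.

End Conjugacy.

(** * Counting separated points *)

Lemma incl_map_inv {X Y : Type} (g : X -> Y) (E' : list Y) (E : list X) :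
  incl E' (map g E) -> exists E0, incl E0 E /\ E' = map g E0.
Proof.
  induction E' as [|y E' IH]; intros H.
  - exists nil. split; [intros x [] | reflexivity].
  - destruct IH as (E0 & HE0 & ->); [intros z Hz; apply H; right; exact Hz|].
    destruct (proj1 (in_map_iff g E y) (H y (or_introl eq_refl))) as (x & <- & Hx).
    exists (x :: E0). split; [|reflexivity]. intros z [<-|Hz]; [exact Hx | apply HE0, Hz].
Qed.

Lemma NoDup_map_inj {X Y : Type} (g : X -> Y) (E : list X) :
  (forall x y, In x E -> In y E -> g x = g y -> x = y) -> NoDup E -> NoDup (map g E).
Proof.
  induction E as [|x E IH]; intros Hinj Hnd; [constructor|].
  inversion Hnd; subst. simpl. constructor.
  - intros Hin. apply in_map_iff in Hin. destruct Hin as (y & Hy & HyE).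
    assert (y = x) as -> by (apply Hinj; simpl; auto). contradiction.
  - apply IH; [|assumption]. intros y z Hy Hz. apply Hinj; simpl; auto.
Qed.

(** Pigeonhole over boxes of length [e]: the box number [h] is injective on [E] and at most the
    integer part of [D / e]. *)
Lemma separated_count {X : Type} (G : X -> R) (e x D : R) (E : list X) :
  0 < e -> NoDup E -> (forall t, In t E -> x <= G t <= x + D) ->
  (forall t u, In t E -> In u E -> t <> u -> e <= Rabs (G t - G u)) ->
  0 <= D -> INR (length E) <= 1 + D / e.
Proof.
  intros He Hnd Hin Hsep HD.
  set (h := fun t => Z.to_nat (Int_part ((G t - x) / e))).
  set (M := Z.to_nat (Int_part (D / e))).
  assert (Hpos : forall y, 0 <= y -> (0 <= Int_part y)%Z).
  { intros y Hy. destruct (base_Int_part y) as [_ H].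
    assert (-1 < Int_part y)%Z; [apply lt_IZR; lra | lia]. }
  assert (Hdiv : forall t, In t E -> 0 <= (G t - x) / e <= D / e).
  { intros t Ht. specialize (Hin t Ht). split.
    - apply Rdiv_le_0_compat; lra.
    - apply Rmult_le_compat_r; [|lra]. apply Rlt_le, Rinv_0_lt_compat, He. }
  assert (Hle : (length (map h E) <= S M)%nat).
  { replace (S M) with (length (seq 0 (S M))) by apply length_seq.
    apply NoDup_incl_length.
    - apply NoDup_map_inj; [|exact Hnd]. intros t u Ht Hu Heq. unfold h in Heq.
      apply Z2Nat.inj in Heq; try (apply Hpos, Hdiv; assumption).
      destruct (excluded_middle_informative (t = u)) as [|Hne]; [assumption|exfalso].
      pose proof (Hsep t u Ht Hu Hne) as H.
      destruct (base_Int_part ((G t - x) / e)) as [A1 A2].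
      destruct (base_Int_part ((G u - x) / e)) as [B1 B2]. rewrite Heq in A1, A2.
      set (z := IZR (Int_part ((G u - x) / e))) in *.
      set (gt := (G t - x) / e) in *. set (gu := (G u - x) / e) in *.
      assert (G t - G u = e * (gt - gu)) as Hd by (unfold gt, gu; field; lra).
      assert (Rabs (G t - G u) < e); [|lra]. apply Rabs_def1; nra.
    - intros m Hm. apply in_map_iff in Hm. destruct Hm as (t & <- & Ht). apply in_seq.
      split; [lia|]. unfold h, M. pose proof (Hdiv t Ht) as [H1 H2].
      assert (Int_part ((G t - x) / e) <= Int_part (D / e))%Z.
      { destruct (base_Int_part ((G t - x) / e)). destruct (base_Int_part (D / e)).
        assert (Int_part ((G t - x) / e) < Int_part (D / e) + 1)%Z; [|lia].
        apply lt_IZR. rewrite plus_IZR. lra. }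
      pose proof (Hpos _ H1). lia. }
  rewrite length_map in Hle. apply le_INR in Hle. rewrite S_INR in Hle.
  unfold M in Hle. assert (0 <= D / e) by (apply Rdiv_le_0_compat; lra).
  rewrite (INR_IZR_INZ (Z.to_nat _)), Z2Nat.id in Hle by (apply Hpos; assumption).
  destruct (base_Int_part (D / e)). lra.
Qed.

Lemma filter_split_length {X : Type} (b : X -> bool) (E : list X) :
  length E = (length (filter b E) + length (filter (fun x => negb (b x)) E))%nat.
Proof. induction E as [|x E IH]; simpl; [reflexivity|]. destruct (b x); simpl; lia. Qed.

(** * Itineraries of the lifted boundary map *)

Section Dynamics.
Context (N : Z) (lam : R) (p q : Z -> R) (sg : Z -> Z) (tau : Z -> R -> R).
Context (B : boundary_lift N lam p q sg tau).
Context (a : Z -> R) (Ga : grid N a) (Hpa : forall k, p k <= a k) (Haq : forall k, a k <= q k).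

Let Phi := phi_lim lam p q sg tau.

Definition lift_map (t : R) : R := tau (piece a t) t.

Definition same_itinerary (n : nat) (t u : R) : Prop :=
  forall i, (i < n)%nat -> piece a (Nat.iter i lift_map t) = piece a (Nat.iter i lift_map u).

Lemma lift_map_val k t : a k <= t < a (k + 1)%Z -> lift_map t = tau k t.
Proof. intros Ht. unfold lift_map. rewrite (piece_unique N a t k Ga Ht). reflexivity. Qed.

Lemma phi_slope_piece k t u : a k <= t -> t <= u -> u <= a (k + 1)%Z ->
  Phi (tau k u) - Phi (tau k t) = lam * (Phi u - Phi t).
Proof.
  intros H1 H2 H3. apply (phi_slope N lam p q sg tau B).
  - pose proof (Hpa k). lra.
  - exact H2.
  - pose proof (Haq (k + 1)%Z). lra.
Qed.

(** A bound on the points of [E] in a single cylinder of order [n]. It is inherited by subsets and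
    passes from order [n + 1] on a piece to order [n] on its image, which lets the induction on [n]
    carry it along. *)
Definition class_bound (n : nat) (L : R) (E : list R) : Prop :=
  forall E', NoDup E' -> incl E' E ->
    (forall t u, In t E' -> In u E' -> same_itinerary n t u) -> INR (length E') <= L.

Lemma class_bound_incl n L E E' : incl E' E -> class_bound n L E -> class_bound n L E'.
Proof. intros Hi H E0 Hnd Hi0. apply H; [exact Hnd|]. intros x Hx. apply Hi, Hi0, Hx. Qed.

(** Inside one piece, [tau k] is injective, takes cylinders of order [n + 1] to cylinders of order
    [n], and multiplies [Phi]-length by [lam]; so the bound for order [n] applies to the image. *)
Lemma count_one_piece n L E u v k :
  (forall E u v, NoDup E -> u <= v -> (forall t, In t E -> u <= t < v) -> class_bound n L E ->
    INR (length E) <= L * (2 ^ n + (lam ^ n - 2 ^ n) * (Phi v - Phi u))) ->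
  NoDup E -> u <= v -> (forall t, In t E -> u <= t < v) -> class_bound (S n) L E ->
  a k <= u -> v <= a (k + 1)%Z ->
  INR (length E) <= L * (2 ^ n + (lam ^ n - 2 ^ n) * (lam * (Phi v - Phi u))).
Proof.
  intros IH Hnd Huv HE HL Hu Hv.
  rewrite <- (length_map (tau k) E), <- (phi_slope_piece k) by assumption.
  apply IH.
  - apply NoDup_map_inj; [|exact Hnd]. intros x y _ _ Hxy.
    destruct (Rtotal_order x y) as [H|[H|H]]; [|exact H|];
      apply (bl_inc B k) in H; lra.
  - apply (bl_inc_le _ _ _ _ _ _ B). exact Huv.
  - intros s Hs. apply in_map_iff in Hs. destruct Hs as (t & <- & Ht). specialize (HE t Ht). split.
    + apply (bl_inc_le _ _ _ _ _ _ B). lra.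
    + apply (bl_inc B). lra.
  - intros E' Hnd' Hi Hsame.
    destruct (incl_map_inv _ _ _ Hi) as (E0 & Hi0 & ->).
    rewrite length_map. apply HL; [eapply NoDup_map_inv; exact Hnd' | exact Hi0 |].
    assert (Hpc : forall t, In t E0 -> a k <= t < a (k + 1)%Z).
    { intros t Ht. specialize (HE t (Hi0 t Ht)). lra. }
    intros t t' Ht Ht' [|i] Hi'.
    + simpl. rewrite !(piece_unique N a _ k Ga) by (apply Hpc; assumption). reflexivity.
    + rewrite !Nat.iter_succ_r, !(lift_map_val k) by (apply Hpc; assumption).
      apply Hsame; [apply in_map; assumption | apply in_map; assumption | lia].
Qed.

(** Induction on the number [m] of consecutive pieces that cover the interval: every piece costs one
    summand [2 ^ n], while the [Phi]-lengths add up. *)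
Lemma count_pieces n L : 0 <= L ->
  (forall E u v, NoDup E -> u <= v -> (forall t, In t E -> u <= t < v) -> class_bound n L E ->
    INR (length E) <= L * (2 ^ n + (lam ^ n - 2 ^ n) * (Phi v - Phi u))) ->
  forall m E u v k,
  NoDup E -> u <= v -> (forall t, In t E -> u <= t < v) -> class_bound (S n) L E ->
  a k <= u -> v <= a (k + Z.of_nat m)%Z ->
  INR (length E) <= L * (INR m * 2 ^ n + (lam ^ n - 2 ^ n) * (lam * (Phi v - Phi u))).
Proof.
  intros HL0 IH. pose proof (bl_lam B) as Hlam.
  pose proof (phi_lim_normalized _ _ _ _ _ _ B) as (_ & _ & Hm & _). fold Phi in Hm.
  assert (H2n : 0 <= 2 ^ n) by (apply pow_le; lra).
  assert (Hln : 0 <= lam ^ n - 2 ^ n) by (pose proof (pow_incr 2 lam n); lra).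
  induction m as [|m IHm]; intros E u v k Hnd Huv HE HL Hu Hv.
  - replace (k + Z.of_nat 0)%Z with k in Hv by lia.
    destruct E as [|t E]; [|specialize (HE t (or_introl eq_refl)); lra].
    simpl. pose proof (Hm u v Huv). rewrite Rmult_0_l, Rplus_0_l.
    repeat apply Rmult_le_pos; lra.
  - rewrite S_INR. pose proof (pos_INR m).
    assert (0 <= INR m * 2 ^ n) by (apply Rmult_le_pos; assumption).
    destruct (Rle_lt_dec v (a (k + 1)%Z)) as [Hv1|Hv1].
    { pose proof (count_one_piece n L E u v k IH Hnd Huv HE HL Hu Hv1) as H1.
      eapply Rle_trans; [exact H1|]. apply Rmult_le_compat_l; [exact HL0|]. lra. }
    replace (k + Z.of_nat (S m))%Z with (k + 1 + Z.of_nat m)%Z in Hv by lia.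
    destruct (Rle_lt_dec (a (k + 1)%Z) u) as [Hu1|Hu1].
    { pose proof (IHm E u v (k + 1)%Z Hnd Huv HE HL Hu1 Hv) as H1.
      eapply Rle_trans; [exact H1|]. apply Rmult_le_compat_l; [exact HL0|]. lra. }
    set (b := fun t => if Rlt_dec t (a (k + 1)%Z) then true else false).
    rewrite (filter_split_length b E), plus_INR.
    pose proof (count_one_piece n L (filter b E) u (a (k + 1)%Z) k IH) as H1.
    pose proof (IHm (filter (fun x => negb (b x)) E) (a (k + 1)%Z) v (k + 1)%Z) as H2.
    assert (Hb1 : forall t, In t (filter b E) -> In t E /\ t < a (k + 1)%Z).
    { intros t Ht. apply filter_In in Ht. unfold b in Ht. destruct (Rlt_dec t (a (k + 1)%Z)).
      - tauto.
      - destruct Ht; discriminate. }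
    assert (Hb2 : forall t, In t (filter (fun x => negb (b x)) E) -> In t E /\ a (k + 1)%Z <= t).
    { intros t Ht. apply filter_In in Ht. unfold b in Ht. destruct (Rlt_dec t (a (k + 1)%Z)).
      - destruct Ht; discriminate.
      - split; [tauto | lra]. }
    specialize (H1 (NoDup_filter _ Hnd) ltac:(lra)).
    specialize (H2 (NoDup_filter _ Hnd) ltac:(lra)).
    assert (H1' : INR (length (filter b E)) <=
      L * (2 ^ n + (lam ^ n - 2 ^ n) * (lam * (Phi (a (k + 1)%Z) - Phi u)))).
    { apply H1.
      - intros t Ht. destruct (Hb1 t Ht) as [Hin Hlt]. specialize (HE t Hin). lra.
      - apply (class_bound_incl _ _ E); [|exact HL]. intros t Ht. apply Hb1, Ht.
      - exact Hu.
      - lra. }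
    assert (H2' : INR (length (filter (fun x => negb (b x)) E)) <=
      L * (INR m * 2 ^ n + (lam ^ n - 2 ^ n) * (lam * (Phi v - Phi (a (k + 1)%Z))))).
    { apply H2.
      - intros t Ht. destruct (Hb2 t Ht) as [Hin Hle]. specialize (HE t Hin). lra.
      - apply (class_bound_incl _ _ E); [|exact HL]. intros t Ht. apply Hb2, Ht.
      - lra.
      - exact Hv. }
    eapply Rle_trans; [apply Rplus_le_compat; [exact H1' | exact H2']|].
    apply Req_le. ring.
Qed.

(** The form of the bound is made for the recursion. An interval of length [l] meets at most [2 + l]
    pieces, and [(2 + l) * 2 ^ n + (lam ^ n - 2 ^ n) * lam * l] is at most [2 ^ (n + 1) + (lam ^ (n
    + 1) - 2 ^ (n + 1)) * l] exactly because [(lam - 3) * 2 ^ n * l >= 0]. *)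
Lemma count_itineraries n : forall L E u v, 0 <= L ->
  NoDup E -> u <= v -> (forall t, In t E -> u <= t < v) -> class_bound n L E ->
  INR (length E) <= L * (2 ^ n + (lam ^ n - 2 ^ n) * (Phi v - Phi u)).
Proof.
  pose proof (bl_lam B) as Hlam.
  pose proof (phi_lim_normalized _ _ _ _ _ _ B) as (Hp & Hq & Hm & _). fold Phi in Hp, Hq, Hm.
  induction n as [|n IH]; intros L E u v HL0 Hnd Huv HE HL.
  - simpl. rewrite Rminus_diag, Rmult_0_l, Rplus_0_r, Rmult_1_r.
    apply HL; [exact Hnd | intros x Hx; exact Hx|]. intros t t' _ _ i Hi. lia.
  - set (k := piece a u). set (j := piece a v).
    pose proof (piece_spec N a u Ga) as Hk. fold k in Hk.
    pose proof (piece_spec N a v Ga) as Hj. fold j in Hj.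
    assert (Hkj : (k <= j)%Z).
    { apply Z.lt_succ_r, (grid_lt_inv N a); [exact Ga|]. unfold Z.succ. lra. }
    pose proof (count_pieces n L HL0 (fun E u v => IH L E u v HL0) (Z.to_nat (j - k + 1)) E u v k
      Hnd Huv HE HL (proj1 Hk)) as H.
    rewrite Z2Nat.id in H by lia.
    replace (k + (j - k + 1))%Z with (j + 1)%Z in H by lia. specialize (H ltac:(lra)).
    rewrite (INR_IZR_INZ (Z.to_nat _)), Z2Nat.id in H by lia.
    (* If [j >= k + 2], the arc from [q (k + 1)] to [p j] lies between [u] and [v] and has length
       [(j - k - 1) * lam - 1]. *)
    assert (Hlen : IZR (j - k + 1) - 2 <= Phi v - Phi u).
    { rewrite plus_IZR, minus_IZR.
      destruct (Z.eq_dec k j) as [->|Hne]; [pose proof (Hm u v Huv); lra|].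
      destruct (Z.eq_dec (k + 1) j) as [<-|Hne2]; [rewrite plus_IZR; pose proof (Hm u v Huv); lra|].
      pose proof (Hm _ _ (Rle_trans _ _ _ (Hpa j) (proj1 Hj))) as H1.
      pose proof (Hm _ _ (Rlt_le _ _ (Rlt_le_trans _ _ _ (proj2 Hk) (Haq (k + 1)%Z)))) as H2.
      rewrite Hp in H1. rewrite Hq, plus_IZR in H2.
      assert (IZR k + 2 <= IZR j) by (rewrite <- plus_IZR; apply IZR_le; lia). nra. }
    eapply Rle_trans; [exact H|]. apply Rmult_le_compat_l; [exact HL0|].
    assert (H2n : 0 <= 2 ^ n) by (apply pow_le; lra).
    pose proof (Hm u v Huv).
    assert (0 <= (lam - 3) * (2 ^ n * (Phi v - Phi u))) by
      (apply Rmult_le_pos; [lra|]; apply Rmult_le_pos; lra).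
    assert (2 ^ n * (IZR (j - k + 1) - 2) <= 2 ^ n * (Phi v - Phi u)) by
      (apply Rmult_le_compat_l; lra).
    simpl. nra.
Qed.

Lemma same_itinerary_lt n t u i : same_itinerary n t u -> t < u -> (i <= n)%nat ->
  Nat.iter i lift_map t < Nat.iter i lift_map u.
Proof.
  intros Hs Htu. induction i as [|i IH]; intros Hi; [exact Htu|].
  rewrite !Nat.iter_succ. unfold lift_map at 1 3. rewrite (Hs i) by lia.
  apply (bl_inc B), IH. lia.
Qed.

Lemma grid_piece_length k : a (k + 1)%Z - a k <= 2 * PI.
Proof.
  pose proof (bl_N B). pose proof (proj2 (proj2 Ga) k).
  pose proof (grid_le N a (k + 1) (k + N) Ga ltac:(lia)). lra.
Qed.

(** On a cylinder the iterates preserve order, so the differences of two orbits all have the same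
    sign. The sum is thus one real coordinate whose differences dominate the distance at each of the
    [n] times, and separated points get separated sums. *)
Fixpoint orbit_sum (n : nat) (t : R) : R :=
  match n with O => 0 | S n => orbit_sum n t + Nat.iter n lift_map t end.

Lemma orbit_sum_lt n t u : same_itinerary n t u -> t < u -> forall m, (m <= n)%nat ->
  0 <= orbit_sum m u - orbit_sum m t <= 2 * PI * INR m /\
  (forall i, (i < m)%nat ->
    Nat.iter i lift_map u - Nat.iter i lift_map t <= orbit_sum m u - orbit_sum m t).
Proof.
  intros Hs Htu. induction m as [|m IH]; intros Hmn.
  - simpl. split; [lra|]. intros i Hi. lia.
  - destruct (IH ltac:(lia)) as [H1 H2].
    pose proof (same_itinerary_lt n t u m Hs Htu ltac:(lia)) as Hlt.
    pose proof (piece_spec N a (Nat.iter m lift_map t) Ga) as P1.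
    pose proof (piece_spec N a (Nat.iter m lift_map u) Ga) as P2.
    rewrite <- (Hs m) in P2 by lia.
    pose proof (grid_piece_length (piece a (Nat.iter m lift_map t))).
    rewrite S_INR. simpl orbit_sum. split; [lra|].
    intros i Hi. destruct (Nat.eq_dec i m) as [->|]; [lra|]. specialize (H2 i ltac:(lia)). lra.
Qed.

Lemma class_count n e E : 0 < e -> NoDup E ->
  (forall t u, In t E -> In u E -> same_itinerary n t u) ->
  (forall t u, In t E -> In u E -> t <> u -> exists i, (i < n)%nat /\
    e <= Rabs (Nat.iter i lift_map t - Nat.iter i lift_map u)) ->
  INR (length E) <= 1 + 4 * PI * INR n / e.
Proof.
  intros He Hnd Hs Hsep. pose proof PI_RGT_0. pose proof (pos_INR n).
  destruct E as [|t0 E0].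
  { simpl. assert (0 <= 4 * PI * INR n / e); [|lra]. apply Rdiv_le_0_compat; [|exact He].
    apply Rmult_le_pos; lra. }
  set (E := t0 :: E0) in *.
  (* Points may lie on either side of [t0], each at most [2 * PI * n] away in [orbit_sum]; hence an
     interval of length [4 * PI * n]. *)
  apply (separated_count (orbit_sum n) e (orbit_sum n t0 - 2 * PI * INR n)).
  - exact He.
  - exact Hnd.
  - intros t Ht. destruct (Rtotal_order t t0) as [Hlt|[->|Hlt]].
    + pose proof (proj1 (orbit_sum_lt n t t0 (Hs t t0 Ht (or_introl eq_refl)) Hlt n (le_n n))). lra.
    + assert (0 <= PI * INR n) by (apply Rmult_le_pos; lra). lra.
    + pose proof (proj1 (orbit_sum_lt n t0 t (Hs t0 t (or_introl eq_refl) Ht) Hlt n (le_n n))). lra.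
  - assert (Hlt : forall t u, In t E -> In u E -> t < u -> e <= orbit_sum n u - orbit_sum n t).
    { intros t u Ht Hu Hlt. destruct (Hsep t u Ht Hu ltac:(lra)) as (i & Hi & Hd).
      pose proof (proj2 (orbit_sum_lt n t u (Hs t u Ht Hu) Hlt n (le_n n)) i Hi).
      pose proof (same_itinerary_lt n t u i (Hs t u Ht Hu) Hlt ltac:(lia)).
      rewrite Rabs_left in Hd by lra. lra. }
    intros t u Ht Hu Hne. destruct (Rtotal_order t u) as [H1|[H1|H1]]; [|contradiction|].
    + specialize (Hlt t u Ht Hu H1). rewrite Rabs_left; lra.
    + specialize (Hlt u t Hu Ht H1). rewrite Rabs_pos_eq; lra.
  - apply Rmult_le_pos; lra.
Qed.

Lemma separated_upper n e E : 0 < e -> NoDup E -> (forall t, In t E -> a 0%Z <= t < a 0%Z + 2 * PI) ->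
  (forall t u, In t E -> In u E -> t <> u -> exists i, (i < n)%nat /\
    e <= Rabs (Nat.iter i lift_map t - Nat.iter i lift_map u)) ->
  INR (length E) <= (1 + 4 * PI * INR n / e) * ((1 + IZR N * lam) * lam ^ n).
Proof.
  intros He Hnd HE Hsep. pose proof PI_RGT_0. pose proof (pos_INR n).
  pose proof (bl_lam B) as Hlam.
  assert (HL : 0 <= 1 + 4 * PI * INR n / e).
  { assert (0 <= 4 * PI * INR n / e); [|lra]. apply Rdiv_le_0_compat; [|exact He].
    apply Rmult_le_pos; lra. }
  pose proof (count_itineraries n _ E (a 0%Z) (a 0%Z + 2 * PI) HL Hnd ltac:(lra) HE) as Hc.
  eapply Rle_trans; [apply Hc|].
  - intros E' Hnd' Hi Hs. apply class_count; try assumption.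
    intros t u Ht Hu. apply Hsep; apply Hi; assumption.
  - apply Rmult_le_compat_l; [exact HL|].
    pose proof (phi_lim_normalized _ _ _ _ _ _ B) as (_ & _ & _ & Hper). fold Phi in Hper.
    rewrite Hper. replace (Phi (a 0%Z) + IZR N * lam - Phi (a 0%Z)) with (IZR N * lam) by ring.
    assert (0 <= 2 ^ n) by (apply pow_le; lra). pose proof (pow_incr 2 lam n ltac:(lra)).
    assert (12 <= IZR N) by (apply IZR_le, (bl_N B)).
    assert (0 <= 2 ^ n * (IZR N * lam)) by (apply Rmult_le_pos; [lra | apply Rmult_le_pos; lra]).
    lra.
Qed.

(** Closeness modulo [N * lam], the [Phi]-length of the circle, since closeness of points on the
    circle says nothing about full turns of their lifts. *)
Definition phi_near (eta t u : R) : Prop :=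
  exists m : Z, Rabs (Phi t - Phi u - IZR m * (IZR N * lam)) < eta.

(* The images of the two sides of a discontinuity [a (k + 1)] are almost antipodal for [Phi], so two
   nearby points with nearby images lie in the same piece. *)
Lemma near_expand_le eta t u : 0 < eta -> eta * lam <= / 4 -> t <= u -> Phi u - Phi t < eta ->
  phi_near eta (lift_map t) (lift_map u) ->
  Phi (lift_map u) - Phi (lift_map t) = lam * (Phi u - Phi t).
Proof.
  intros Heta Hsm Htu Hd [m Hnear]. apply Rabs_def2 in Hnear.
  pose proof (bl_lam B) as Hlam.
  pose proof (phi_lim_normalized _ _ _ _ _ _ B) as (Hp & Hq & Hm & _). fold Phi in Hp, Hq, Hm.
  set (k := piece a t). pose proof (piece_spec N a t Ga) as Ht. fold k in Ht.
  pose proof (piece_spec N a u Ga) as Hu. set (j := piece a u) in *.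
  assert (Hkj : (k <= j)%Z).
  { apply Z.lt_succ_r, (grid_lt_inv N a); [exact Ga|]. unfold Z.succ. lra. }
  destruct (Z.eq_dec k j) as [Hj|Hne].
  { rewrite (lift_map_val k t) by exact Ht. rewrite (lift_map_val k u) by (rewrite Hj; exact Hu).
    apply phi_slope_piece; [lra | exact Htu |]. rewrite <- Hj in Hu. lra. }
  exfalso. destruct (Z.eq_dec j (k + 1)) as [Hj|Hne2].
  - rewrite (lift_map_val k t) in Hnear by exact Ht.
    rewrite (lift_map_val (k + 1) u) in Hnear by (rewrite <- Hj; exact Hu).
    rewrite Hj in Hu.
    pose proof (phi_slope_piece k t (a (k + 1)%Z) ltac:(lra) ltac:(lra) ltac:(lra)) as S1.
    pose proof (phi_slope_piece (k + 1) (a (k + 1)%Z) u ltac:(lra) ltac:(lra) ltac:(lra)) as S2.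
    pose proof (Hm _ _ (bl_inc_le _ _ _ _ _ _ B k _ _ (Hpa (k + 1)%Z))) as L1.
    pose proof (Hm _ _ (bl_inc_le _ _ _ _ _ _ B k _ _ (Haq (k + 1)%Z))) as U1.
    pose proof (Hm _ _ (bl_inc_le _ _ _ _ _ _ B (k + 1)%Z _ _ (Hpa (k + 1)%Z))) as L2.
    pose proof (Hm _ _ (bl_inc_le _ _ _ _ _ _ B (k + 1)%Z _ _ (Haq (k + 1)%Z))) as U2.
    rewrite (bl_pk1 B), Hp in L1. rewrite (bl_qk1 B), Hp in U1.
    rewrite (bl_pk B), Hq in L2. rewrite (bl_qk B), Hq in U2.
    (* The two images of [a (k + 1)] differ in [Phi] by a value between
       [(m0 * N + N / 2 - 2) * lam - 1] and [(m0 * N + N / 2) * lam - 1]. As [N >= 12], this stays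
       away from [m0] and [m0 + 1] full turns even after the corrections [Hx] and [Hy], which
       excludes every [m]. *)
    destruct (bl_gap B k) as [m0 Hgap].
    pose proof (bl_N B) as HN.
    pose proof (Z.div_mod N 2 ltac:(lia)). pose proof (Z.mod_pos_bound N 2 ltac:(lia)).
    assert (Hr : (sg k + N = sg (k + 1) + 1 + m0 * N + N / 2)%Z) by lia.
    apply (f_equal IZR) in Hr. rewrite !plus_IZR, mult_IZR in Hr.
    rewrite !plus_IZR in *. rewrite minus_IZR in *.
    pose proof (Hm _ _ (proj2 (conj I (Rlt_le _ _ (proj2 Ht))))) as Hm1.
    pose proof (Hm _ _ (proj1 Hu)) as Hm2.
    assert (Hx : 0 <= lam * (Phi (a (k + 1)%Z) - Phi t) <= / 4) by nra.
    assert (Hy : 0 <= lam * (Phi u - Phi (a (k + 1)%Z)) <= / 4) by nra.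
    assert (HNr : 12 <= IZR N) by (apply IZR_le; exact HN).
    destruct (Z_le_gt_dec m m0) as [Hmm|Hmm].
    + assert (0 <= (IZR m0 - IZR m) * (IZR N * lam)).
      { apply Rmult_le_pos; [apply IZR_le in Hmm; lra | apply Rmult_le_pos; lra]. }
      assert (6 <= IZR (N / 2)) by (apply IZR_le; lia). nra.
    + assert (HmR : IZR m0 + 1 <= IZR m) by (rewrite <- plus_IZR; apply IZR_le; lia).
      assert (0 <= (IZR m - IZR m0 - 1) * (IZR N * lam)).
      { apply Rmult_le_pos; [lra | apply Rmult_le_pos; lra]. }
      assert (IZR (N / 2) + 6 <= IZR N) by (rewrite <- plus_IZR; apply IZR_le; lia). nra.
  (* If a whole piece is skipped, the arc from [q (k + 1)] to [p (k + 2)], of length [lam - 1],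
     separates [t] from [u]. *)
  - assert (Hk2 : (k + 1 + 1 <= j)%Z) by lia.
    pose proof (grid_le N a _ _ Ga Hk2).
    pose proof (Hpa (k + 1 + 1)%Z). pose proof (Haq (k + 1)%Z).
    assert (K1 : p (k + 1 + 1)%Z <= u) by lra. assert (K2 : t <= q (k + 1)%Z) by lra.
    apply Hm in K1. apply Hm in K2. rewrite Hp, !plus_IZR in K1. rewrite Hq, plus_IZR in K2. nra.
Qed.

Lemma near_expand eta t u : 0 < eta -> eta * lam <= / 4 -> Rabs (Phi t - Phi u) < eta ->
  phi_near eta (lift_map t) (lift_map u) ->
  Phi (lift_map t) - Phi (lift_map u) = lam * (Phi t - Phi u).
Proof.
  intros Heta Hsm Hd Hnear. apply Rabs_def2 in Hd. destruct (Rle_lt_dec t u) as [Htu|Htu].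
  - pose proof (near_expand_le eta t u Heta Hsm Htu ltac:(lra) Hnear). lra.
  - assert (Hnear' : phi_near eta (lift_map u) (lift_map t)).
    { destruct Hnear as [m Hnear]. exists (- m)%Z. rewrite opp_IZR, <- Rabs_Ropp.
      replace (- (Phi (lift_map u) - Phi (lift_map t) - - IZR m * (IZR N * lam))) with
        (Phi (lift_map t) - Phi (lift_map u) - IZR m * (IZR N * lam)) by ring. exact Hnear. }
    apply near_expand_le with (2 := Hsm) (5 := Hnear'); lra.
Qed.

Lemma near_small eta t u : eta <= / 4 -> Rabs (Phi t - Phi u) <= / 4 -> phi_near eta t u ->
  Rabs (Phi t - Phi u) < eta.
Proof.
  intros He Hd [m Hm]. pose proof (bl_lam B) as Hlam.
  assert (12 <= IZR N) by (apply IZR_le, (bl_N B)).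
  assert (36 <= IZR N * lam) by nra.
  destruct (Z.eq_dec m 0) as [->|Hne]; [rewrite Rmult_0_l, Rminus_0_r in Hm; exact Hm|].
  exfalso. apply Rabs_def2 in Hm.
  pose proof (Rle_abs (Phi t - Phi u)). pose proof (Rle_abs (- (Phi t - Phi u))).
  rewrite Rabs_Ropp in *.
  destruct (Z_lt_le_dec m 0).
  - assert (IZR m <= -1) by (apply IZR_le; lia). nra.
  - assert (1 <= IZR m) by (apply IZR_le; lia). nra.
Qed.

(** While the orbits stay near, [near_expand] multiplies the difference by [lam] and [near_small]
    brings it back below [eta], so after [n] steps the magnified difference is still below [eta]. *)
Lemma near_orbit eta n : 0 < eta -> eta * lam <= / 4 -> forall t u,
  (forall i, (i <= n)%nat -> phi_near eta (Nat.iter i lift_map t) (Nat.iter i lift_map u)) ->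
  Rabs (Phi t - Phi u) < eta -> lam ^ n * Rabs (Phi t - Phi u) < eta.
Proof.
  intros Heta Hsm. pose proof (bl_lam B) as Hlam.
  induction n as [|n IH]; intros t u Hnear Hd; [simpl; lra|].
  pose proof (near_expand eta t u Heta Hsm Hd (Hnear 1%nat ltac:(lia))) as Hexp.
  assert (Habs : Rabs (Phi (lift_map t) - Phi (lift_map u)) = lam * Rabs (Phi t - Phi u)).
  { rewrite Hexp, Rabs_mult, (Rabs_pos_eq lam); lra. }
  replace (lam ^ S n * Rabs (Phi t - Phi u)) with (lam ^ n * (lam * Rabs (Phi t - Phi u)))
    by (simpl; ring).
  rewrite <- Habs. apply IH.
  - intros i Hi. rewrite <- !Nat.iter_succ_r. apply Hnear. lia.
  - apply near_small; [nra | rewrite Habs; nra | exact (Hnear 1%nat ltac:(lia))].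
Qed.

Lemma phi_value y : 0 <= y <= 1 -> exists t, Phi t = y.
Proof.
  intros Hy. pose proof (phi_lim_normalized _ _ _ _ _ _ B) as (Hp & Hq & _). fold Phi in Hp, Hq.
  destruct (IVT_gen Phi (p 0%Z) (q 0%Z) y) as (t & _ & Ht).
  - intros t e He. destruct (phi_unif_cont N lam p q sg tau B e He) as (d & Hd & Hc).
    exists d. split; [exact Hd|]. intros x [_ Hx]. apply Hc, Hx.
  - rewrite Hp, Hq, Rmin_left, Rmax_right; lra.
  - exists t. exact Ht.
Qed.

Lemma spread_points eta n : 0 < eta -> eta * lam <= / 4 -> exists E : list R,
  lam ^ n <= INR (length E) /\
  forall i j, (i < j < length E)%nat -> exists m, (m <= n)%nat /\
    ~ phi_near eta (Nat.iter m lift_map (nth i E 0)) (Nat.iter m lift_map (nth j E 0)).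
Proof.
  intros Heta Hsm. pose proof (bl_lam B) as Hlam.
  assert (Hln : 1 <= lam ^ n) by (apply pow_R1_Rle; lra).
  assert (Hetas : eta <= / 4) by nra.
  (* The spacing [eta / lam ^ n] is what [near_orbit] denies to two points that are never separated.
     The more than [lam ^ n] values needed fit into [[0, eta]], within the range given by
     [phi_value]. *)
  set (x := fun j : nat => epsilon (inhabits 0) (fun t => Phi t = INR j * (eta / lam ^ n))).
  destruct (archimed (lam ^ n)) as [HM1 HM2].
  assert (HM0 : (0 <= up (lam ^ n))%Z) by (apply le_IZR; lra).
  set (M := Z.to_nat (up (lam ^ n))).
  assert (HM : INR M = IZR (up (lam ^ n))) by (unfold M; rewrite INR_IZR_INZ, Z2Nat.id; auto).
  assert (Hstep : 0 < eta / lam ^ n) by (apply Rdiv_lt_0_compat; lra).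
  assert (Hle : forall j, (j < M)%nat -> INR j * (eta / lam ^ n) <= eta).
  { intros j Hj. assert (INR (S j) <= INR M) by (apply le_INR; lia). rewrite S_INR in *.
    replace eta with (lam ^ n * (eta / lam ^ n)) at 2 by (field; lra).
    apply Rmult_le_compat_r; lra. }
  assert (Hx : forall j, (j < M)%nat -> Phi (x j) = INR j * (eta / lam ^ n)).
  { intros j Hj. unfold x. apply epsilon_spec. apply phi_value. split.
    - apply Rmult_le_pos; [apply pos_INR | lra].
    - specialize (Hle j Hj). lra. }
  exists (map x (seq 0 M)). rewrite length_map, length_seq. split; [lra|].
  intros i j Hij.
  rewrite (nth_indep _ 0 (x 0%nat)) by (rewrite length_map, length_seq; lia).
  rewrite (nth_indep (map x (seq 0 M)) 0 (x 0%nat) (n := j)) by (rewrite length_map, length_seq; lia).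
  rewrite !map_nth, !seq_nth, !Nat.add_0_l by lia.
  apply NNPP. intros Hno.
  assert (Hnear : forall m, (m <= n)%nat ->
    phi_near eta (Nat.iter m lift_map (x i)) (Nat.iter m lift_map (x j))).
  { intros m Hm. apply NNPP. intros Hc. apply Hno. exists m. split; assumption. }
  assert (Hdiff : Rabs (Phi (x i) - Phi (x j)) = (INR j - INR i) * (eta / lam ^ n)).
  { rewrite !Hx by lia. rewrite <- Rabs_Ropp, Rabs_pos_eq; [ring|].
    assert (INR i <= INR j) by (apply le_INR; lia).
    assert (0 <= (INR j - INR i) * (eta / lam ^ n)) by (apply Rmult_le_pos; lra). lra. }
  assert (Hji : INR i + 1 <= INR j) by (rewrite <- S_INR; apply le_INR; lia).
  assert (Hsmall : Rabs (Phi (x i) - Phi (x j)) < eta).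
  { apply near_small; [exact Hetas | | exact (Hnear 0%nat ltac:(lia))].
    rewrite Hdiff. pose proof (Hle j ltac:(lia)).
    assert (0 <= INR i * (eta / lam ^ n)) by (apply Rmult_le_pos; [apply pos_INR | lra]). lra. }
  pose proof (near_orbit eta n Heta Hsm _ _ Hnear Hsmall) as H. rewrite Hdiff in H.
  replace (lam ^ n * ((INR j - INR i) * (eta / lam ^ n))) with ((INR j - INR i) * eta) in H
    by (field; lra).
  nra.
Qed.

End Dynamics.

(** * The circle and its universal cover *)

Lemma cexp_dist_sq t u : (Cmod (cexp_i t - cexp_i u)%C) ^ 2 = 2 - 2 * cos (t - u).
Proof.
  unfold Cmod, cexp_i. rewrite pow2_sqrt by (apply Rplus_le_le_0_compat; apply pow2_ge_0). simpl.
  rewrite cos_minus. pose proof (sin2_cos2 t). pose proof (sin2_cos2 u). unfold Rsqr in *. nra.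
Qed.

Lemma cexp_dist_le t u : Cmod (cexp_i t - cexp_i u)%C <= Rabs (t - u).
Proof.
  apply Rsqr_incr_0_var; [|apply Rabs_pos]. rewrite <- Rsqr_abs. rewrite !Rsqr_pow2, cexp_dist_sq.
  assert (Hs : Rabs (sin ((t - u) / 2)) <= Rabs ((t - u) / 2)).
  { assert (Hpos : forall x, 0 <= x -> Rabs (sin x) <= x).
    { intros x Hx. destruct (Rle_lt_dec 1 x) as [H|H].
      - pose proof (SIN_bound x). apply Rabs_le. lra.
      - destruct Hx as [Hx| <-]; [|rewrite sin_0, Rabs_R0; lra].
        pose proof (sin_lt_x x Hx). pose proof PI2_1.
        pose proof (sin_gt_0 x Hx ltac:(pose proof PI_RGT_0; lra)). rewrite Rabs_pos_eq; lra. }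
    destruct (Rle_lt_dec 0 ((t - u) / 2)) as [H|H].
    - rewrite (Rabs_pos_eq ((t - u) / 2)) by exact H. apply Hpos, H.
    - rewrite (Rabs_left ((t - u) / 2)) by exact H.
      rewrite <- Rabs_Ropp, <- sin_neg. apply Hpos. lra. }
  replace (t - u) with (2 * ((t - u) / 2)) at 1 by field. rewrite cos_2a_sin.
  apply Rsqr_le_abs_1 in Hs. unfold Rsqr in Hs. nra.
Qed.

Lemma cexp_periodic t m : cexp_i (t + 2 * PI * IZR m) = cexp_i t.
Proof.
  assert (Hnat : forall n x, cexp_i (x + 2 * PI * INR n) = cexp_i x).
  { intros n x. unfold cexp_i. replace (2 * PI * INR n) with (2 * INR n * PI) by ring.
    rewrite cos_period, sin_period. reflexivity. }
  destruct (Z_le_gt_dec 0 m) as [Hm|Hm].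
  - rewrite <- (Z2Nat.id m Hm), <- INR_IZR_INZ. apply Hnat.
  - rewrite <- (Hnat (Z.to_nat (- m)) (t + 2 * PI * IZR m)).
    rewrite INR_IZR_INZ, Z2Nat.id, opp_IZR by lia. f_equal. ring.
Qed.

Lemma cos_periodic t m : cos (t + 2 * PI * IZR m) = cos t.
Proof. exact (f_equal fst (cexp_periodic t m)). Qed.

Lemma sin_periodic t m : sin (t + 2 * PI * IZR m) = sin t.
Proof. exact (f_equal snd (cexp_periodic t m)). Qed.

Lemma real_mod (x c d : R) : 0 < d -> exists m : Z, c <= x + d * IZR m < c + d.
Proof.
  intros Hd. exists (- Int_part ((x - c) / d))%Z. rewrite opp_IZR.
  destruct (base_Int_part ((x - c) / d)) as [H1 H2].
  set (z := IZR (Int_part ((x - c) / d))) in *. set (y := (x - c) / d) in *.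
  assert (Hx : x = c + d * y) by (unfold y; field; lra). rewrite Hx. nra.
Qed.

Lemma circle_angle (x y : R) : x ^ 2 + y ^ 2 = 1 -> exists t, x = cos t /\ y = sin t.
Proof.
  intros H. assert (Hx : -1 <= x <= 1) by nra.
  assert (Hs : sin (acos x) = Rabs y).
  { rewrite sin_acos by exact Hx. replace (1 - x²) with (y²) by (unfold Rsqr; nra). apply sqrt_Rsqr_abs. }
  destruct (Rle_lt_dec 0 y) as [Hy|Hy].
  - exists (acos x). rewrite cos_acos, Hs, Rabs_pos_eq; auto.
  - exists (- acos x). rewrite cos_neg, sin_neg, cos_acos, Hs, Rabs_left by auto. split; ring.
Qed.

Lemma on_circle_angle (z : C) (c : R) : on_circle z -> exists t, z = cexp_i t /\ c <= t < c + 2 * PI.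
Proof.
  intros Hz. destruct z as [x y]. unfold on_circle, Cmod in Hz. simpl in Hz.
  assert (x ^ 2 + y ^ 2 = 1).
  { rewrite <- (pow2_sqrt (x ^ 2 + y ^ 2)) by nra. simpl. rewrite Hz. ring. }
  destruct (circle_angle x y H) as (t & -> & ->).
  destruct (real_mod t c (2 * PI)) as [m Hm]; [pose proof PI_RGT_0; lra|].
  exists (t + 2 * PI * IZR m). split; [|exact Hm]. rewrite cexp_periodic. reflexivity.
Qed.

Lemma cexp_on_circle t : on_circle (cexp_i t).
Proof.
  unfold on_circle, Cmod, cexp_i. simpl. pose proof (sin2_cos2 t). unfold Rsqr in *.
  replace (_ + _) with 1 by nra. apply sqrt_1.
Qed.

Lemma cexp_close d : 0 < d -> exists e, 0 < e /\ forall t u,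
  Cmod (cexp_i t - cexp_i u)%C <= e -> exists m : Z, Rabs (t + 2 * PI * IZR m - u) < d.
Proof.
  intros Hd. pose proof PI_RGT_0 as HPI. set (d' := Rmin d 1).
  assert (Hd' : 0 < d' <= 1) by (unfold d'; split; [apply Rmin_glb_lt; lra | apply Rmin_r]).
  assert (Hdd : d' <= d) by apply Rmin_l. pose proof PI2_1.
  assert (Hc : cos d' < 1) by (rewrite <- cos_0; apply cos_decreasing_1; lra).
  (* The squared chord is [2 - 2 * cos]. Since [0 < 1 - cos d' < 1], half the square of this number
     is smaller than the number itself, so no root has to be taken. *)
  exists (1 - cos d'). split; [lra|]. intros t u Hclose.
  destruct (real_mod (t - u) (- PI) (2 * PI)) as [m Hm]; [lra|]. exists m.
  set (x := t - u + 2 * PI * IZR m) in *.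
  replace (t + 2 * PI * IZR m - u) with x by (unfold x; ring).
  assert (Hcx : 1 - cos x <= (1 - cos d') ^ 2 / 2).
  { assert (Hsq : Cmod (cexp_i t - cexp_i u)%C ^ 2 <= (1 - cos d') ^ 2)
      by (apply pow_incr; split; [apply Cmod_ge_0 | exact Hclose]).
    rewrite cexp_dist_sq in Hsq.
    assert (cos x = cos (t - u)) as -> by
      (pose proof (cexp_periodic (t - u) m) as E; injection E; auto). lra. }
  assert (Hc0 : 0 < cos d') by (apply cos_gt_0; lra).
  assert (Hlt : cos d' < cos x) by nra.
  apply Rlt_le_trans with d'; [|exact Hdd].
  apply Rnot_le_lt. intros Hge.
  assert (cos x <= cos d'); [|lra].
  destruct (Rle_lt_dec 0 x) as [Hx|Hx].
  - rewrite Rabs_pos_eq in Hge by exact Hx. apply cos_decr_1; lra.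
  - rewrite Rabs_left in Hge by exact Hx. rewrite <- (cos_neg x). apply cos_decr_1; lra.
Qed.

(** * Separated sets on the circle *)

Section Circle.
Context (N : Z) (lam : R) (p q : Z -> R) (sg : Z -> Z) (tau : Z -> R -> R).
Context (B : boundary_lift N lam p q sg tau).
Context (a : Z -> R) (Ga : grid N a) (Hpa : forall k, p k <= a k) (Haq : forall k, a k <= q k).
Context (f : C -> C) (Hf : forall t, f (cexp_i t) = cexp_i (lift_map tau a t)).

Lemma iter_lift n t : Nat.iter n f (cexp_i t) = cexp_i (Nat.iter n (lift_map tau a) t).
Proof. induction n as [|n IH]; [reflexivity|]. rewrite !Nat.iter_succ, IH. apply Hf. Qed.

Lemma circle_upper eps n E : 0 < eps -> sep_set f n eps E ->
  INR (length E) <= (1 + 4 * PI * INR n / eps) * ((1 + IZR N * lam) * lam ^ n).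
Proof.
  intros Heps [Hcirc Hsep].
  assert (HE : exists ER, map cexp_i ER = E /\ forall t, In t ER -> a 0%Z <= t < a 0%Z + 2 * PI).
  { clear Hsep. induction E as [|z E IH].
    - exists nil. split; [reflexivity | intros t []].
    - destruct IH as (ER & <- & HER); [intros x Hx; apply Hcirc; right; exact Hx|].
      destruct (on_circle_angle z (a 0%Z) (Hcirc z (or_introl eq_refl))) as (t & -> & Ht).
      exists (t :: ER). split; [reflexivity|]. intros u [<-|Hu]; [exact Ht | apply HER, Hu]. }
  destruct HE as (ER & HER & Hran).
  assert (Hlen : length E = length ER) by (rewrite <- HER; apply length_map).
  assert (Hnth : forall i, (i < length ER)%nat -> nth i E (RtoC 0) = cexp_i (nth i ER 0)).
  { intros i Hi. rewrite <- HER, <- (map_nth cexp_i). apply nth_indep. rewrite length_map. exact Hi. }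
  rewrite Hlen. apply (separated_upper N lam p q sg tau B a Ga Hpa Haq n eps).
  - exact Heps.
  - apply (NoDup_nth ER 0).
    assert (Hlt : forall i j, (i < j < length ER)%nat -> nth i ER 0 <> nth j ER 0).
    { intros i j Hij Heq. destruct (Hsep i j ltac:(lia)) as (m & _ & Hm).
      rewrite !Hnth, Heq in Hm by lia. unfold Cminus in Hm. rewrite Cplus_opp_r, Cmod_0 in Hm. lra. }
    intros i j Hi Hj Heq. destruct (Nat.lt_trichotomy i j) as [H|[H|H]]; [|exact H|].
    + exfalso. apply (Hlt i j); [lia | exact Heq].
    + exfalso. apply (Hlt j i); [lia | symmetry; exact Heq].
  - exact Hran.
  - assert (Hlt : forall i j, (i < j < length ER)%nat -> exists m, (m < n)%nat /\
      eps <= Rabs (Nat.iter m (lift_map tau a) (nth i ER 0) - Nat.iter m (lift_map tau a) (nth j ER 0))).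
    { intros i j Hij. destruct (Hsep i j ltac:(lia)) as (m & Hmn & Hm). exists m. split; [exact Hmn|].
      rewrite !Hnth, !iter_lift in Hm by lia.
      eapply Rle_trans; [apply Rlt_le, Hm | apply cexp_dist_le]. }
    intros t u Ht Hu Hne.
    destruct (In_nth ER t 0 Ht) as (i & Hi & <-). destruct (In_nth ER u 0 Hu) as (j & Hj & <-).
    destruct (Nat.lt_trichotomy i j) as [H|[H|H]]; [|subst; contradiction|].
    + apply Hlt; lia.
    + destruct (Hlt j i ltac:(lia)) as (m & Hm & Hd). exists m. split; [exact Hm|].
      rewrite Rabs_minus_sym. exact Hd.
Qed.

(** One [eps] serves all [n]: a small chord forces nearby angles, and uniform continuity of [Phi]
    then forces nearby [Phi]-values. The order is [S n] because [spread_points] separates at some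
    time [m <= n]. *)
Lemma circle_lower : exists eps, 0 < eps /\ forall n, exists E,
  sep_set f (S n) eps E /\ lam ^ n <= INR (length E).
Proof.
  pose proof (bl_lam B) as Hlam.
  set (eta := / (4 * lam)).
  assert (Heta : 0 < eta) by (apply Rinv_0_lt_compat; lra).
  assert (Hsm : eta * lam <= / 4) by (unfold eta; apply Req_le; field; lra).
  destruct (phi_unif_cont N lam p q sg tau B eta Heta) as (d & Hd & Hc).
  destruct (cexp_close d Hd) as (e & He & Hclose).
  exists e. split; [exact He|]. intros n.
  destruct (spread_points N lam p q sg tau B a Ga Hpa Haq eta n Heta Hsm) as (ER & Hlen & Hsep).
  exists (map cexp_i ER). rewrite length_map. split; [|exact Hlen]. split.
  - intros x Hx. apply in_map_iff in Hx. destruct Hx as (t & <- & _). apply cexp_on_circle.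
  - rewrite length_map. intros i j Hij. destruct (Hsep i j Hij) as (m & Hm & Hfar).
    assert (Hnth : forall i, (i < length ER)%nat -> nth i (map cexp_i ER) (RtoC 0) = cexp_i (nth i ER 0)).
    { intros l Hl. rewrite <- (map_nth cexp_i). apply nth_indep. rewrite length_map. exact Hl. }
    exists m. split; [lia|]. rewrite !Hnth, !iter_lift by lia.
    apply Rnot_le_gt. intros Hle. apply Hfar.
    destruct (Hclose _ _ Hle) as [z Hz]. exists (- z)%Z.
    rewrite opp_IZR.
    pose proof (Hc _ _ Hz) as H. rewrite (phi_shift N lam p q sg tau B) in H.
    eapply Rle_lt_trans; [|exact H]. apply Req_le. f_equal. ring.
Qed.

End Circle.

(** * Entropy from bounds on separated sets *)

Lemma ln_le_compat x y : 0 < x -> x <= y -> ln x <= ln y.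
Proof. intros Hx [H| ->]; [|lra]. apply Rlt_le, ln_increasing; assumption. Qed.

(** From [ln y <= 2 * sqrt y] and [y <= C * (1 + c) * n] it suffices that
    [4 * C * (1 + c) * n <= (eta * n) ^ 2], which determines the threshold. *)
Lemma sublinear_ln C c eta : 1 <= C -> 0 <= c -> 0 < eta -> exists M, forall n, (M <= n)%nat -> (1 <= n)%nat ->
  ln (C * (1 + c * INR n)) <= eta * INR n.
Proof.
  intros HC Hc Heta. set (D := C * (1 + c)).
  assert (HD : 1 <= D) by (unfold D; nra).
  exists (Z.to_nat (up (4 * D / eta ^ 2))). intros n Hn Hn1.
  assert (Hn1' : 1 <= INR n) by (apply (le_INR 1 n) in Hn1; exact Hn1).
  assert (Hbig : 4 * D / eta ^ 2 <= INR n).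
  { destruct (archimed (4 * D / eta ^ 2)) as [H _].
    assert (0 < 4 * D / eta ^ 2) by (apply Rdiv_lt_0_compat; [lra | apply pow_lt, Heta]).
    assert (0 <= up (4 * D / eta ^ 2))%Z by (apply le_IZR; lra).
    apply le_INR in Hn. rewrite INR_IZR_INZ, Z2Nat.id in Hn by assumption. lra. }
  set (y := C * (1 + c * INR n)).
  assert (Hcn : 0 <= c * INR n) by (apply Rmult_le_pos; lra).
  assert (Hy : 1 <= y <= D * INR n).
  { unfold y, D. rewrite Rmult_assoc. split; [nra|]. apply Rmult_le_compat_l; lra. }
  assert (Hln : ln y <= 2 * sqrt y).
  { rewrite <- (sqrt_sqrt y) at 1 by lra.
    assert (Hs : 0 < sqrt y) by (apply sqrt_lt_R0; lra).
    rewrite ln_mult by assumption.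
    pose proof (exp_ineq1_le (ln (sqrt y))) as H. rewrite exp_ln in H by exact Hs. lra. }
  eapply Rle_trans; [exact Hln|].
  assert (H4 : 4 * (D * INR n) <= (eta * INR n) ^ 2).
  { apply Rmult_le_compat_r with (r := eta ^ 2) in Hbig; [|apply pow_le; lra].
    replace (4 * D / eta ^ 2 * eta ^ 2) with (4 * D) in Hbig by (field; lra).
    replace ((eta * INR n) ^ 2) with (INR n * eta ^ 2 * INR n) by ring.
    apply Rmult_le_compat_r with (r := INR n) in Hbig; lra. }
  apply Rsqr_incr_0_var; [|nra]. rewrite Rsqr_mult, Rsqr_sqrt by lra. unfold Rsqr. nra.
Qed.

Lemma Rbar_lub_correct (E : Rbar -> Prop) : Rbar_is_lub E (Rbar_lub E).
Proof. exact (proj2_sig (Rbar_ex_lub E)). Qed.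

Lemma Rbar_glb_correct (E : Rbar -> Prop) : Rbar_is_glb E (Rbar_glb E).
Proof. exact (proj2_sig (Rbar_ex_glb E)). Qed.

(** The linear factor in the upper bound disappears after division by [n], and so does the shift
    from [n] to [S n] in the lower one. From below a single [eps0] suffices because the entropy is a
    supremum over [eps]. *)
Lemma htop_of_bounds (f : C -> C) (lam : R) : 1 < lam ->
  (forall eps, 0 < eps -> exists C c, 1 <= C /\ 0 <= c /\
     forall n E, sep_set f n eps E -> INR (length E) <= C * (1 + c * INR n) * lam ^ n) ->
  (exists eps, 0 < eps /\ forall n, exists E, sep_set f (S n) eps E /\ lam ^ n <= INR (length E)) ->
  htop f = Finite (ln lam).
Proof.
  intros Hlam Hup (eps0 & Heps0 & Hlow).
  assert (Hln : 0 < ln lam) by (rewrite <- ln_1; apply ln_increasing; lra).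
  assert (Hle : forall eps, 0 < eps -> Rbar_le (sep_limsup f eps) (ln lam)).
  { intros eps Heps. destruct (Hup eps Heps) as (C & c & HC & Hc & HE).
    assert (Heta : forall eta, 0 < eta -> Rbar_le (sep_limsup f eps) (ln lam + eta)).
    { intros eta Heta. destruct (sublinear_ln C c eta HC Hc Heta) as [M HM].
      destruct (Rbar_glb_correct (fun y => exists N, y = tail_sup f eps N)) as [Hl _].
      apply Rbar_le_trans with (tail_sup f eps M).
      - apply Hl. exists M. reflexivity.
      - apply Rbar_lub_correct. intros r (n & E & Hn & Hn1 & Hne & Hs & Hr). rewrite Hr. simpl.
        assert (Hnp : 1 <= INR n) by (apply (le_INR 1 n) in Hn1; exact Hn1).
        apply Rmult_le_reg_r with (INR n); [lra|].
        unfold Rdiv. rewrite Rmult_assoc, Rinv_l, Rmult_1_r by lra.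
        assert (Hlenp : 0 < INR (length E)).
        { destruct E; [contradiction|]. apply lt_0_INR. simpl. lia. }
        eapply Rle_trans; [apply ln_le_compat; [exact Hlenp | apply HE, Hs]|].
        assert (0 <= c * INR n) by (apply Rmult_le_pos; lra).
        assert (0 < C * (1 + c * INR n)) by (apply Rmult_lt_0_compat; lra).
        rewrite ln_mult by (try apply pow_lt; lra).
        rewrite ln_pow by lra. specialize (HM n Hn Hn1). lra. }
    destruct (sep_limsup f eps) as [x| |]; simpl in *.
    - apply Rnot_lt_le. intros Hlt. specialize (Heta ((x - ln lam) / 2) ltac:(lra)). lra.
    - apply (Heta 1). lra.
    - exact I. }
  assert (Hge : Rbar_le (ln lam) (sep_limsup f eps0)).
  { apply Rbar_glb_correct. intros y (M & ->).
    assert (Hs : forall n E, (M <= n)%nat -> (1 <= n)%nat -> E <> nil -> sep_set f n eps0 E ->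
      Rbar_le (ln (INR (length E)) / INR n) (tail_sup f eps0 M)).
    { intros n E HMn Hn1 Hne Hsep. apply Rbar_lub_correct. exists n, E. repeat split; auto; apply Hsep. }
    set (s := tail_sup f eps0 M) in *.
    assert (Hn : forall n, (M <= S n)%nat -> Rbar_le (INR n * ln lam / INR (S n)) s).
    { intros n Hn. destruct (Hlow n) as (E & HE & Hlen).
      assert (Hpn : 0 < lam ^ n) by (apply pow_lt; lra).
      apply Rbar_le_trans with (Finite (ln (INR (length E)) / INR (S n))).
      - change (INR n * ln lam * / INR (S n) <= ln (INR (length E)) * / INR (S n)).
        apply Rmult_le_compat_r.
        + apply Rlt_le, Rinv_0_lt_compat, lt_0_INR. lia.
        + rewrite <- ln_pow by lra. apply ln_le_compat; assumption.
      - apply Hs; [exact Hn | lia | | exact HE]. intros ->. simpl in Hlen. lra. }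
    destruct s as [x| |]; simpl.
    - apply Rnot_lt_le. intros Hlt.
      (* Chosen so that [(ln lam - x) * (n + 1) > ln lam], that is, [n * ln lam > x * (n + 1)]. *)
      set (n := (M + Z.to_nat (up (ln lam / (ln lam - x))))%nat).
      specialize (Hn n ltac:(lia)). simpl Rbar_le in Hn.
      assert (Hbig : ln lam / (ln lam - x) < INR (S n)).
      { rewrite S_INR. unfold n. rewrite plus_INR.
        destruct (archimed (ln lam / (ln lam - x))) as [H _].
        assert (0 < ln lam / (ln lam - x)) by (apply Rdiv_lt_0_compat; lra).
        assert (0 <= up (ln lam / (ln lam - x)))%Z by (apply le_IZR; lra).
        rewrite (INR_IZR_INZ (Z.to_nat _)), Z2Nat.id by assumption. pose proof (pos_INR M). lra. }
      assert (Hpos : 0 < INR (S n)) by (apply lt_0_INR; lia).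
      apply Rmult_lt_compat_r with (r := ln lam - x) in Hbig; [|lra].
      unfold Rdiv in Hbig at 1. rewrite Rmult_assoc, Rinv_l, Rmult_1_r in Hbig by lra.
      apply Rmult_le_compat_r with (r := INR (S n)) in Hn; [|lra].
      change (INR n * ln lam / INR (S n) * INR (S n) <= x * INR (S n)) in Hn.
      unfold Rdiv in Hn. rewrite Rmult_assoc, Rinv_l, Rmult_1_r in Hn by lra.
      rewrite S_INR in *. nra.
    - exact I.
    - apply (Hn M). lia. }
  destruct (Rbar_lub_correct (fun h => exists eps, 0 < eps /\ h = sep_limsup f eps)) as [Hh1 Hh2].
  apply Rbar_le_antisym.
  - apply Hh2. intros y (eps & Heps & ->). apply Hle, Heps.
  - eapply Rbar_le_trans; [exact Hge|]. apply Hh1. exists eps0. split; [exact Heps0 | reflexivity].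
Qed.

(** * The hyperboloid model *)

Record vec := V3 { vx : R; vy : R; vh : R }.

Definition vadd (u v : vec) : vec := V3 (vx u + vx v) (vy u + vy v) (vh u + vh v).
Definition vscal (c : R) (u : vec) : vec := V3 (c * vx u) (c * vy u) (c * vh u).
Definition mdot (u v : vec) : R := vx u * vx v + vy u * vy v - vh u * vh v.
(** The last coordinate has the opposite of the Euclidean sign, so that [mcross u v] is orthogonal
    to [u] and [v] for the Lorentz form and [det3] is the ordinary determinant. *)
Definition mcross (u v : vec) : vec :=
  V3 (vy u * vh v - vh u * vy v) (vh u * vx v - vx u * vh v) (vy u * vx v - vx u * vy v).
Definition det3 (u v w : vec) : R := mdot (mcross u v) w.
(** The closed future cone without its apex: its rays are the points of the disk and the ideal
    points, while those of [timelike] are the points of the disk alone. *)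
Definition fut (u : vec) : Prop := 0 < vh u /\ vx u ^ 2 + vy u ^ 2 <= vh u ^ 2.
Definition timelike (u : vec) : Prop := 0 < vh u /\ vx u ^ 2 + vy u ^ 2 < vh u ^ 2.
Definition vunit (u : vec) : vec := vscal (/ sqrt (mdot u u)) u.

Lemma vec_ext u v : vx u = vx v -> vy u = vy v -> vh u = vh v -> u = v.
Proof. destruct u, v; simpl; intros; subst; reflexivity. Qed.

Ltac vec_ring :=
  repeat match goal with v : vec |- _ => destruct v end;
  unfold det3, mcross, mdot, vadd, vscal; cbn [vx vy vh]; ring.

Ltac vec_eq := apply vec_ext; vec_ring.

Lemma mdot_comm u v : mdot u v = mdot v u.
Proof. vec_ring. Qed.
Lemma mdot_add_l u v w : mdot (vadd u v) w = mdot u w + mdot v w.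
Proof. vec_ring. Qed.
Lemma mdot_add_r u v w : mdot w (vadd u v) = mdot w u + mdot w v.
Proof. vec_ring. Qed.
Lemma mdot_scal_l c u v : mdot (vscal c u) v = c * mdot u v.
Proof. vec_ring. Qed.
Lemma mdot_scal_r c u v : mdot u (vscal c v) = c * mdot u v.
Proof. vec_ring. Qed.
Lemma mcross_scal c d u v : mcross (vscal c u) (vscal d v) = vscal (c * d) (mcross u v).
Proof. vec_eq. Qed.
Lemma mcross_anti u v : mcross v u = vscal (-1) (mcross u v).
Proof. vec_eq. Qed.
Lemma vscal_vscal c d u : vscal c (vscal d u) = vscal (c * d) u.
Proof. vec_eq. Qed.
Lemma vscal_1 u : vscal 1 u = u.
Proof. vec_eq. Qed.
Lemma vscal_add c u v : vscal c (vadd u v) = vadd (vscal c u) (vscal c v).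
Proof. vec_eq. Qed.
Lemma det3_cycle u v w : det3 u v w = det3 v w u.
Proof. vec_ring. Qed.
Lemma det3_12 u v : det3 u v u = 0.
Proof. vec_ring. Qed.
Lemma det3_22 u v : det3 u v v = 0.
Proof. vec_ring. Qed.

Lemma timelike_fut u : timelike u -> fut u.
Proof. intros [H1 H2]. split; lra. Qed.

Lemma Rlt_sqr_pow x y : 0 <= x -> x < y -> x ^ 2 < y ^ 2.
Proof. intros. nra. Qed.

Lemma fut_comb c d u v : fut u -> fut v -> 0 <= c -> 0 < d -> fut (vadd (vscal c u) (vscal d v)).
Proof.
  intros [Hu1 Hu2] [Hv1 Hv2] Hc Hd. destruct u as [a b h], v as [a' b' h']. unfold fut; simpl in *.
  assert (Hcs : a * a' + b * b' <= h * h').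
  { apply Rsqr_incr_0_var; [|nra]. unfold Rsqr.
    apply Rle_trans with ((a ^ 2 + b ^ 2) * (a' ^ 2 + b' ^ 2)); [pose proof (pow2_ge_0 (a * b' - b * a')); nra|].
    replace (h * h' * (h * h')) with (h ^ 2 * h' ^ 2) by ring.
    apply Rmult_le_compat; try assumption; nra. }
  split; [nra|].
  assert (0 <= c * d * (h * h' - (a * a' + b * b'))) by
    (apply Rmult_le_pos; [apply Rmult_le_pos|]; lra).
  assert (0 <= c ^ 2 * (h ^ 2 - (a ^ 2 + b ^ 2))) by (apply Rmult_le_pos; [apply pow2_ge_0 | lra]).
  assert (0 <= d ^ 2 * (h' ^ 2 - (a' ^ 2 + b' ^ 2))) by (apply Rmult_le_pos; [apply pow2_ge_0 | lra]).
  nra.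
Qed.

Lemma fut_mdot_neg u v : fut u -> timelike v -> mdot u v < 0.
Proof.
  intros [Hu1 Hu2] [Hv1 Hv2]. destruct u as [a b h], v as [a' b' h']. unfold mdot; simpl in *.
  apply Rnot_le_lt. intros H.
  assert (H1 : (h * h') ^ 2 <= (a * a' + b * b') ^ 2).
  { apply pow_incr. split; [nra | lra]. }
  assert (H2 : (a * a' + b * b') ^ 2 <= (a ^ 2 + b ^ 2) * (a' ^ 2 + b' ^ 2)).
  { pose proof (pow2_ge_0 (a * b' - b * a')). nra. }
  assert (H3 : (a ^ 2 + b ^ 2) * (a' ^ 2 + b' ^ 2) <= h ^ 2 * (a' ^ 2 + b' ^ 2)).
  { apply Rmult_le_compat_r; [nra | exact Hu2]. }
  assert (H4 : h ^ 2 * (a' ^ 2 + b' ^ 2) < h ^ 2 * h' ^ 2).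
  { apply Rmult_lt_compat_l; [nra | exact Hv2]. }
  nra.
Qed.

Lemma fut_mdot_npos u v : fut u -> fut v -> mdot u v <= 0.
Proof.
  intros [Hu1 Hu2] [Hv1 Hv2]. destruct u as [a b h], v as [a' b' h']. unfold mdot; simpl in *.
  apply Rnot_lt_le. intros H.
  assert (H0 : 0 < h * h') by (apply Rmult_lt_0_compat; assumption).
  assert (H1 : (h * h') ^ 2 < (a * a' + b * b') ^ 2) by (apply Rlt_sqr_pow; lra).
  assert (H2 : (a * a' + b * b') ^ 2 <= (a ^ 2 + b ^ 2) * (a' ^ 2 + b' ^ 2)).
  { pose proof (pow2_ge_0 (a * b' - b * a')). nra. }
  assert (H3 : (a ^ 2 + b ^ 2) * (a' ^ 2 + b' ^ 2) <= h ^ 2 * h' ^ 2).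
  { apply Rmult_le_compat; try assumption; nra. }
  nra.
Qed.

Lemma perp_fut_spacelike w m : fut w -> mdot m w = 0 -> 0 <= mdot m m.
Proof.
  intros [Hw1 Hw2] Hm. destruct w as [a b h], m as [x y z]. unfold mdot in *; simpl in *.
  assert (H1 : (z * h) ^ 2 <= (x ^ 2 + y ^ 2) * (a ^ 2 + b ^ 2)).
  { replace (z * h) with (x * a + y * b) by lra. pose proof (pow2_ge_0 (x * b - y * a)). nra. }
  assert (H2 : (x ^ 2 + y ^ 2) * (a ^ 2 + b ^ 2) <= (x ^ 2 + y ^ 2) * h ^ 2).
  { apply Rmult_le_compat_l; [nra | exact Hw2]. }
  assert (H3 : z ^ 2 <= x ^ 2 + y ^ 2).
  { apply Rmult_le_reg_r with (h ^ 2); [nra|]. nra. }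
  nra.
Qed.

Lemma perp_timelike_spacelike w m x : timelike w -> mdot m w = 0 -> mdot m x <> 0 -> 0 < mdot m m.
Proof.
  intros [Hw1 Hw2] Hm Hx. destruct w as [a b h], m as [p q z]. unfold mdot in *; simpl in *.
  assert (H1 : (z * h) ^ 2 <= (p ^ 2 + q ^ 2) * (a ^ 2 + b ^ 2)).
  { replace (z * h) with (p * a + q * b) by lra. pose proof (pow2_ge_0 (p * b - q * a)). nra. }
  destruct (Rle_lt_dec (p ^ 2 + q ^ 2) 0) as [H0|H0].
  - exfalso. apply Hx. assert (p = 0) by nra. assert (q = 0) by nra. subst.
    assert (z = 0) by nra. subst. ring.
  - assert (H2 : (p ^ 2 + q ^ 2) * (a ^ 2 + b ^ 2) < (p ^ 2 + q ^ 2) * h ^ 2).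
    { apply Rmult_lt_compat_l; lra. }
    assert (H3 : z ^ 2 < p ^ 2 + q ^ 2).
    { apply Rmult_lt_reg_r with (h ^ 2); [nra|]. nra. }
    nra.
Qed.

Lemma vunit_unit u : 0 < mdot u u -> mdot (vunit u) (vunit u) = 1.
Proof.
  intros H. unfold vunit. rewrite mdot_scal_l, mdot_scal_r.
  pose proof (sqrt_lt_R0 _ H). rewrite <- (sqrt_sqrt (mdot u u)) at 3 by lra. field. lra.
Qed.

Lemma vunit_dot u w : 0 < mdot u u -> exists c, 0 < c /\ vunit u = vscal c u /\ mdot (vunit u) w = c * mdot u w.
Proof.
  intros H. exists (/ sqrt (mdot u u)). split; [apply Rinv_0_lt_compat, sqrt_lt_R0, H|].
  split; [reflexivity|]. unfold vunit. apply mdot_scal_l.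
Qed.

Lemma vunit_scal c u : 0 < c -> 0 < mdot u u -> vunit (vscal c u) = vunit u.
Proof.
  intros Hc H. unfold vunit. rewrite mdot_scal_l, mdot_scal_r, vscal_vscal. f_equal.
  rewrite <- Rmult_assoc, sqrt_mult, sqrt_square by nra. pose proof (sqrt_lt_R0 _ H). field. lra.
Qed.

Lemma vunit_opp u : vunit (vscal (-1) u) = vscal (-1) (vunit u).
Proof.
  unfold vunit. rewrite mdot_scal_l, mdot_scal_r, !vscal_vscal.
  replace (-1 * (-1 * mdot u u)) with (mdot u u) by ring. f_equal. ring.
Qed.

(** * Disk automorphisms as Lorentz maps *)

(* The action of a Moebius map in the Klein model, from
   [|d|^2 (2 m(z), 1 + |m(z)|^2) = (a^2 w + b^2 conj w + 2 a b h, (|a|^2 + |b|^2) h + 2 Re (a conj b w))]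
   with [w = 2 z], [h = 1 + |z|^2] and [d = conj b z + conj a]. *)
Definition lor (m : mob) (v : vec) : vec :=
  let '((a1, a2), (b1, b2)) := m in
  V3 ((a1 ^ 2 - a2 ^ 2 + b1 ^ 2 - b2 ^ 2) * vx v + (2 * b1 * b2 - 2 * a1 * a2) * vy v
        + 2 * (a1 * b1 - a2 * b2) * vh v)
     ((2 * a1 * a2 + 2 * b1 * b2) * vx v + (a1 ^ 2 - a2 ^ 2 - b1 ^ 2 + b2 ^ 2) * vy v
        + 2 * (a1 * b2 + a2 * b1) * vh v)
     (2 * (a1 * b1 + a2 * b2) * vx v + 2 * (a1 * b2 - a2 * b1) * vy v
        + (a1 ^ 2 + a2 ^ 2 + b1 ^ 2 + b2 ^ 2) * vh v).

Lemma Cmod_sq z : Cmod z ^ 2 = fst z ^ 2 + snd z ^ 2.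
Proof. unfold Cmod. apply pow2_sqrt. apply Rplus_le_le_0_compat; apply pow2_ge_0. Qed.

Lemma disk_mob_coords a1 a2 b1 b2 : is_disk_mob ((a1, a2), (b1, b2)) <->
  a1 ^ 2 + a2 ^ 2 - (b1 ^ 2 + b2 ^ 2) = 1.
Proof. unfold is_disk_mob. rewrite !Cmod_sq. simpl. tauto. Qed.

Lemma lor_mdot m u v : is_disk_mob m -> mdot (lor m u) (lor m v) = mdot u v.
Proof.
  destruct m as [[a1 a2] [b1 b2]]. rewrite disk_mob_coords. intros H.
  transitivity ((a1 ^ 2 + a2 ^ 2 - (b1 ^ 2 + b2 ^ 2)) ^ 2 * mdot u v).
  - destruct u, v. unfold lor, mdot; simpl. ring.
  - rewrite H. ring.
Qed.

Lemma lor_mcross m u v : is_disk_mob m -> lor m (mcross u v) = mcross (lor m u) (lor m v).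
Proof.
  destruct m as [[a1 a2] [b1 b2]]. rewrite disk_mob_coords. intros H.
  transitivity (vscal (a1 ^ 2 + a2 ^ 2 - (b1 ^ 2 + b2 ^ 2)) (lor ((a1, a2), (b1, b2)) (mcross u v))).
  - rewrite H, vscal_1. reflexivity.
  - destruct u, v. unfold lor, mcross, vscal; simpl. f_equal; ring.
Qed.

Lemma lor_add m u v : lor m (vadd u v) = vadd (lor m u) (lor m v).
Proof.
  destruct m as [[a1 a2] [b1 b2]]. destruct u, v. unfold lor, vadd; simpl. f_equal; ring.
Qed.

Lemma lor_scal m c u : lor m (vscal c u) = vscal c (lor m u).
Proof.
  destruct m as [[a1 a2] [b1 b2]]. destruct u. unfold lor, vscal; simpl. f_equal; ring.
Qed.

Lemma lor_det3 m u v w : is_disk_mob m -> det3 (lor m u) (lor m v) (lor m w) = det3 u v w.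
Proof. intros H. unfold det3. rewrite <- lor_mcross by exact H. apply lor_mdot, H. Qed.

Lemma lor_fut m u : is_disk_mob m -> fut u -> fut (lor m u).
Proof.
  intros Hm [H1 H2]. pose proof (lor_mdot m u u Hm) as Hd.
  assert (Hq : vx (lor m u) ^ 2 + vy (lor m u) ^ 2 <= vh (lor m u) ^ 2).
  { unfold mdot in Hd. nra. }
  split; [|exact Hq].
  destruct m as [[a1 a2] [b1 b2]]. rewrite disk_mob_coords in Hm. destruct u as [x y h]. unfold lor in *.
  cbn [vx vy vh] in *.
  set (A := a1 ^ 2 + a2 ^ 2) in *. set (B := b1 ^ 2 + b2 ^ 2) in *.
  set (c := a1 * b1 + a2 * b2). set (d := a1 * b2 - a2 * b1).
  assert (Hcd : c ^ 2 + d ^ 2 = A * B) by (unfold A, B, c, d; ring).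
  assert (HB : 0 <= B) by (unfold B; nra).
  (* Cauchy-Schwarz, with [c ^ 2 + d ^ 2 = A * B] and [(A + B) ^ 2 = 1 + 4 * A * B]: the mixed terms
     cannot outweigh the last one, so the sign of the height is preserved. *)
  assert (Hcs : (2 * (c * x + d * y)) ^ 2 < ((A + B) * h) ^ 2).
  { assert ((c * x + d * y) ^ 2 <= (c ^ 2 + d ^ 2) * (x ^ 2 + y ^ 2)) by
      (pose proof (pow2_ge_0 (c * y - d * x)); nra).
    assert ((c ^ 2 + d ^ 2) * (x ^ 2 + y ^ 2) <= A * B * h ^ 2).
    { rewrite Hcd. apply Rmult_le_compat_l; [nra | exact H2]. }
    assert (0 < h ^ 2) by nra.
    replace (((A + B) * h) ^ 2) with ((A - B) ^ 2 * h ^ 2 + 4 * (A * B * h ^ 2)) by ring.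
    rewrite Hm. nra. }
  assert (HK : 0 < (A + B) * h) by (apply Rmult_lt_0_compat; lra).
  replace (_ + _) with (2 * (c * x + d * y) + (A + B) * h) by (unfold A, B, c, d; ring).
  set (S := 2 * (c * x + d * y)) in *. set (K := (A + B) * h) in *. nra.
Qed.

(** The Klein point at height 1, as a representative of its ray. Lorentz maps move rays, which is
    why the statements about [lor] and [kv] carry a positive factor. *)
Definition kv (z : C) : vec := V3 (Re (klein z)) (Im (klein z)) 1.

Lemma kv_coords x y : kv (x, y) = V3 (2 * x / (1 + (x ^ 2 + y ^ 2))) (2 * y / (1 + (x ^ 2 + y ^ 2))) 1.
Proof.
  unfold kv, klein. rewrite Cmod_sq. unfold Re, Im. simpl. f_equal; field; nra.
Qed.

Lemma kv_0 : kv (RtoC 0) = V3 0 0 1.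
Proof. unfold RtoC. rewrite kv_coords. f_equal; field; lra. Qed.

Lemma Cmod_lt_1 z : Cmod z < 1 <-> fst z ^ 2 + snd z ^ 2 < 1.
Proof.
  rewrite <- Cmod_sq. pose proof (Cmod_ge_0 z). split; intros; nra.
Qed.

Lemma Cmod_le_1 z : Cmod z <= 1 <-> fst z ^ 2 + snd z ^ 2 <= 1.
Proof.
  rewrite <- Cmod_sq. pose proof (Cmod_ge_0 z). split; intros; nra.
Qed.

Lemma Cmod_eq_1 z : Cmod z = 1 <-> fst z ^ 2 + snd z ^ 2 = 1.
Proof.
  rewrite <- Cmod_sq. pose proof (Cmod_ge_0 z). split; intros; nra.
Qed.

Lemma kv_norm z : vx (kv z) ^ 2 + vy (kv z) ^ 2 = 1 - ((1 - (fst z ^ 2 + snd z ^ 2)) / (1 + (fst z ^ 2 + snd z ^ 2))) ^ 2.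
Proof. destruct z as [x y]. rewrite kv_coords. simpl. field. nra. Qed.

Lemma kv_timelike z : in_disk z -> timelike (kv z).
Proof.
  intros Hz. apply Cmod_lt_1 in Hz. split; [simpl; lra|]. rewrite kv_norm.
  set (s := fst z ^ 2 + snd z ^ 2) in *.
  assert (0 <= s) by (unfold s; nra).
  assert (0 < (1 - s) / (1 + s)) by (apply Rdiv_lt_0_compat; lra). simpl vh. nra.
Qed.

Lemma kv_circle z : on_circle z -> kv z = V3 (fst z) (snd z) 1.
Proof.
  intros Hz. apply Cmod_eq_1 in Hz. destruct z as [x y]. rewrite kv_coords.
  cbn [fst snd] in *. rewrite Hz. f_equal; field.
Qed.

Lemma kv_circle_fut z : on_circle z -> fut (kv z).
Proof.
  intros Hz. rewrite (kv_circle z Hz). apply Cmod_eq_1 in Hz. split; simpl in *; lra.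
Qed.

Lemma mob_den m z : is_disk_mob m -> Cmod z <= 1 ->
  (Cconj (snd m) * z + Cconj (fst m))%C <> RtoC 0.
Proof.
  destruct m as [[a1 a2] [b1 b2]]. rewrite disk_mob_coords, Cmod_le_1. destruct z as [x y]. simpl.
  intros Hm Hz Heq. unfold Cconj, Cmult, Cplus, RtoC in Heq. simpl in Heq.
  injection Heq as E1 E2.
  assert (Ha : a1 ^ 2 + a2 ^ 2 = (b1 ^ 2 + b2 ^ 2) * (x ^ 2 + y ^ 2)).
  { replace a1 with (- (b1 * x - - b2 * y)) by lra.
    replace a2 with (b1 * y + - b2 * x) by lra. ring. }
  assert (0 <= (b1 ^ 2 + b2 ^ 2) * (1 - (x ^ 2 + y ^ 2))) by (apply Rmult_le_pos; nra). nra.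
Qed.

Lemma mob_kv m z : is_disk_mob m -> Cmod z <= 1 ->
  Cmod (mob_act m z) <= 1 /\ (in_disk z -> in_disk (mob_act m z)) /\
  (on_circle z -> on_circle (mob_act m z)) /\
  exists c, 0 < c /\ lor m (kv z) = vscal c (kv (mob_act m z)).
Proof.
  intros Hm Hz. pose proof (mob_den m z Hm Hz) as Hd.
  unfold in_disk, on_circle. rewrite Cmod_le_1, !Cmod_lt_1, !Cmod_eq_1.
  destruct m as [[a1 a2] [b1 b2]]. rewrite disk_mob_coords in Hm. rewrite Cmod_le_1 in Hz.
  destruct z as [x y]. simpl in Hz.
  set (d1 := b1 * x + b2 * y + a1). set (d2 := b1 * y - b2 * x - a2).
  set (n1 := a1 * x - a2 * y + b1). set (n2 := a1 * y + a2 * x + b2).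
  assert (HD : 0 < d1 ^ 2 + d2 ^ 2).
  { assert (d1 <> 0 \/ d2 <> 0).
    { destruct (Req_dec d1 0); [|tauto]. destruct (Req_dec d2 0); [|tauto].
      exfalso. apply Hd. unfold Cconj, Cmult, Cplus, RtoC. simpl. f_equal; unfold d1, d2 in *; lra. }
    nra. }
  assert (Hw : mob_act (@pair C C (a1, a2) (b1, b2)) (x, y) =
    ((n1 * d1 + n2 * d2) / (d1 ^ 2 + d2 ^ 2), (n2 * d1 - n1 * d2) / (d1 ^ 2 + d2 ^ 2))).
  { unfold mob_act, Cdiv, Cinv, Cconj, Cmult, Cplus. simpl fst; simpl snd.
    replace (b1 * x - - b2 * y + a1) with d1 by (unfold d1; ring).
    replace (b1 * y + - b2 * x + - a2) with d2 by (unfold d2; ring).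
    replace (a1 * x - a2 * y + b1) with n1 by reflexivity.
    replace (a1 * y + a2 * x + b2) with n2 by reflexivity.
    f_equal; field; lra. }
  rewrite Hw.
  set (D := d1 ^ 2 + d2 ^ 2) in *. set (M := n1 ^ 2 + n2 ^ 2).
  assert (Hnorm : ((n1 * d1 + n2 * d2) / D) ^ 2 + ((n2 * d1 - n1 * d2) / D) ^ 2 = M / D).
  { unfold M, D. field. fold D. lra. }
  (* [D] and [M] are the squared moduli of denominator and numerator; this identity settles disk and
     circle together. *)
  assert (Hdiff : D - M = 1 - (x ^ 2 + y ^ 2)).
  { transitivity ((a1 ^ 2 + a2 ^ 2 - (b1 ^ 2 + b2 ^ 2)) * (1 - (x ^ 2 + y ^ 2))).
    - unfold D, M, d1, d2, n1, n2. ring.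
    - rewrite Hm. ring. }
  assert (HMD : M / D = 1 - (1 - (x ^ 2 + y ^ 2)) / D) by (rewrite <- Hdiff; field; lra).
  cbn [fst snd]. rewrite Hnorm, HMD.
  assert (Hinv : 0 < / D) by (apply Rinv_0_lt_compat; lra).
  repeat split.
  - assert (0 <= (1 - (x ^ 2 + y ^ 2)) * / D) by (apply Rmult_le_pos; lra). unfold Rdiv. lra.
  - intros Hx. assert (0 < (1 - (x ^ 2 + y ^ 2)) * / D) by (apply Rmult_lt_0_compat; lra).
    unfold Rdiv. lra.
  - intros Hx. rewrite Hx. field. lra.
  - assert (HM : 0 <= M) by (unfold M; nra). assert (Hs : 0 < 1 + (x ^ 2 + y ^ 2)) by nra.
    exists ((D + M) / (1 + (x ^ 2 + y ^ 2))). split; [apply Rdiv_lt_0_compat; lra|].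
    rewrite !kv_coords, Hnorm.
    replace (1 + M / D) with ((D + M) / D) by (field; lra).
    unfold lor, vscal; simpl vx; simpl vy; simpl vh.
    apply vec_ext; simpl vx; simpl vy; simpl vh; unfold D, M;
      field_simplify_eq; try (repeat split; fold D; fold M; lra);
      unfold d1, d2, n1, n2; ring.
Qed.

Definition mob_mul (m n : mob) : mob :=
  ((fst m * fst n + snd m * Cconj (snd n))%C, (fst m * snd n + snd m * Cconj (fst n))%C).

Lemma mob_mul_disk m n : is_disk_mob m -> is_disk_mob n -> is_disk_mob (mob_mul m n).
Proof.
  destruct m as [[a1 a2] [b1 b2]], n as [[c1 c2] [d1 d2]]. unfold mob_mul, Cconj, Cmult, Cplus.
  simpl fst; simpl snd. rewrite !disk_mob_coords. intros Hm Hn.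
  transitivity ((a1 ^ 2 + a2 ^ 2 - (b1 ^ 2 + b2 ^ 2)) * (c1 ^ 2 + c2 ^ 2 - (d1 ^ 2 + d2 ^ 2))).
  - ring.
  - rewrite Hm, Hn. ring.
Qed.

Lemma mob_inv_disk m : is_disk_mob m -> is_disk_mob (mob_inv m).
Proof.
  destruct m as [[a1 a2] [b1 b2]]. unfold mob_inv, Cconj, Copp. simpl fst; simpl snd.
  rewrite !disk_mob_coords. intros H. rewrite <- H. ring.
Qed.

Lemma mob_mul_act m n z : is_disk_mob m -> is_disk_mob n -> Cmod z <= 1 ->
  mob_act (mob_mul m n) z = mob_act m (mob_act n z).
Proof.
  intros Hm Hn Hz. pose proof (mob_den n z Hn Hz) as D1.
  pose proof (mob_den m _ Hm (proj1 (mob_kv n z Hn Hz))) as D2.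
  pose proof (mob_den _ z (mob_mul_disk m n Hm Hn) Hz) as D3.
  destruct m as [a b], n as [c d]. unfold mob_act, mob_mul in *. simpl fst in *; simpl snd in *.
  rewrite !Cplus_conj, !Cmult_conj, !Cconj_conj in *.
  field. repeat split; try assumption.
  match goal with |- ?n <> _ => intros E; apply D2;
    transitivity (n / (Cconj d * z + Cconj c))%C; [field; exact D1 | rewrite E; field; exact D1] end.
Qed.

Lemma mob_inv_act m z : is_disk_mob m -> Cmod z <= 1 -> mob_act (mob_inv m) (mob_act m z) = z.
Proof.
  intros Hm Hz. rewrite <- mob_mul_act by (try apply mob_inv_disk; assumption).
  assert (E : mob_mul (mob_inv m) m = (RtoC 1, RtoC 0)).
  { destruct m as [[a1 a2] [b1 b2]]. rewrite disk_mob_coords in Hm.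
    unfold mob_mul, mob_inv, Cconj, Cmult, Cplus, Copp, RtoC. simpl fst; simpl snd.
    apply injective_projections; apply injective_projections; cbn [fst snd]; rewrite <- ?Hm; ring. }
  rewrite E. unfold mob_act. simpl fst; simpl snd.
  replace (Cconj (RtoC 0)) with (RtoC 0) by (unfold Cconj, RtoC; simpl; f_equal; ring).
  replace (Cconj (RtoC 1)) with (RtoC 1) by (unfold Cconj, RtoC; simpl; f_equal; ring).
  field.
Qed.

Lemma in_disk_le z : in_disk z -> Cmod z <= 1.
Proof. unfold in_disk. lra. Qed.

Lemma on_circle_le z : on_circle z -> Cmod z <= 1.
Proof. unfold on_circle. lra. Qed.

Lemma mob_in_disk m z : is_disk_mob m -> in_disk z -> in_disk (mob_act m z).
Proof. intros Hm Hz. apply (mob_kv m z Hm (in_disk_le z Hz)), Hz. Qed.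

Lemma mob_on_circle m z : is_disk_mob m -> on_circle z -> on_circle (mob_act m z).
Proof. intros Hm Hz. apply (mob_kv m z Hm (on_circle_le z Hz)), Hz. Qed.

Lemma mob_kv_scal m z : is_disk_mob m -> Cmod z <= 1 ->
  exists c, 0 < c /\ lor m (kv z) = vscal c (kv (mob_act m z)).
Proof. intros Hm Hz. apply (mob_kv m z Hm Hz). Qed.

Lemma Cdiv_eq (n d w : C) : d <> RtoC 0 -> (n / d)%C = w -> n = (w * d)%C.
Proof. intros Hd <-. field. exact Hd. Qed.

(* Fixing [0] and [1 / 2] forces [b = 0] and [a] real. *)
Lemma mob_id_circle m z : is_disk_mob m -> (forall u, in_disk u -> mob_act m u = u) ->
  on_circle z -> mob_act m z = z.
Proof.
  intros Hm Hid Hz.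
  assert (H0 : in_disk (RtoC 0)) by (unfold in_disk; rewrite Cmod_0; lra).
  assert (H1 : in_disk (RtoC (/ 2))) by (unfold in_disk; rewrite Cmod_R, Rabs_pos_eq; lra).
  pose proof (mob_den m _ Hm (in_disk_le _ H0)) as D0.
  pose proof (mob_den m _ Hm (in_disk_le _ H1)) as D1.
  pose proof (mob_den m z Hm (on_circle_le _ Hz)) as D2.
  pose proof (Hid _ H0) as E0. pose proof (Hid _ H1) as E1. clear Hid.
  destruct m as [a b]. unfold mob_act in *. simpl fst in *; simpl snd in *.
  assert (Hb : b = RtoC 0).
  { pose proof (Cdiv_eq _ _ _ D0 E0) as E. transitivity (a * RtoC 0 + b)%C; [ring|].
    rewrite E. ring. }
  subst b.
  replace (Cconj (RtoC 0)) with (RtoC 0) in * by (unfold Cconj, RtoC; simpl; f_equal; ring).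
  assert (Ha : a = Cconj a).
  { assert (E : (a * RtoC (/ 2))%C = (RtoC (/ 2) * Cconj a)%C).
    { pose proof (Cdiv_eq _ _ _ D1 E1) as E. transitivity (a * RtoC (/ 2) + RtoC 0)%C; [ring|].
      rewrite E. ring. }
    destruct a as [a1 a2].
    unfold Cconj, Cmult, RtoC in *. simpl in *. injection E as Ea Eb. f_equal. lra. }
  rewrite <- Ha in *. field. intros H. apply D2. rewrite H. ring.
Qed.

(** * Ideal endpoints *)

(* [X] is the ideal endpoint of the ray from [b] through [a]: in the Klein model, betweenness is a positive
   combination of the lifts [kv]. *)
Definition is_start (X a b : C) : Prop :=
  on_circle X /\ exists s t, 0 < s /\ 0 < t /\ kv a = vadd (vscal s (kv X)) (vscal t (kv b)).

Lemma kv_inj_circle X Y : on_circle X -> on_circle Y -> kv X = kv Y -> X = Y.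
Proof.
  intros HX HY H. rewrite !kv_circle in H by assumption. injection H as H1 H2.
  destruct X, Y. simpl in *. subst. reflexivity.
Qed.

Lemma is_start_unique X Y a b : in_disk a -> is_start X a b -> is_start Y a b -> X = Y.
Proof.
  intros Ha [HX (s & t & Hs & Ht & E1)] [HY (s' & t' & Hs' & Ht' & E2)].
  apply kv_inj_circle; [exact HX | exact HY|].
  pose proof (kv_timelike a Ha) as [_ Hta].
  rewrite (kv_circle X HX) in *. rewrite (kv_circle Y HY) in *.
  apply Cmod_eq_1 in HX. apply Cmod_eq_1 in HY.
  destruct X as [x y], Y as [x' y']. cbn [fst snd] in *.
  destruct (kv a) as [a1 a2 h] eqn:Ea. destruct (kv b) as [b1 b2 h'] eqn:Eb.
  assert (h = 1) by (apply (f_equal vh) in Ea; simpl in Ea; lra).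
  assert (h' = 1) by (apply (f_equal vh) in Eb; simpl in Eb; lra). subst h h'.
  unfold vadd, vscal in *. cbn [vx vy vh] in *.
  injection E1 as A1 A2 A3. injection E2 as B1 B2 B3.
  assert (Ht1 : t = 1 - s) by lra. assert (Ht1' : t' = 1 - s') by lra. subst t t'.
  assert (s = s').
  { (* [X] and [Y] both come from the negative root of the quadratic that cuts the circle on the chord *)
    set (u := b1 - a1) in *. set (v := b2 - a2) in *.
    set (r := (1 - s) / s). set (r' := (1 - s') / s').
    assert (Hr : 0 < r) by (apply Rdiv_lt_0_compat; assumption).
    assert (Hr' : 0 < r') by (apply Rdiv_lt_0_compat; assumption).
    assert (Hx : x = a1 - r * u) by (unfold r, u; field_simplify_eq; [nra | lra]).
    assert (Hy : y = a2 - r * v) by (unfold r, v; field_simplify_eq; [nra | lra]).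
    assert (Hx' : x' = a1 - r' * u) by (unfold r', u; field_simplify_eq; [nra | lra]).
    assert (Hy' : y' = a2 - r' * v) by (unfold r', v; field_simplify_eq; [nra | lra]).
    assert (Q : (r - r') * ((u ^ 2 + v ^ 2) * (r + r') - 2 * (a1 * u + a2 * v)) = 0).
    { subst x y x' y'. nra. }
    assert (Huv : 0 < u ^ 2 + v ^ 2).
    { destruct (Req_dec u 0) as [U|U]; [|nra]. destruct (Req_dec v 0) as [W|W]; [|nra].
      exfalso. subst x y. rewrite U, W in HX. nra. }
    assert (Hrr : r = r').
    { apply Rmult_integral in Q. destruct Q as [Q|Q]; [lra|].
      exfalso. assert (Hq : r ^ 2 * (u ^ 2 + v ^ 2) - 2 * r * (a1 * u + a2 * v) > 0) by (subst x y; nra).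
      assert (Hq' : r * ((u ^ 2 + v ^ 2) * r - 2 * (a1 * u + a2 * v)) > 0) by (clear - Hq; replace (r * _) with (r ^ 2 * (u ^ 2 + v ^ 2) - 2 * r * (a1 * u + a2 * v)) by ring; exact Hq).
      assert (0 < r * r' * (u ^ 2 + v ^ 2)) by (apply Rmult_lt_0_compat; [apply Rmult_lt_0_compat; assumption | exact Huv]).
      replace (2 * (a1 * u + a2 * v)) with ((u ^ 2 + v ^ 2) * (r + r')) in Hq' by (clear - Q; lra).
      clear - Hq' H. nra. }
    unfold r, r' in Hrr. apply (f_equal (fun z => z * (s * s'))) in Hrr.
    replace ((1 - s) / s * (s * s')) with ((1 - s) * s') in Hrr by (field; lra).
    replace ((1 - s') / s' * (s * s')) with ((1 - s') * s) in Hrr by (field; lra). lra. }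
  subst s'. f_equal.
  - apply Rmult_eq_reg_l with s; lra.
  - apply Rmult_eq_reg_l with s; lra.
Qed.

Lemma klein_kv z : klein z = (vx (kv z), vy (kv z)).
Proof. unfold kv. cbn [vx vy]. destruct (klein z). reflexivity. Qed.

Lemma chord_disc (a1 a2 u v : R) : a1 ^ 2 + a2 ^ 2 < 1 -> 0 < u ^ 2 + v ^ 2 ->
  (a1 * u + a2 * v) ^ 2 < (a1 * u + a2 * v) ^ 2 - (u ^ 2 + v ^ 2) * (a1 ^ 2 + a2 ^ 2 - 1).
Proof.
  intros Ha Hd. assert (0 < (u ^ 2 + v ^ 2) * (1 - (a1 ^ 2 + a2 ^ 2))) by (apply Rmult_lt_0_compat; lra). lra.
Qed.

(** The two choices of [sgn] give the two roots of the quadratic that intersects the chord line with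
    the circle. As [a] is inside, the root of the discriminant exceeds the linear term, and each
    root has the sign of [sgn]. *)
Lemma chord_point (a b : C) (sgn : R) : in_disk a -> klein a <> klein b -> sgn ^ 2 = 1 ->
  let t := chord_param a b sgn in
  on_circle (klein a + RtoC t * (klein b - klein a))%C /\ 0 < sgn * t.
Proof.
  intros Ha Hne Hsgn t. pose proof (kv_timelike a Ha) as [_ Hta].
  unfold t, chord_param, cdot. rewrite !Cmod_sq.
  assert (Ea : vx (kv a) = fst (klein a) /\ vy (kv a) = snd (klein a)) by (split; reflexivity).
  destruct Ea as [Ea1 Ea2]. rewrite Ea1, Ea2 in Hta.
  destruct (klein a) as [a1 a2]. destruct (klein b) as [b1 b2]. simpl vh in Hta.
  unfold on_circle. rewrite Cmod_eq_1.
  unfold Cminus, Cplus, Copp, Cmult, RtoC, Re, Im. cbn [fst snd] in *.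
  set (u := b1 + - a1). set (v := b2 + - a2).
  assert (Huv : 0 < u ^ 2 + v ^ 2).
  { destruct (Req_dec u 0) as [U|U]; [|nra]. destruct (Req_dec v 0) as [W|W]; [|nra].
    exfalso. apply Hne. unfold u, v in *. f_equal; lra. }
  pose proof (chord_disc a1 a2 u v ltac:(lra) Huv) as Hdisc.
  set (p := a1 * u + a2 * v) in *. set (D := p ^ 2 - (u ^ 2 + v ^ 2) * (a1 ^ 2 + a2 ^ 2 - 1)) in *.
  set (w := sqrt D).
  assert (Hw : w ^ 2 = D) by (unfold w; apply pow2_sqrt; nra).
  assert (Hw0 : 0 <= w) by apply sqrt_pos.
  set (Q := u ^ 2 + v ^ 2) in *. split.
  - replace (_ + _) with (a1 ^ 2 + a2 ^ 2 + (2 * p * (- p + sgn * w) + (- p + sgn * w) ^ 2) / Q)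
      by (unfold p, Q; field; fold Q; lra).
    replace (2 * p * (- p + sgn * w) + (- p + sgn * w) ^ 2) with (sgn ^ 2 * w ^ 2 - p ^ 2) by ring.
    rewrite Hsgn, Hw. unfold D. field. lra.
  - replace (sgn * ((- p + sgn * w) / Q)) with ((sgn ^ 2 * w - sgn * p) / Q) by (field; lra).
    rewrite Hsgn. apply Rdiv_lt_0_compat; [|exact Huv].
    assert ((sgn * p) ^ 2 < w ^ 2) by (rewrite Hw; replace ((sgn * p) ^ 2) with (sgn ^ 2 * p ^ 2) by ring; rewrite Hsgn; lra).
    nra.
Qed.

Lemma geod_start_spec a b : in_disk a -> klein a <> klein b -> is_start (geod_start a b) a b.
Proof.
  intros Ha Hne. destruct (chord_point a b (-1) Ha Hne ltac:(ring)) as [Hc Ht].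
  unfold geod_start. set (t := chord_param a b (-1)) in *. split; [exact Hc|].
  exists (/ (1 - t)), (- t / (1 - t)).
  assert (0 < / (1 - t)) by (apply Rinv_0_lt_compat; lra).
  split; [assumption|]. split; [apply Rmult_lt_0_compat; lra|].
  rewrite (kv_circle _ Hc). unfold kv. destruct (klein a) as [a1 a2], (klein b) as [b1 b2].
  unfold Cminus, Cplus, Copp, Cmult, RtoC, Re, Im, vadd, vscal. cbn [fst snd vx vy vh].
  f_equal; field; lra.
Qed.

Lemma geod_end_start a b : in_disk a -> in_disk b -> klein a <> klein b -> geod_end a b = geod_start b a.
Proof.
  intros Ha Hb Hne. apply (is_start_unique _ _ b a Hb); [|apply geod_start_spec; auto].
  destruct (chord_point a b 1 Ha Hne ltac:(ring)) as [Hc Ht].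
  unfold geod_end. set (t := chord_param a b 1) in *. split; [exact Hc|].
  (* the chord leaves the disk after [b] *)
  assert (Ht1 : 1 < t).
  { apply Rnot_le_lt. intros Hle. pose proof (kv_timelike a Ha) as [_ Hta].
    pose proof (kv_timelike b Hb) as [_ Htb].
    apply Cmod_eq_1 in Hc. unfold kv in *. destruct (klein a) as [a1 a2], (klein b) as [b1 b2].
    unfold Cminus, Cplus, Copp, Cmult, RtoC, Re, Im in *. cbn [fst snd vx vy vh] in *.
    assert (Hab : a1 * b1 + a2 * b2 < 1) by (pose proof (pow2_ge_0 (a1 - b1)); pose proof (pow2_ge_0 (a2 - b2)); nra).
    assert (Ht0 : 0 < t) by lra.
    assert (Ht2 : 0 < t ^ 2) by (apply pow_lt; exact Ht0).
    assert (Htt : 0 <= 2 * t * (1 - t)) by (apply Rmult_le_pos; lra).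
    assert (E : 1 = (1 - t) ^ 2 * (a1 ^ 2 + a2 ^ 2) + 2 * t * (1 - t) * (a1 * b1 + a2 * b2) + t ^ 2 * (b1 ^ 2 + b2 ^ 2))
      by (symmetry; etransitivity; [|exact Hc]; ring).
    assert ((1 - t) ^ 2 * (a1 ^ 2 + a2 ^ 2) <= (1 - t) ^ 2 * 1) by (apply Rmult_le_compat_l; [apply pow2_ge_0 | lra]).
    assert (2 * t * (1 - t) * (a1 * b1 + a2 * b2) <= 2 * t * (1 - t) * 1) by (apply Rmult_le_compat_l; lra).
    assert (t ^ 2 * (b1 ^ 2 + b2 ^ 2) < t ^ 2 * 1) by (apply Rmult_lt_compat_l; lra). nra. }
  exists (/ t), ((t - 1) / t).
  assert (0 < / t) by (apply Rinv_0_lt_compat; lra).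
  split; [assumption|]. split; [apply Rmult_lt_0_compat; lra|].
  rewrite (kv_circle _ Hc). unfold kv. destruct (klein a) as [a1 a2], (klein b) as [b1 b2].
  unfold Cminus, Cplus, Copp, Cmult, RtoC, Re, Im, vadd, vscal. cbn [fst snd vx vy vh].
  f_equal; field; lra.
Qed.

Lemma vscal_cancel c u v : c <> 0 -> vscal c u = vscal c v -> u = v.
Proof.
  intros Hc H. rewrite <- (vscal_1 u), <- (vscal_1 v).
  replace 1 with (/ c * c) by (field; exact Hc). rewrite <- !vscal_vscal, H. reflexivity.
Qed.

Lemma mob_comb m X a b s t : is_disk_mob m -> Cmod X <= 1 -> Cmod a <= 1 -> Cmod b <= 1 ->
  0 < s -> 0 < t -> kv a = vadd (vscal s (kv X)) (vscal t (kv b)) ->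
  exists s' t', 0 < s' /\ 0 < t' /\
    kv (mob_act m a) = vadd (vscal s' (kv (mob_act m X))) (vscal t' (kv (mob_act m b))).
Proof.
  intros Hm HX Ha Hb Hs Ht E.
  destruct (mob_kv_scal m X Hm HX) as (cX & HcX & EX).
  destruct (mob_kv_scal m a Hm Ha) as (ca & Hca & Ea).
  destruct (mob_kv_scal m b Hm Hb) as (cb & Hcb & Eb).
  exists (s * cX / ca), (t * cb / ca).
  split; [apply Rdiv_lt_0_compat; [apply Rmult_lt_0_compat|]; assumption|].
  split; [apply Rdiv_lt_0_compat; [apply Rmult_lt_0_compat|]; assumption|].
  apply (vscal_cancel ca); [lra|]. rewrite <- Ea, E, lor_add, !lor_scal, EX, Eb, vscal_add, !vscal_vscal.
  f_equal; f_equal; field; lra.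
Qed.

Lemma is_start_mob m X a b : is_disk_mob m -> in_disk a -> in_disk b -> is_start X a b ->
  is_start (mob_act m X) (mob_act m a) (mob_act m b).
Proof.
  intros Hm Ha Hb [HX (s & t & Hs & Ht & E)]. split; [apply mob_on_circle; assumption|].
  apply (mob_comb m X a b s t); auto using in_disk_le, on_circle_le.
Qed.

Lemma is_start_geod X a b : in_disk a -> klein a <> klein b -> is_start X a b -> X = geod_start a b.
Proof. intros Ha Hne H. apply (is_start_unique _ _ a b Ha H), geod_start_spec; assumption. Qed.

(** With [X], [a], [v], [c] in this order on a line, eliminating [a] from the two betweenness
    relations leaves the factor [1 - s * t'] in front of [v]. *)
Lemma is_start_extend X a v c s t : 0 < s -> 0 < t ->
  kv v = vadd (vscal s (kv a)) (vscal t (kv c)) -> is_start X a v -> is_start X v c.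
Proof.
  intros Hs Ht E [HX (s' & t' & Hs' & Ht' & E')]. split; [exact HX|].
  assert (H1 : s + t = 1) by (apply (f_equal vh) in E; simpl in E; lra).
  assert (H2 : s' + t' = 1) by (apply (f_equal vh) in E'; simpl in E'; lra).
  assert (Hp : 0 < 1 - s * t') by nra.
  exists (s * s' / (1 - s * t')), (t / (1 - s * t')).
  split; [apply Rdiv_lt_0_compat; [apply Rmult_lt_0_compat|]; assumption|].
  split; [apply Rdiv_lt_0_compat; assumption|].
  apply (vscal_cancel (1 - s * t')); [lra|]. rewrite vscal_add, !vscal_vscal.
  replace ((1 - s * t') * (s * s' / (1 - s * t'))) with (s * s') by (field; lra).
  replace ((1 - s * t') * (t / (1 - s * t'))) with t by (field; lra).
  apply vec_ext; [apply (f_equal vx) in E; apply (f_equal vx) in E' |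
    apply (f_equal vy) in E; apply (f_equal vy) in E' | apply (f_equal vh) in E; apply (f_equal vh) in E'];
    unfold vadd, vscal in *; cbn [vx vy vh] in *; rewrite E' in E; lra.
Qed.

(** * Angles *)

(** The automorphism [w -> (w - v) / (1 - conj v * w)], scaled to satisfy [is_disk_mob]. Its values
    are [tangent_dir v w], so it turns angles at [v] into Euclidean angles at 0. *)
Definition dmap (v : C) : mob :=
  (RtoC (/ sqrt (1 - Cmod v ^ 2)), (RtoC (/ sqrt (1 - Cmod v ^ 2)) * - v)%C).

Lemma dmap_sqrt v : in_disk v -> 0 < sqrt (1 - Cmod v ^ 2).
Proof. intros Hv. apply Cmod_lt_1 in Hv. rewrite <- Cmod_sq in Hv. apply sqrt_lt_R0. lra. Qed.

Lemma dmap_disk v : in_disk v -> is_disk_mob (dmap v).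
Proof.
  intros Hv. pose proof (dmap_sqrt v Hv) as Hs. apply Cmod_lt_1 in Hv. rewrite <- Cmod_sq in Hv.
  unfold dmap, is_disk_mob. cbn [fst snd]. rewrite Cmod_mult, Cmod_opp, Cmod_R.
  rewrite Rabs_pos_eq by (apply Rlt_le, Rinv_0_lt_compat, Hs).
  set (s := sqrt (1 - Cmod v ^ 2)) in *.
  assert (Hs2 : s ^ 2 = 1 - Cmod v ^ 2) by (unfold s; apply pow2_sqrt; lra).
  replace ((/ s) ^ 2 - (/ s * Cmod v) ^ 2) with ((1 - Cmod v ^ 2) / s ^ 2) by (field; lra).
  rewrite <- Hs2. field. lra.
Qed.

Lemma dmap_act v w : in_disk v -> Cmod w <= 1 -> mob_act (dmap v) w = tangent_dir v w.
Proof.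
  intros Hv Hw. pose proof (mob_den _ w (dmap_disk v Hv) Hw) as Hd.
  pose proof (dmap_sqrt v Hv) as Hs. unfold mob_act, dmap, tangent_dir in *. cbn [fst snd] in *.
  set (s := sqrt (1 - Cmod v ^ 2)) in *. set (c := RtoC (/ s)) in *.
  assert (Hc : c <> RtoC 0).
  { intros H. injection H as H. pose proof (Rinv_0_lt_compat s Hs). lra. }
  assert (Ec : Cconj c = c) by (unfold c, Cconj, RtoC; simpl; f_equal; ring).
  rewrite Cmult_conj, Copp_conj, Ec in *.
  assert (Hd' : (RtoC 1 - Cconj v * w)%C <> RtoC 0).
  { intros H. apply Hd. transitivity (c * (RtoC 1 - Cconj v * w))%C; [ring | rewrite H; ring]. }
  replace (c * - Cconj v * w + c)%C with (c * (RtoC 1 - Cconj v * w))%C by ring.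
  field. split; assumption.
Qed.

Lemma tangent_in_disk v w : in_disk v -> in_disk w -> in_disk (tangent_dir v w).
Proof.
  intros Hv Hw. rewrite <- dmap_act by auto using in_disk_le.
  apply mob_in_disk; auto using dmap_disk.
Qed.

Lemma tangent_self v : tangent_dir v v = RtoC 0.
Proof. unfold tangent_dir, Cdiv. ring. Qed.

Lemma dmap_kv v w : in_disk v -> in_disk w ->
  exists c, 0 < c /\ lor (dmap v) (kv w) = vscal c (kv (tangent_dir v w)).
Proof.
  intros Hv Hw. rewrite <- dmap_act by auto using in_disk_le.
  apply mob_kv_scal; auto using dmap_disk, in_disk_le.
Qed.

Definition kfac (z : C) : R := 2 / (1 + Cmod z ^ 2).

Lemma kfac_pos z : 0 < kfac z.
Proof. unfold kfac. apply Rdiv_lt_0_compat; [lra|]. pose proof (pow2_ge_0 (Cmod z)). lra. Qed.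

Lemma kv_kfac z : kv z = V3 (kfac z * Re z) (kfac z * Im z) 1.
Proof.
  unfold kv, klein. fold (kfac z). destruct z. unfold Cmult, RtoC, Re, Im. cbn [fst snd].
  f_equal; ring.
Qed.

(* [gram v a b] is, up to positive factors, the inner product of the directions from [v] to [a], [b]. *)
Definition gram (v a b : vec) : R := mdot a v * mdot b v - mdot a b * mdot v v.

Lemma gram_scal v a b c d e : gram (vscal c v) (vscal d a) (vscal e b) = c ^ 2 * d * e * gram v a b.
Proof. unfold gram. rewrite !mdot_scal_l, !mdot_scal_r. ring. Qed.

Lemma gram_lor m v a b : is_disk_mob m -> gram (lor m v) (lor m a) (lor m b) = gram v a b.
Proof. intros H. unfold gram. rewrite !lor_mdot by exact H. reflexivity. Qed.

Lemma gram_origin a b : gram (kv (RtoC 0)) (kv a) (kv b) = kfac a * kfac b * cdot a b.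
Proof. rewrite kv_0, !kv_kfac. unfold gram, mdot, cdot. cbn [vx vy vh]. ring. Qed.

Definition gcos (v a b : vec) : R := gram v a b / sqrt (gram v a a * gram v b b).

Lemma gcos_scal v a b c d e : 0 < c -> 0 < d -> 0 < e ->
  gcos (vscal c v) (vscal d a) (vscal e b) = gcos v a b.
Proof.
  intros Hc Hd He. unfold gcos. rewrite !gram_scal.
  set (k := c ^ 2 * d * e). assert (Hk : 0 < k) by (unfold k; repeat apply Rmult_lt_0_compat; try lra).
  replace (_ * (c ^ 2 * e * e * gram v b b)) with (k ^ 2 * (gram v a a * gram v b b)) by (unfold k; ring).
  rewrite sqrt_mult_alt by apply pow2_ge_0. rewrite sqrt_pow2 by lra.
  apply Rdiv_mult_l_l. lra.
Qed.

Lemma gcos_lor m v a b : is_disk_mob m -> gcos (lor m v) (lor m a) (lor m b) = gcos v a b.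
Proof. intros H. unfold gcos. rewrite !gram_lor by exact H. reflexivity. Qed.

Lemma gcos_origin a b : gcos (kv (RtoC 0)) (kv a) (kv b) = cdot a b / (Cmod a * Cmod b).
Proof.
  unfold gcos. rewrite !gram_origin. pose proof (kfac_pos a). pose proof (kfac_pos b).
  assert (Hself : forall z, cdot z z = Cmod z ^ 2).
  { intros z. rewrite Cmod_sq. unfold cdot, Re, Im. ring. }
  rewrite !Hself.
  replace (_ * (kfac b * kfac b * Cmod b ^ 2)) with ((kfac a * kfac b * (Cmod a * Cmod b)) ^ 2) by ring.
  rewrite sqrt_pow2.
  - apply Rdiv_mult_l_l. apply Rgt_not_eq, Rmult_lt_0_compat; assumption.
  - pose proof (Cmod_ge_0 a). pose proof (Cmod_ge_0 b). apply Rmult_le_pos; apply Rmult_le_pos; lra.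
Qed.

Lemma hangle_gcos v a b : in_disk v -> in_disk a -> in_disk b ->
  hangle v a b = acos (gcos (kv v) (kv a) (kv b)).
Proof.
  intros Hv Ha Hb. unfold hangle, angle_between. f_equal. rewrite <- gcos_origin.
  destruct (dmap_kv v v Hv Hv) as (c & Hc & E). destruct (dmap_kv v a Hv Ha) as (d & Hd & Ea).
  destruct (dmap_kv v b Hv Hb) as (e & He & Eb). rewrite tangent_self in E.
  rewrite <- (gcos_lor (dmap v) (kv v)) by (apply dmap_disk, Hv).
  rewrite E, Ea, Eb, gcos_scal by assumption. reflexivity.
Qed.

Lemma hangle_mob m v a b : is_disk_mob m -> in_disk v -> in_disk a -> in_disk b ->
  hangle (mob_act m v) (mob_act m a) (mob_act m b) = hangle v a b.
Proof.
  intros Hm Hv Ha Hb. rewrite !hangle_gcos by auto using mob_in_disk. f_equal.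
  destruct (mob_kv_scal m v Hm (in_disk_le _ Hv)) as (c & Hc & E).
  destruct (mob_kv_scal m a Hm (in_disk_le _ Ha)) as (d & Hd & Ea).
  destruct (mob_kv_scal m b Hm (in_disk_le _ Hb)) as (e & He & Eb).
  rewrite <- (gcos_lor m (kv v)) by exact Hm. rewrite E, Ea, Eb, gcos_scal by assumption. reflexivity.
Qed.

Lemma hangle_sym v a b : hangle v a b = hangle v b a.
Proof.
  unfold hangle, angle_between. f_equal. rewrite (Rmult_comm (Cmod _)). f_equal. unfold cdot. ring.
Qed.

Lemma cos_ratio_bound a b : -1 <= cdot a b / (Cmod a * Cmod b) <= 1.
Proof.
  pose proof (Cmod_ge_0 a). pose proof (Cmod_ge_0 b).
  set (k := Cmod a * Cmod b). assert (Hk : 0 <= k) by (apply Rmult_le_pos; assumption).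
  assert (Hcs : cdot a b ^ 2 <= k ^ 2).
  { unfold k. rewrite Rpow_mult_distr, !Cmod_sq. destruct a, b. unfold cdot, Re, Im. cbn [fst snd].
    match goal with |- ?l <= ?r => assert (0 <= r - l) end; [|lra].
    replace (_ - _) with ((r * r2 - r0 * r1) ^ 2) by ring. apply pow2_ge_0. }
  destruct (Req_dec k 0) as [->|Hk0]; [unfold Rdiv; rewrite Rinv_0; lra|].
  assert (- k <= cdot a b <= k) by (split; nra).
  split; apply Rmult_le_reg_r with k; try lra; unfold Rdiv; rewrite Rmult_assoc, Rinv_l; lra.
Qed.

Lemma acos_sum_PI x y : -1 <= x <= 1 -> -1 <= y <= 1 -> acos x + acos y = PI -> y = - x.
Proof.
  intros Hx Hy H. rewrite <- (cos_acos y Hy). replace (acos y) with (PI - acos x) by lra.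
  rewrite Rtrigo_facts.cos_pi_minus, cos_acos by exact Hx. reflexivity.
Qed.

Lemma det3_origin a b : det3 (kv (RtoC 0)) (kv a) (kv b) = kfac a * kfac b * ccross a b.
Proof. rewrite kv_0, !kv_kfac. unfold det3, mcross, mdot, ccross. cbn [vx vy vh]. ring. Qed.

(** After division by the lengths of [c] and [x], the dot products with [b] are opposite; dot and
    cross product together have a fixed sum of squares, so the cross products agree up to sign, and
    the sign condition makes them opposite too. Both products with [b] determine a vector. *)
Lemma planar_opposite (b c x : C) : ccross b c * ccross b x < 0 ->
  cdot b x / (Cmod b * Cmod x) = - (cdot b c / (Cmod b * Cmod c)) ->
  exists k, 0 < k /\ Re x = - k * Re c /\ Im x = - k * Im c.
Proof.
  intros Hcr Hcos.
  assert (Hpos : forall z, 0 < Cmod z \/ (fst z = 0 /\ snd z = 0)).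
  { intros z. destruct (Cmod_ge_0 z) as [H|H]; [left; exact H|]. right.
    pose proof (Cmod_sq z) as E. rewrite <- H in E. split; nra. }
  unfold ccross, cdot, Re, Im in *.
  destruct (Hpos b) as [Hb|[H1 H2]]; [|rewrite H1, H2 in Hcr; lra].
  destruct (Hpos c) as [Hc|[H1 H2]]; [|rewrite H1, H2 in Hcr; lra].
  destruct (Hpos x) as [Hx|[H1 H2]]; [|rewrite H1, H2 in Hcr; lra].
  pose proof (Cmod_sq b) as Sb. pose proof (Cmod_sq c) as Sc. pose proof (Cmod_sq x) as Sx.
  clear Hpos.
  destruct b as [b1 b2], c as [c1 c2], x as [x1 x2]. cbn [fst snd] in *.
  set (nb := Cmod (b1, b2)) in *. set (nc := Cmod (c1, c2)) in *. set (nx := Cmod (x1, x2)) in *.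
  assert (E1 : nc * (b1 * x1 + b2 * x2) + nx * (b1 * c1 + b2 * c2) = 0).
  { apply (f_equal (fun z => z * (nb * nc * nx))) in Hcos.
    replace ((b1 * x1 + b2 * x2) / (nb * nx) * (nb * nc * nx)) with (nc * (b1 * x1 + b2 * x2)) in Hcos
      by (field; lra).
    replace (- ((b1 * c1 + b2 * c2) / (nb * nc)) * (nb * nc * nx)) with (- (nx * (b1 * c1 + b2 * c2))) in Hcos
      by (field; lra). lra. }
  set (P := b1 * c2 - b2 * c1) in *. set (Q := b1 * x2 - b2 * x1) in *.
  set (p := b1 * c1 + b2 * c2) in *. set (q := b1 * x1 + b2 * x2) in *.
  assert (EP : P ^ 2 + p ^ 2 = nb ^ 2 * nc ^ 2) by (rewrite Sb, Sc; unfold P, p; ring).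
  assert (EQ : Q ^ 2 + q ^ 2 = nb ^ 2 * nx ^ 2) by (rewrite Sb, Sx; unfold Q, q; ring).
  assert (E2 : nc * Q + nx * P = 0).
  { assert ((nc * Q - nx * P) * (nc * Q + nx * P) = 0).
    { replace ((nc * Q - nx * P) * (nc * Q + nx * P)) with
        (nc ^ 2 * (Q ^ 2 + q ^ 2) - nx ^ 2 * (P ^ 2 + p ^ 2) - (nc * q + nx * p) * (nc * q - nx * p)) by ring.
      rewrite EP, EQ, E1. ring. }
    apply Rmult_integral in H. destruct H as [H|H]; [|exact H]. exfalso.
    assert (Hc2 : nc * (P * Q) = nx * P ^ 2) by (replace (nc * (P * Q)) with (P * (nc * Q)) by ring; replace (nc * Q) with (nx * P) by lra; ring).
    assert (0 <= nx * P ^ 2) by (apply Rmult_le_pos; [lra | apply pow2_ge_0]).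
    assert (nc * (P * Q) < 0) by nra. lra. }
  exists (nx / nc). split; [apply Rdiv_lt_0_compat; assumption|].
  assert (Hnb : 0 < nb ^ 2) by (apply pow_lt; exact Hb).
  split.
  - apply Rmult_eq_reg_l with (nb ^ 2 * nc); [|apply Rgt_not_eq, Rmult_lt_0_compat; assumption].
    replace (nb ^ 2 * nc * (- (nx / nc) * c1)) with (- (nb ^ 2 * nx * c1)) by (field; lra).
    apply Rminus_diag_uniq. rewrite Sb.
    replace (_ - _) with (b1 * (nc * q + nx * p) - b2 * (nc * Q + nx * P)) by (unfold P, Q, p, q; ring).
    rewrite E1, E2. ring.
  - apply Rmult_eq_reg_l with (nb ^ 2 * nc); [|apply Rgt_not_eq, Rmult_lt_0_compat; assumption].
    replace (nb ^ 2 * nc * (- (nx / nc) * c2)) with (- (nb ^ 2 * nx * c2)) by (field; lra).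
    apply Rminus_diag_uniq. rewrite Sb.
    replace (_ - _) with (b2 * (nc * q + nx * p) + b1 * (nc * Q + nx * P)) by (unfold P, Q, p, q; ring).
    rewrite E1, E2. ring.
Qed.

(* Supplementary angles on the two sides of a common ray: the other two rays are opposite. *)
Lemma opposite_rays v b c x : in_disk v -> in_disk b -> in_disk c -> in_disk x ->
  hangle v b c + hangle v b x = PI ->
  det3 (kv v) (kv b) (kv c) * det3 (kv v) (kv b) (kv x) < 0 ->
  exists s t, 0 < s /\ 0 < t /\ kv v = vadd (vscal s (kv x)) (vscal t (kv c)).
Proof.
  intros Hv Hb Hc Hx Hang Hdet. pose proof (dmap_disk v Hv) as Hm.
  apply acos_sum_PI in Hang; [|apply cos_ratio_bound|apply cos_ratio_bound].
  destruct (dmap_kv v v Hv Hv) as (kv0 & Hk & E). rewrite tangent_self in E.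
  destruct (dmap_kv v b Hv Hb) as (kb & Hkb & Eb).
  destruct (dmap_kv v c Hv Hc) as (kc & Hkc & Ec).
  destruct (dmap_kv v x Hv Hx) as (kx & Hkx & Ex).
  rewrite <- (lor_det3 (dmap v) (kv v) (kv b) (kv c)) in Hdet by exact Hm.
  rewrite <- (lor_det3 (dmap v) (kv v) (kv b) (kv x)) in Hdet by exact Hm.
  rewrite E, Eb, Ec, Ex in Hdet.
  assert (Hs : forall p q r a b c, det3 (vscal p a) (vscal q b) (vscal r c) = p * q * r * det3 a b c)
    by (intros; vec_ring).
  rewrite !Hs, !det3_origin in Hdet. clear Hs.
  set (B := tangent_dir v b) in *. set (Y := tangent_dir v c) in *. set (X := tangent_dir v x) in *.
  pose proof (kfac_pos B) as KB. pose proof (kfac_pos Y) as KY. pose proof (kfac_pos X) as KX.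
  destruct (planar_opposite B Y X) as (k & Hk0 & E1 & E2).
  - apply Rnot_le_lt. intros Hge.
    assert (0 <= (kv0 * kb * kc * (kfac B * kfac Y)) * (kv0 * kb * kx * (kfac B * kfac X)) * (ccross B Y * ccross B X)).
    { apply Rmult_le_pos; [|exact Hge]. apply Rlt_le.
      apply Rmult_lt_0_compat; repeat (apply Rmult_lt_0_compat; [|try apply Rmult_lt_0_compat; assumption]); assumption. }
    nra.
  - exact Hang.
  - assert (HY : in_disk Y) by (apply tangent_in_disk; assumption).
    assert (HX : in_disk X) by (apply tangent_in_disk; assumption).
    assert (H0 : in_disk (RtoC 0)) by (unfold in_disk; rewrite Cmod_0; lra).
    (* With [v] moved to 0, the directions [X] and [Y] are opposite and 0 lies between them; the
       weights balance the two Klein points, and the inverse map carries the relation back. *)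
    destruct (mob_comb (mob_inv (dmap v)) X (RtoC 0) Y (kfac Y / (kfac Y + k * kfac X))
      (k * kfac X / (kfac Y + k * kfac X))) as (s & t & Hs & Ht & Est);
      auto using in_disk_le, mob_inv_disk.
    + apply Rdiv_lt_0_compat; nra.
    + apply Rdiv_lt_0_compat; nra.
    + rewrite kv_0, !kv_kfac, E1, E2. unfold vadd, vscal. cbn [vx vy vh]. f_equal; field; nra.
    + exists s, t. split; [exact Hs|]. split; [exact Ht|].
      assert (Hback : forall w, in_disk w -> mob_act (mob_inv (dmap v)) (tangent_dir v w) = w).
      { intros w Hw. rewrite <- dmap_act by auto using in_disk_le.
        apply mob_inv_act; auto using in_disk_le. }
      unfold X, Y in Est. rewrite !Hback in Est by assumption.
      rewrite <- (tangent_self v), Hback in Est by assumption. exact Est.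
Qed.

(** * Triangles *)

Lemma cramer u v w x : vscal (det3 u v w) x =
  vadd (vscal (det3 x v w) u) (vadd (vscal (det3 u x w) v) (vscal (det3 u v x) w)).
Proof. vec_eq. Qed.

(** The matrix of the products [mdot] of the [n]'s with the [v]'s is a product of three matrices,
    and the middle one, the Lorentz form, has determinant -1. *)
Lemma gram_det n1 n2 n3 v1 v2 v3 :
  - (det3 n1 n2 n3 * det3 v1 v2 v3) =
  mdot n1 v1 * (mdot n2 v2 * mdot n3 v3 - mdot n2 v3 * mdot n3 v2)
  - mdot n1 v2 * (mdot n2 v1 * mdot n3 v3 - mdot n2 v3 * mdot n3 v1)
  + mdot n1 v3 * (mdot n2 v1 * mdot n3 v2 - mdot n2 v2 * mdot n3 v1).
Proof. vec_ring. Qed.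

(* A hyperbolic triangle with vertices [Z] (possibly ideal), [V], [V'] and inward unit normals [n1],
   [n2] of the sides through [Z]: the outer bisector [n1 + n2] at [Z] has its [Z]-coordinate negative.
   Its product with the normal [n] of the base is then negative, i.e. the base angles sum to less
   than [PI]. *)
Lemma triangle_bisector Z V V' n1 n2 n : fut Z -> timelike V -> fut V' ->
  mdot n1 n1 = 1 -> mdot n2 n2 = 1 -> mdot n1 Z = 0 -> mdot n2 Z = 0 ->
  mdot n1 V = 0 -> mdot n2 V' = 0 -> 0 < mdot n2 V -> 0 < mdot n1 V' ->
  mdot n V = 0 -> mdot n V' = 0 -> 0 < mdot n Z ->
  exists a b c, a < 0 /\ 0 <= b /\ 0 <= c /\
    vadd n1 n2 = vadd (vscal a Z) (vadd (vscal b V) (vscal c V')).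
Proof.
  intros HZ HV HV' U1 U2 Z1 Z2 V1 V2 P2 P1 NV NV' NZ.
  assert (HD : det3 Z V V' <> 0).
  (* Only one term of the Gram determinant survives the orthogonality relations, and it is positive,
     so the three points are independent. *)
  { intros H. pose proof (gram_det n1 n2 n V' V Z) as G.
    replace (det3 V' V Z) with (- det3 Z V V') in G by vec_ring.
    rewrite H, V1, V2, Z1, Z2, NV, NV' in G.
    assert (0 < mdot n1 V' * (mdot n2 V * mdot n Z)) by
      (apply Rmult_lt_0_compat; [|apply Rmult_lt_0_compat]; assumption).
    lra. }
  set (M := vadd n1 n2).
  set (a := det3 M V V' / det3 Z V V'). set (b := det3 Z M V' / det3 Z V V').
  set (c := det3 Z V M / det3 Z V V').
  assert (EM : M = vadd (vscal a Z) (vadd (vscal b V) (vscal c V'))).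
  { apply (vscal_cancel (det3 Z V V')); [exact HD|]. rewrite cramer, !vscal_add, !vscal_vscal.
    f_equal; [|f_equal]; f_equal; unfold a, b, c; field; exact HD. }
  assert (Hdot : forall w, mdot M w = a * mdot Z w + (b * mdot V w + c * mdot V' w)).
  { intros w. rewrite EM, !mdot_add_l, !mdot_scal_l. reflexivity. }
  assert (HMZ : mdot M Z = 0) by (unfold M; rewrite mdot_add_l, Z1, Z2; ring).
  (* Being orthogonal to [Z], the bisector is not timelike. This gives [1 + mdot n1 n2 >= 0], and
     hence the signs of [b] and [c]. *)
  pose proof (perp_fut_spacelike Z M HZ HMZ) as HMM.
  assert (HMM' : mdot M M = 2 + 2 * mdot n1 n2).
  { unfold M. rewrite mdot_add_l, !mdot_add_r, U1, U2, (mdot_comm n2 n1). ring. }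
  assert (Ec : 1 + mdot n1 n2 = c * mdot n1 V').
  { transitivity (mdot n1 M).
    - unfold M. rewrite mdot_add_r, U1. reflexivity.
    - rewrite mdot_comm, Hdot, (mdot_comm Z), (mdot_comm V), (mdot_comm V'), Z1, V1. ring. }
  assert (Eb : 1 + mdot n1 n2 = b * mdot n2 V).
  { transitivity (mdot n2 M).
    - unfold M. rewrite mdot_add_r, U2, (mdot_comm n2 n1). ring.
    - rewrite mdot_comm, Hdot, (mdot_comm Z), (mdot_comm V), (mdot_comm V'), Z2, V2. ring. }
  assert (Hb : 0 <= b) by (apply Rnot_lt_le; intros H; nra).
  assert (Hc : 0 <= c) by (apply Rnot_lt_le; intros H; nra).
  exists a, b, c. repeat split; try assumption.
  (* If [a >= 0], all terms of [mdot M Z = 0] are nonpositive, which forces [b = 0]; then [mdot M V]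
     is nonpositive, although it equals [mdot n2 V > 0]. *)
  apply Rnot_le_lt. intros Ha.
  pose proof (fut_mdot_npos Z Z HZ HZ) as S1. pose proof (fut_mdot_neg Z V HZ HV) as S2.
  pose proof (fut_mdot_npos V' Z HV' HZ) as S3. pose proof (fut_mdot_neg V' V HV' HV) as S4.
  rewrite Hdot, (mdot_comm V Z) in HMZ.
  assert (a * mdot Z Z <= 0) by nra. assert (b * mdot Z V <= 0) by nra.
  assert (c * mdot V' Z <= 0) by nra.
  assert (Hb0 : b = 0) by nra.
  assert (HMV : mdot M V = mdot n2 V) by (unfold M; rewrite mdot_add_l, V1; ring).
  rewrite Hdot, Hb0 in HMV. nra.
Qed.

(* Exterior angle comparison: the line of [m1] meets the side [B W] (normal [mb]) at a larger
   angle than it meets the line of [m0] at [P], because [m0] crosses [B W] closer to [B]. *)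
Lemma exterior_angle B W Q P R' mb m0 m1 c0 c1 cb s :
  timelike B -> fut W -> timelike P -> s ^ 2 = 1 ->
  0 < c0 -> 0 < c1 -> 0 < cb ->
  (forall x, mdot m0 x = c0 * s * det3 Q P x) ->
  (forall x, mdot m1 x = c1 * s * det3 P R' x) ->
  (forall x, mdot mb x = cb * s * det3 B W x) ->
  mdot mb mb = 1 -> mdot m0 m0 = 1 ->
  0 < mdot mb Q -> 0 < mdot mb P -> 0 < mdot mb R' ->
  0 < mdot m0 R' -> 0 < mdot m0 B -> mdot m0 W < 0 ->
  0 < mdot m1 Q -> 0 < mdot m1 B -> mdot m1 W < 0 ->
  mdot m1 mb < mdot m1 m0.
Proof.
  intros HB HW HP Hs Hc0 Hc1 Hcb F0 F1 Fb Ub U0 bQ bP bR R0 B0 W0 Q1 B1 W1.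
  (* [Z] and [X] are the points of the side [B W] on the lines of [m0] and [m1]. [EZ] and [EX]
     rewrite them along [Q P] and [P R'], from which their positions relative to the other line are
     read off. *)
  set (Z := vadd (vscal (- mdot m0 W) B) (vscal (mdot m0 B) W)).
  set (X := vadd (vscal (- mdot m1 W) B) (vscal (mdot m1 B) W)).
  assert (HZ : fut Z) by (apply fut_comb; try lra; [apply timelike_fut|]; assumption).
  assert (HX : fut X) by (apply fut_comb; try lra; [apply timelike_fut|]; assumption).
  assert (EZ : Z = vadd (vscal (c0 / cb * mdot mb P) Q) (vscal (- (c0 / cb * mdot mb Q)) P)).
  { unfold Z. rewrite !F0, !Fb. apply (vscal_cancel cb); [lra|].
    rewrite !vscal_add, !vscal_vscal.
    replace (cb * (c0 / cb * (cb * s * det3 B W P))) with (cb * c0 * s * det3 B W P) by (field; lra).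
    replace (cb * - (c0 / cb * (cb * s * det3 B W Q))) with (- (cb * c0 * s * det3 B W Q)) by (field; lra).
    clear. vec_eq. }
  assert (EX : X = vadd (vscal (c1 / cb * mdot mb R') P) (vscal (- (c1 / cb * mdot mb P)) R')).
  { unfold X. rewrite !F1, !Fb. apply (vscal_cancel cb); [lra|].
    rewrite !vscal_add, !vscal_vscal.
    replace (cb * (c1 / cb * (cb * s * det3 B W R'))) with (cb * c1 * s * det3 B W R') by (field; lra).
    replace (cb * - (c1 / cb * (cb * s * det3 B W P))) with (- (cb * c1 * s * det3 B W P)) by (field; lra).
    clear. vec_eq. }
  assert (m0Q : mdot m0 Q = 0) by (rewrite F0, det3_12; ring).
  assert (m0P : mdot m0 P = 0) by (rewrite F0, det3_22; ring).
  assert (m1P : mdot m1 P = 0) by (rewrite F1, det3_12; ring).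
  assert (m1R : mdot m1 R' = 0) by (rewrite F1, det3_22; ring).
  assert (mbB : mdot mb B = 0) by (rewrite Fb, det3_12; ring).
  assert (mbW : mdot mb W = 0) by (rewrite Fb, det3_22; ring).
  assert (K0 : 0 < c0 / cb) by (apply Rdiv_lt_0_compat; assumption).
  assert (K1 : 0 < c1 / cb) by (apply Rdiv_lt_0_compat; assumption).
  assert (m1Z : 0 < mdot m1 Z).
  { rewrite EZ, mdot_add_r, !mdot_scal_r, m1P, Rmult_0_r, Rplus_0_r.
    apply Rmult_lt_0_compat; [apply Rmult_lt_0_compat|]; assumption. }
  (* The triangle [Z P X] lies on the negative side of [m0], whence the factor -1. *)
  destruct (triangle_bisector Z P X (vscal (-1) m0) mb m1) as (a & b & c & Ha & Hb & Hc & E);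
    try assumption.
  - rewrite mdot_scal_l, mdot_scal_r, U0. ring.
  - rewrite mdot_scal_l, EZ, mdot_add_r, !mdot_scal_r, m0Q, m0P. ring.
  - unfold Z. rewrite mdot_add_r, !mdot_scal_r, mbB, mbW. ring.
  - rewrite mdot_scal_l, m0P. ring.
  - unfold X. rewrite mdot_add_r, !mdot_scal_r, mbB, mbW. ring.
  - rewrite mdot_scal_l, EX, mdot_add_r, !mdot_scal_r, m0P, Rmult_0_r, Rplus_0_l.
    assert (0 < c1 / cb * mdot mb P * mdot m0 R') by
      (apply Rmult_lt_0_compat; [apply Rmult_lt_0_compat|]; assumption). lra.
  - rewrite EX, mdot_add_r, !mdot_scal_r, m1P, m1R. ring.
  - assert (Hm : mdot m1 (vadd (vscal (-1) m0) mb) < 0).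
    { rewrite E, !mdot_add_r, !mdot_scal_r, m1P.
      replace (mdot m1 X) with 0 by (rewrite EX, mdot_add_r, !mdot_scal_r, m1P, m1R; ring).
      nra. }
    rewrite mdot_add_r, mdot_scal_r in Hm. lra.
Qed.

(** [P] has positive barycentric coordinates in the triangle, so a functional that vanishes at [P]
    and is positive at two corners is negative at the third. *)
Lemma barycentric_sign n A B W P : det3 A B W > 0 -> det3 P B W > 0 -> det3 A P W > 0 -> det3 A B P > 0 ->
  mdot n P = 0 -> 0 < mdot n A -> 0 < mdot n B -> mdot n W < 0.
Proof.
  intros D DA DB DW HP HA HB.
  assert (E : det3 A B W * mdot n P = det3 P B W * mdot n A + (det3 A P W * mdot n B + det3 A B P * mdot n W)).
  { rewrite <- mdot_scal_r, cramer, !mdot_add_r, !mdot_scal_r. reflexivity. }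
  rewrite HP in E.
  assert (0 < det3 P B W * mdot n A) by (apply Rmult_lt_0_compat; lra).
  assert (0 < det3 A P W * mdot n B) by (apply Rmult_lt_0_compat; lra).
  apply Rnot_le_lt. intros Hw. assert (0 <= det3 A B P * mdot n W) by (apply Rmult_le_pos; lra). lra.
Qed.

Lemma mcross_spacelike x y z : timelike x \/ timelike y -> det3 x y z > 0 ->
  0 < mdot (mcross x y) (mcross x y).
Proof.
  intros [H|H] Hd.
  - apply (perp_timelike_spacelike x _ z); [exact H | apply det3_12 | unfold det3 in Hd; lra].
  - apply (perp_timelike_spacelike y _ z); [exact H | apply det3_22 | unfold det3 in Hd; lra].
Qed.

(* Two opposite sides [A B] and [P1 P2] of a convex polygon with equal adjacent angles: the sides next
   to [A B] cannot meet on the side of the polygon, at [W].  The angles at [A] and [B] would sum to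
   less than [PI], while the line [P1 P2] cuts the triangle [A B W] in another triangle at [W]
   whose base angles exceed the supplements of the angles at [P1] and [P2]. *)
Lemma no_enclosing_triangle A B W P0 P1 P2 P3 :
  timelike A -> timelike B -> fut W -> timelike P1 -> timelike P2 ->
  det3 A B W > 0 ->
  (forall P, In P (P0 :: P1 :: P2 :: P3 :: nil) -> det3 P B W > 0 /\ det3 A P W > 0 /\ det3 A B P > 0) ->
  (forall P, In P (A :: B :: nil) -> det3 P0 P1 P > 0 /\ det3 P1 P2 P > 0 /\ det3 P2 P3 P > 0) ->
  det3 P0 P1 P2 > 0 -> det3 P1 P2 P3 > 0 ->
  mdot (vunit (mcross W A)) (vunit (mcross A B)) = mdot (vunit (mcross P0 P1)) (vunit (mcross P1 P2)) ->
  mdot (vunit (mcross A B)) (vunit (mcross B W)) = mdot (vunit (mcross P1 P2)) (vunit (mcross P2 P3)) ->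
  False.
Proof.
  intros HA HB HW HP1 HP2 D HP HAB D012 D123 E1 E2.
  pose proof mcross_spacelike as Hsp.
  assert (Scyc : forall x y z, det3 x y z = det3 y z x) by apply det3_cycle.
  destruct (HP P0) as (P0a & P0b & P0c); [simpl; tauto|].
  destruct (HP P1) as (P1a & P1b & P1c); [simpl; tauto|].
  destruct (HP P2) as (P2a & P2b & P2c); [simpl; tauto|].
  destruct (HP P3) as (P3a & P3b & P3c); [simpl; tauto|].
  destruct (HAB A) as (A0 & A1 & A2); [simpl; tauto|].
  destruct (HAB B) as (B0 & B1 & B2); [simpl; tauto|].
  assert (DBW : det3 B W A > 0) by (rewrite <- Scyc; exact D).
  assert (DWA : det3 W A B > 0) by (rewrite Scyc; exact D).
  assert (SWA : 0 < mdot (mcross W A) (mcross W A)) by (apply (Hsp W A B); auto).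
  assert (SAB : 0 < mdot (mcross A B) (mcross A B)) by (apply (Hsp A B W); auto).
  assert (SBW : 0 < mdot (mcross B W) (mcross B W)) by (apply (Hsp B W A); auto).
  assert (S01 : 0 < mdot (mcross P0 P1) (mcross P0 P1)) by (apply (Hsp P0 P1 P2); auto).
  assert (S12 : 0 < mdot (mcross P1 P2) (mcross P1 P2)) by (apply (Hsp P1 P2 P3); auto).
  assert (S23 : 0 < mdot (mcross P2 P3) (mcross P2 P3)) by (apply (Hsp P2 P3 A); auto).
  assert (Hu : forall x y, 0 < mdot (mcross x y) (mcross x y) -> exists c, 0 < c /\
    forall z, mdot (vunit (mcross x y)) z = c * det3 x y z).
  { intros x y H. destruct (vunit_dot _ x H) as (c & Hc & Ec & _). exists c. split; [exact Hc|].
    intros z. rewrite Ec. apply mdot_scal_l. }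
  destruct (Hu _ _ SWA) as (cc & Hcc & Fc). destruct (Hu _ _ SAB) as (cs & Hcs & Fs).
  destruct (Hu _ _ SBW) as (cb & Hcb & Fb). destruct (Hu _ _ S01) as (c0 & Hc0 & F0).
  destruct (Hu _ _ S12) as (c1 & Hc1 & F1). destruct (Hu _ _ S23) as (c2 & Hc2 & F2). clear Hu.
  pose proof (vunit_unit _ SWA) as Uc. pose proof (vunit_unit _ SBW) as Ub.
  pose proof (vunit_unit _ S01) as U0. pose proof (vunit_unit _ S23) as U2.
  set (mc := vunit (mcross W A)) in *. set (ms := vunit (mcross A B)) in *.
  set (mb := vunit (mcross B W)) in *. set (m0 := vunit (mcross P0 P1)) in *.
  set (m1 := vunit (mcross P1 P2)) in *. set (m2 := vunit (mcross P2 P3)) in *.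
  assert (W0 : mdot m0 W < 0).
  { apply (barycentric_sign m0 A B W P1); try assumption; rewrite F0, ?det3_22; try nra. }
  assert (W1 : mdot m1 W < 0).
  { apply (barycentric_sign m1 A B W P1); try assumption; rewrite F1, ?det3_12; try nra. }
  assert (W2 : mdot m2 W < 0).
  { apply (barycentric_sign m2 A B W P2); try assumption; rewrite F2, ?det3_12; try nra. }
  destruct (triangle_bisector W A B mc mb ms) as (a & b & c & Ha & Hb & Hc & EM);
    try assumption; try (apply timelike_fut; assumption);
    rewrite ?Fc, ?Fb, ?Fs, ?det3_12, ?det3_22; try nra.
  assert (L1 : mdot ms (vadd mc mb) < 0).
  { rewrite EM, !mdot_add_r, !mdot_scal_r, !Fs, det3_12, det3_22.
    assert (0 < cs * det3 A B W) by (apply Rmult_lt_0_compat; lra). nra. }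
  assert (L2 : 0 < mdot m1 (vadd mc mb)).
  { rewrite EM, !mdot_add_r, !mdot_scal_r.
    assert (0 < mdot m1 A) by (rewrite F1; apply Rmult_lt_0_compat; lra).
    assert (0 < mdot m1 B) by (rewrite F1; apply Rmult_lt_0_compat; lra).
    assert (0 < a * mdot m1 W) by nra.
    assert (0 <= b * mdot m1 A) by (apply Rmult_le_pos; lra).
    assert (0 <= c * mdot m1 B) by (apply Rmult_le_pos; lra). lra. }
  assert (L3 : mdot m1 mb < mdot m1 m0).
  { apply (exterior_angle B W P0 P1 P2 mb m0 m1 c0 c1 cb 1); try assumption; try ring;
      try (intros x; rewrite ?F0, ?F1, ?Fb; ring);
      rewrite ?F0, ?F1, ?Fb; try (apply Rmult_lt_0_compat; [assumption|]);
      try (rewrite <- Scyc; lra); try lra. }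
  (* The mirror image of [L3]: exchanging the ends reverses every orientation, hence the sign -1. *)
  assert (L4 : mdot m1 mc < mdot m1 m2).
  { apply (exterior_angle A W P3 P2 P1 mc m2 m1 c2 c1 cc (-1)); try assumption; try ring;
      try (intros x; rewrite ?F2, ?F1, ?Fc; vec_ring);
      rewrite ?F2, ?F1, ?Fc; try (apply Rmult_lt_0_compat; [assumption|]);
      try lra.
    all: try (rewrite Scyc; lra).
    all: try (rewrite <- Scyc; lra). }
  (* By [E1] and [E2], [L1] says that [mdot m1 m0 + mdot m1 m2] is negative, while [L2], [L3] and
     [L4] make it positive. *)
  rewrite !mdot_add_r in L1, L2. rewrite (mdot_comm ms mc), E1, E2 in L1.
  rewrite (mdot_comm m0 m1) in L1. lra.
Qed.

(** * Canonical polygons *)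

Set Implicit Arguments.

(** The polygon with [2 * h] sides and labels in all of Z. The step [k -> sg k + 1] runs through a
    vertex cycle; by [zp_opp], two such steps lead to the opposite vertex. [zp_rel] is asserted on
    the circle, where the boundary map lives. *)
Record zpolygon (h : Z) (V : Z -> C) (T : Z -> mob) (sg : Z -> Z) : Prop := {
  zp_h : (6 <= h)%Z;
  zp_V : forall k, in_disk (V k);
  zp_V_per : forall k, V (k + 2 * h)%Z = V k;
  zp_T_per : forall k, T (k + 2 * h)%Z = T k;
  zp_conv : forall k i, (2 <= i < 2 * h)%Z ->
    det3 (kv (V k)) (kv (V (k + 1)%Z)) (kv (V (k + i)%Z)) > 0;
  zp_T : forall k, is_disk_mob (T k);
  zp_T0 : forall k, mob_act (T k) (V k) = V (sg k + 1)%Z;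
  zp_T1 : forall k, mob_act (T k) (V (k + 1)%Z) = V (sg k);
  zp_angle : forall k, hangle (V k) (V (k - 1)%Z) (V (k + 1)%Z) +
    hangle (V (sg k + 1)%Z) (V (sg k)) (V (sg k + 2)%Z) = PI;
  zp_sg_sg : forall k, sg (sg k) = k;
  zp_sg_per : forall k, sg (k + 2 * h)%Z = (sg k - 2 * h)%Z;
  zp_opp : forall k, exists m, (sg (sg k + 1) + 1 = k + h + m * (2 * h))%Z;
  zp_rel : forall k x, on_circle x ->
    mob_act (T (sg (k + 1) + 1)%Z) (mob_act (T (k + 1)%Z) x) =
    mob_act (T (sg k - 1)%Z) (mob_act (T k) x)
}.

Unset Implicit Arguments.

Lemma lor_vunit m u : is_disk_mob m -> lor m (vunit u) = vunit (lor m u).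
Proof. intros Hm. unfold vunit. rewrite lor_scal, lor_mdot by exact Hm. reflexivity. Qed.

Section Polygon.
Context (h : Z) (V : Z -> C) (T : Z -> mob) (sg : Z -> Z) (Z0 : zpolygon h V T sg).

Let HV := zp_V Z0.
Let HT := zp_T Z0.
Definition vert (k : Z) : vec := kv (V k).

Lemma zp_V_perm k m : V (k + m * (2 * h))%Z = V k.
Proof.
  assert (Hn : forall n k, V (k + Z.of_nat n * (2 * h))%Z = V k).
  { induction n as [|n IH]; intros j; [f_equal; lia|].
    replace (j + Z.of_nat (S n) * (2 * h))%Z with (j + Z.of_nat n * (2 * h) + 2 * h)%Z by lia.
    rewrite (zp_V_per Z0). apply IH. }
  destruct (Z_le_gt_dec 0 m) as [Hm|Hm].
  - rewrite <- (Z2Nat.id m Hm). apply Hn.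
  - rewrite <- (Hn (Z.to_nat (- m)) (k + m * (2 * h))%Z), Z2Nat.id by lia. f_equal. lia.
Qed.

Lemma zp_left k j : (k + 2 <= j < k + 2 * h)%Z -> det3 (vert k) (vert (k + 1)%Z) (vert j) > 0.
Proof.
  intros Hj. replace j with (k + (j - k))%Z by lia. apply (zp_conv Z0). lia.
Qed.

Lemma zp_left_prev k : det3 (vert k) (vert (k + 1)%Z) (vert (k - 1)%Z) > 0.
Proof.
  pose proof (zp_h Z0). unfold vert. rewrite <- (zp_V_per Z0 (k - 1)).
  apply zp_left. lia.
Qed.

Lemma zp_left_next k : det3 (vert k) (vert (k + 1)%Z) (vert (k + 2)%Z) > 0.
Proof. pose proof (zp_h Z0). apply zp_left. lia. Qed.

Lemma det3_scal a b c x y z : det3 (vscal a x) (vscal b y) (vscal c z) = a * b * c * det3 x y z.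
Proof. vec_ring. Qed.

Lemma det3_swap x y z : det3 y x z = - det3 x y z.
Proof. vec_ring. Qed.

Lemma mob_det3 m x y z : is_disk_mob m -> in_disk x -> in_disk y -> in_disk z ->
  exists c, 0 < c /\ det3 (kv x) (kv y) (kv z) = c * det3 (kv (mob_act m x)) (kv (mob_act m y)) (kv (mob_act m z)).
Proof.
  intros Hm Hx Hy Hz.
  destruct (mob_kv_scal m x Hm (in_disk_le _ Hx)) as (a & Ha & Ea).
  destruct (mob_kv_scal m y Hm (in_disk_le _ Hy)) as (b & Hb & Eb).
  destruct (mob_kv_scal m z Hm (in_disk_le _ Hz)) as (c & Hc & Ec).
  exists (a * b * c). split; [repeat apply Rmult_lt_0_compat; assumption|].
  rewrite <- (lor_det3 m) by exact Hm. rewrite Ea, Eb, Ec. apply det3_scal.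
Qed.

(** Here the angle condition does its work: at [V (sg k + 1)] the angle of the polygon and that of
    its image under [T k] add up to a straight angle, so the image of side [k - 1] and side
    [sg k + 1] lie on one line. *)
Lemma zp_collinear_start k : exists s t, 0 < s /\ 0 < t /\
  vert (sg k + 1)%Z = vadd (vscal s (kv (mob_act (T k) (V (k - 1)%Z)))) (vscal t (vert (sg k + 2)%Z)).
Proof.
  apply (opposite_rays (V (sg k + 1)%Z) (V (sg k))); auto using mob_in_disk.
  - rewrite <- (zp_angle Z0 k), Rplus_comm. f_equal.
    rewrite <- (zp_T0 Z0), <- (zp_T1 Z0), hangle_mob by auto. apply hangle_sym.
  - pose proof (zp_left_next (sg k)) as H1. rewrite det3_swap. fold (vert (sg k)) (vert (sg k + 1)%Z) (vert (sg k + 2)%Z).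
    destruct (mob_det3 (T k) (V k) (V (k + 1)%Z) (V (k - 1)%Z) (HT k) (HV _) (HV _) (HV _)) as (c & Hc & E).
    rewrite (zp_T0 Z0), (zp_T1 Z0) in E.
    pose proof (zp_left_prev k) as H2. unfold vert at 1 2 3 in H2. rewrite E in H2.
    fold (vert (sg k)) (vert (sg k + 1)%Z) in *.
    set (d := det3 (vert (sg k + 1)%Z) (vert (sg k)) (kv (mob_act (T k) (V (k - 1)%Z)))) in *.
    assert (0 < d) by (apply Rmult_lt_reg_l with c; lra). nra.
Qed.

Lemma zp_collinear_end k : exists s t, 0 < s /\ 0 < t /\
  vert (sg k) = vadd (vscal s (kv (mob_act (T k) (V (k + 2)%Z)))) (vscal t (vert (sg k - 1)%Z)).
Proof.
  apply (opposite_rays (V (sg k)) (V (sg k + 1)%Z)); auto using mob_in_disk.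
  (* At the other end of the side, the condition of label [sg k] applies: it pairs the corner [sg k]
     with the corner [k + 1]. *)
  - pose proof (zp_angle Z0 (sg k)) as H. rewrite (zp_sg_sg Z0) in H.
    rewrite <- H. f_equal; [apply hangle_sym|].
    rewrite <- (zp_T0 Z0), <- (zp_T1 Z0), hangle_mob by auto. reflexivity.
  - pose proof (zp_left_prev (sg k)) as H1.
    destruct (mob_det3 (T k) (V (k + 1)%Z) (V k) (V (k + 2)%Z) (HT k) (HV _) (HV _) (HV _)) as (c & Hc & E).
    rewrite (zp_T0 Z0), (zp_T1 Z0) in E.
    pose proof (zp_left_next k) as H2. rewrite det3_swap in E. unfold vert at 1 2 3 in H2.
    fold (vert (sg k)) (vert (sg k + 1)%Z) (vert (sg k - 1)%Z) in *.
    set (d := det3 (vert (sg k)) (vert (sg k + 1)%Z) (kv (mob_act (T k) (V (k + 2)%Z)))) in *.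
    assert (0 < - d) by (apply Rmult_lt_reg_l with c; lra). nra.
Qed.

(** * Ideal endpoints of the sides *)

Definition Pz (k : Z) : C := geod_start (V k) (V (k + 1)%Z).
(** The terminal point of side [k - 1] as the start of the reversed side, so that [is_start] serves
    both kinds of endpoints. *)
Definition Qz (k : Z) : C := geod_start (V k) (V (k - 1)%Z).

Lemma zp_klein_ne k : klein (V k) <> klein (V (k + 1)%Z).
Proof.
  intros H. pose proof (zp_left_next k) as Hd.
  assert (E : vert k = vert (k + 1)%Z) by (unfold vert, kv; rewrite H; reflexivity).
  rewrite E in Hd. replace (det3 _ _ _) with 0 in Hd; [lra|]. vec_ring.
Qed.

Lemma zp_klein_ne' k : klein (V k) <> klein (V (k - 1)%Z).
Proof.
  intros H. apply (zp_klein_ne (k - 1)). replace (k - 1 + 1)%Z with k by lia. symmetry. exact H.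
Qed.

Lemma Pz_start k : is_start (Pz k) (V k) (V (k + 1)%Z).
Proof. apply geod_start_spec; [apply HV | apply zp_klein_ne]. Qed.

Lemma Qz_start k : is_start (Qz k) (V k) (V (k - 1)%Z).
Proof. apply geod_start_spec; [apply HV | apply zp_klein_ne']. Qed.

Lemma T_Pz k : mob_act (T k) (Pz k) = Qz (sg k + 1).
Proof.
  pose proof (is_start_mob (T k) _ _ _ (HT k) (HV _) (HV _) (Pz_start k)) as H.
  rewrite (zp_T0 Z0), (zp_T1 Z0) in H.
  apply (is_start_unique _ _ _ _ (HV _) H).
  pose proof (Qz_start (sg k + 1)) as H'. replace (sg k + 1 - 1)%Z with (sg k) in H' by lia. exact H'.
Qed.

Lemma T_Qz_next k : mob_act (T k) (Qz (k + 1)) = Pz (sg k).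
Proof.
  pose proof (Qz_start (k + 1)) as H0. replace (k + 1 - 1)%Z with k in H0 by lia.
  pose proof (is_start_mob (T k) _ _ _ (HT k) (HV _) (HV _) H0) as H.
  rewrite (zp_T0 Z0), (zp_T1 Z0) in H.
  apply (is_start_unique _ _ _ _ (HV _) H), Pz_start.
Qed.

Lemma vadd_comm u v : vadd u v = vadd v u.
Proof. vec_eq. Qed.

Lemma T_Qz k : mob_act (T k) (Qz k) = Qz (sg k + 2).
Proof.
  pose proof (is_start_mob (T k) _ _ _ (HT k) (HV _) (HV _) (Qz_start k)) as H.
  rewrite (zp_T0 Z0) in H.
  apply (is_start_unique _ _ _ _ (HV _) H).
  destruct (zp_collinear_start k) as (s & t & Hs & Ht & E). rewrite vadd_comm in E.
  apply (is_start_extend _ _ _ _ t s Ht Hs E).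
  pose proof (Qz_start (sg k + 2)) as H'. replace (sg k + 2 - 1)%Z with (sg k + 1)%Z in H' by lia. exact H'.
Qed.

Lemma T_Pz_next k : mob_act (T k) (Pz (k + 1)) = Pz (sg k - 1).
Proof.
  pose proof (Pz_start (k + 1)) as H0. replace (k + 1 + 1)%Z with (k + 2)%Z in H0 by lia.
  pose proof (is_start_mob (T k) _ _ _ (HT k) (HV _) (HV _) H0) as H.
  rewrite (zp_T1 Z0) in H.
  apply (is_start_unique _ _ _ _ (HV _) H).
  destruct (zp_collinear_end k) as (s & t & Hs & Ht & E). rewrite vadd_comm in E.
  apply (is_start_extend _ _ _ _ t s Ht Hs E).
  pose proof (Pz_start (sg k - 1)) as H'. replace (sg k - 1 + 1)%Z with (sg k) in H' by lia. exact H'.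
Qed.

(** * Normals of the sides *)

Definition nv (k : Z) : vec := mcross (vert k) (vert (k + 1)%Z).
Definition uv (k : Z) : vec := vunit (nv k).

Lemma nv_pos k : 0 < mdot (nv k) (nv k).
Proof.
  apply (mcross_spacelike _ _ (vert (k + 2)%Z)); [left; apply kv_timelike, HV | apply zp_left_next].
Qed.

Lemma lor_uv_of_nv m j k c : is_disk_mob m -> 0 < c -> lor m (nv j) = vscal c (nv k) ->
  lor m (uv j) = uv k.
Proof.
  intros Hm Hc E. unfold uv. rewrite lor_vunit, E by exact Hm. apply vunit_scal; [exact Hc | apply nv_pos].
Qed.

(** The sign appears because [T k] reverses the side: the image of the polygon lies across side
    [sg k]. *)
Lemma lor_uv k : lor (T k) (uv k) = vscal (-1) (uv (sg k)).
Proof.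
  destruct (mob_kv_scal (T k) (V k) (HT k) (in_disk_le _ (HV _))) as (a & Ha & Ea).
  destruct (mob_kv_scal (T k) (V (k + 1)%Z) (HT k) (in_disk_le _ (HV _))) as (b & Hb & Eb).
  rewrite (zp_T0 Z0) in Ea. rewrite (zp_T1 Z0) in Eb.
  unfold uv. rewrite lor_vunit, <- vunit_opp by apply HT.
  unfold nv at 1, vert at 1 2. rewrite lor_mcross, Ea, Eb, mcross_scal by apply HT.
  rewrite mcross_anti. fold (vert (sg k)) (vert (sg k + 1)%Z) (nv (sg k)).
  apply vunit_scal; [apply Rmult_lt_0_compat; assumption|].
  rewrite mdot_scal_l, mdot_scal_r. pose proof (nv_pos (sg k)). lra.
Qed.

Lemma lor_uv_prev k : lor (T k) (uv (k - 1)) = uv (sg k + 1).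
Proof.
  destruct (mob_kv_scal (T k) (V k) (HT k) (in_disk_le _ (HV _))) as (a & Ha & Ea).
  destruct (mob_kv_scal (T k) (V (k - 1)%Z) (HT k) (in_disk_le _ (HV _))) as (b & Hb & Eb).
  rewrite (zp_T0 Z0) in Ea.
  destruct (zp_collinear_start k) as (s & t & Hs & Ht & E).
  apply (lor_uv_of_nv _ _ _ (b * a * (t / s))); [apply HT| |].
  { apply Rmult_lt_0_compat; [apply Rmult_lt_0_compat | apply Rdiv_lt_0_compat]; assumption. }
  unfold nv, vert at 1 2. replace (k - 1 + 1)%Z with k by lia.
  rewrite lor_mcross, Ea, Eb, mcross_scal by apply HT.
  fold (vert (sg k + 1)%Z). replace (sg k + 1 + 1)%Z with (sg k + 2)%Z by lia.
  rewrite E, <- (vscal_vscal (b * a) (t / s)). f_equal.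
  set (x := kv (mob_act (T k) (V (k - 1)%Z))). set (c := vert (sg k + 2)%Z).
  apply (vscal_cancel s); [lra|]. rewrite vscal_vscal. replace (s * (t / s)) with t by (field; lra).
  clearbody x c. clear. vec_eq.
Qed.

Lemma lor_uv_next k : lor (T k) (uv (k + 1)) = uv (sg k - 1).
Proof.
  destruct (mob_kv_scal (T k) (V (k + 1)%Z) (HT k) (in_disk_le _ (HV _))) as (a & Ha & Ea).
  destruct (mob_kv_scal (T k) (V (k + 2)%Z) (HT k) (in_disk_le _ (HV _))) as (b & Hb & Eb).
  rewrite (zp_T1 Z0) in Ea.
  destruct (zp_collinear_end k) as (s & t & Hs & Ht & E).
  apply (lor_uv_of_nv _ _ _ (a * b * (t / s))); [apply HT| |].
  { apply Rmult_lt_0_compat; [apply Rmult_lt_0_compat | apply Rdiv_lt_0_compat]; assumption. }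
  unfold nv, vert at 1 2. replace (k + 1 + 1)%Z with (k + 2)%Z by lia.
  rewrite lor_mcross, Ea, Eb, mcross_scal by apply HT.
  fold (vert (sg k)). replace (sg k - 1 + 1)%Z with (sg k) by lia.
  rewrite E, <- (vscal_vscal (a * b) (t / s)). f_equal.
  set (x := kv (mob_act (T k) (V (k + 2)%Z))). set (c := vert (sg k - 1)%Z).
  apply (vscal_cancel s); [lra|]. rewrite vscal_vscal. replace (s * (t / s)) with t by (field; lra).
  clearbody x c. clear. vec_eq.
Qed.

(** Minus the cosine of the interior angle at vertex [k], as the normals point inward. *)
Definition corner (k : Z) : R := mdot (uv (k - 1)) (uv k).

Lemma corner_pair k : corner k = - corner (sg k + 1).
Proof.
  unfold corner. rewrite <- (lor_mdot (T k)) by apply HT. rewrite lor_uv, lor_uv_prev, mdot_scal_r.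
  replace (sg k + 1 - 1)%Z with (sg k) by lia. rewrite mdot_comm. ring.
Qed.

(** Taking supplements twice along the vertex cycle leads to the opposite vertex with the original
    angle. *)
Lemma corner_opposite k : corner (k + h) = corner k.
Proof.
  rewrite (corner_pair k), (corner_pair (sg k + 1)), Ropp_involutive.
  destruct (zp_opp Z0 k) as [m ->].
  unfold corner, uv, nv, vert.
  replace (k + h + m * (2 * h) - 1)%Z with (k + h - 1 + m * (2 * h))%Z by lia.
  replace (k + h - 1 + m * (2 * h) + 1)%Z with (k + h + m * (2 * h))%Z by lia.
  replace (k + h + m * (2 * h) + 1)%Z with (k + h + 1 + m * (2 * h))%Z by lia.
  rewrite !zp_V_perm. replace (k + h - 1 + 1)%Z with (k + h)%Z by lia. reflexivity.
Qed.

Lemma uv_nv_sign k x : exists c, 0 < c /\ mdot (uv k) x = c * mdot (nv k) x.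
Proof. destruct (vunit_dot (nv k) x (nv_pos k)) as (c & Hc & _ & E). exists c. split; assumption. Qed.

(* The lines of sides [k - 1] and [k + 1] do not meet beyond side [k], even at infinity. *)
Lemma sides_do_not_meet k W : fut W -> mdot (nv (k - 1)) W = 0 -> mdot (nv (k + 1)) W = 0 ->
  mdot (nv k) W < 0 -> False.
Proof.
  intros HW H1 H2 H3. pose proof (zp_h Z0) as Hh.
  (* [T k] takes the lines of sides [k - 1] and [k + 1] to those of sides [s + 1] and [s - 1], and
     moves a point beyond side [k] to the polygon's side of side [s]. *)
  set (s := sg k). set (W' := lor (T k) W).
  assert (HW' : fut W') by (apply lor_fut; [apply HT | exact HW]).
  assert (F1 : mdot (nv (s + 1)) W' = 0).
  { destruct (uv_nv_sign (s + 1) W') as (c & Hc & E). destruct (uv_nv_sign (k - 1) W) as (c' & Hc' & E').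
    unfold W', s in *. rewrite <- lor_uv_prev, lor_mdot, E', H1 in E by apply HT.
    apply Rmult_eq_reg_l with c; lra. }
  assert (F2 : mdot (nv (s - 1)) W' = 0).
  { destruct (uv_nv_sign (s - 1) W') as (c & Hc & E). destruct (uv_nv_sign (k + 1) W) as (c' & Hc' & E').
    unfold W', s in *. rewrite <- lor_uv_next, lor_mdot, E', H2 in E by apply HT.
    apply Rmult_eq_reg_l with c; lra. }
  assert (F3 : 0 < mdot (nv s) W').
  { destruct (uv_nv_sign s W') as (c & Hc & E). destruct (uv_nv_sign k W) as (c' & Hc' & E').
    assert (mdot (uv s) W' = - (c' * mdot (nv k) W)).
    { rewrite <- E', <- (lor_mdot (T k) (uv k) W) by apply HT. rewrite lor_uv, mdot_scal_l. unfold W', s. ring. }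
    apply Rmult_lt_reg_l with c; [exact Hc|]. rewrite <- E, H. nra. }
  clearbody s W'. clear H1 H2 H3 HW W k.
  set (A := vert s). set (B := vert (s + 1)%Z). set (D := vert (s + 2)%Z). set (D' := vert (s - 1)%Z).
  assert (G1 : det3 B D W' = 0).
  { unfold nv in F1. replace (s + 1 + 1)%Z with (s + 2)%Z in F1 by lia. exact F1. }
  assert (G2 : det3 D' A W' = 0).
  { unfold nv in F2. replace (s - 1 + 1)%Z with s in F2 by lia. exact F2. }
  assert (G3 : det3 A B W' > 0) by exact F3.
  assert (HD : det3 A B D > 0) by apply zp_left_next.
  assert (HD' : det3 A B D' > 0) by apply zp_left_prev.
  set (y := det3 A B W' / det3 A B D). set (y' := det3 A B W' / det3 A B D').
  assert (Hy : 0 < y) by (apply Rdiv_lt_0_compat; assumption).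
  assert (Hy' : 0 < y') by (apply Rdiv_lt_0_compat; assumption).
  (* [W'] is on the line of side [s + 1], so [B W'] has the same normal as that side up to a
     positive factor, and convexity speaks about the triangle. *)
  assert (EB : mcross B W' = vscal y (nv (s + 1))).
  { unfold nv. replace (s + 1 + 1)%Z with (s + 2)%Z by lia. fold B D.
    apply (vscal_cancel (det3 A B D)); [lra|]. rewrite vscal_vscal.
    replace (det3 A B D * y) with (det3 A B W') by (unfold y; field; lra).
    replace (vscal (det3 A B D) (mcross B W')) with (mcross B (vscal (det3 A B D) W')) by vec_eq.
    rewrite cramer. replace (det3 W' B D) with 0 by (rewrite det3_cycle; lra).
    clear. vec_eq. }
  assert (EA : mcross W' A = vscal y' (nv (s - 1))).
  { unfold nv. replace (s - 1 + 1)%Z with s by lia. fold A D'.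
    apply (vscal_cancel (det3 A B D')); [lra|]. rewrite vscal_vscal.
    replace (det3 A B D' * y') with (det3 A B W') by (unfold y'; field; lra).
    replace (vscal (det3 A B D') (mcross W' A)) with (mcross (vscal (det3 A B D') W') A) by vec_eq.
    rewrite cramer. replace (det3 A W' D') with 0 by (rewrite <- det3_cycle; lra).
    clear. vec_eq. }
  set (t := (s + h)%Z).
  assert (HP : forall j, (t - 1 <= j <= t + 2)%Z ->
     det3 (vert j) B W' > 0 /\ det3 A (vert j) W' > 0 /\ det3 A B (vert j) > 0).
  { intros j Hj. unfold t in Hj. split; [|split].
    - rewrite det3_cycle. unfold det3. rewrite EB, mdot_scal_l.
      apply Rmult_lt_0_compat; [exact Hy|]. apply zp_left. lia.
    - rewrite <- det3_cycle. unfold det3. rewrite EA, mdot_scal_l.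
      apply Rmult_lt_0_compat; [exact Hy'|]. apply zp_left. lia.
    - apply zp_left. lia. }
  assert (HAB : forall i j, (i = s \/ i = s + 1)%Z -> (t - 1 <= j <= t + 1)%Z ->
     det3 (vert j) (vert (j + 1)%Z) (vert i) > 0).
  { intros i j Hi Hj. unfold vert at 3. rewrite <- (zp_V_per Z0 i). apply zp_left.
    unfold t in Hj. lia. }
  apply (no_enclosing_triangle A B W' (vert (t - 1)%Z) (vert t) (vert (t + 1)%Z) (vert (t + 2)%Z)).
  - apply kv_timelike, HV.
  - apply kv_timelike, HV.
  - exact HW'.
  - apply kv_timelike, HV.
  - apply kv_timelike, HV.
  - exact G3.
  - intros P [<-|[<-|[<-|[<-|[]]]]]; apply HP; lia.
  - assert (Ht : forall i, (i = s \/ i = s + 1)%Z -> det3 (vert (t - 1)%Z) (vert t) (vert i) > 0 /\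
      det3 (vert t) (vert (t + 1)%Z) (vert i) > 0 /\ det3 (vert (t + 1)%Z) (vert (t + 2)%Z) (vert i) > 0).
    { intros i Hi. pose proof (HAB i (t - 1)%Z Hi ltac:(lia)) as K1.
      pose proof (HAB i t Hi ltac:(lia)) as K2. pose proof (HAB i (t + 1)%Z Hi ltac:(lia)) as K3.
      replace (t - 1 + 1)%Z with t in K1 by lia. replace (t + 1 + 1)%Z with (t + 2)%Z in K3 by lia.
      auto. }
    intros P [<-|[<-|[]]]; apply Ht; auto.
  - pose proof (zp_left_next (t - 1)) as K. replace (t - 1 + 1)%Z with t in K by lia.
    replace (t - 1 + 2)%Z with (t + 1)%Z in K by lia. exact K.
  - apply zp_left_next.
  - rewrite EA, vunit_scal by (try apply nv_pos; assumption).
    pose proof (corner_opposite s) as H. unfold corner in H. fold t in H. unfold uv in H.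
    symmetry. unfold nv in H at 1. replace (t - 1 + 1)%Z with t in H by lia. exact H.
  - rewrite EB, vunit_scal by (try apply nv_pos; assumption).
    pose proof (corner_opposite (s + 1)) as H. unfold corner in H.
    replace (s + 1 + h)%Z with (t + 1)%Z in H by (unfold t; lia).
    replace (t + 1 - 1)%Z with t in H by lia. replace (s + 1 - 1)%Z with s in H by lia.
    unfold uv in H. symmetry. unfold nv in H at 2. replace (t + 1 + 1)%Z with (t + 2)%Z in H by lia. exact H.
Qed.

End Polygon.

(** * Angles modulo a full turn *)

Lemma cexp_add x y : cexp_i (x + y) = (cexp_i x * cexp_i y)%C.
Proof.
  unfold cexp_i, Cmult. cbn [fst snd]. rewrite cos_plus, sin_plus. f_equal; ring.
Qed.

Lemma cexp_eq a b : cexp_i a = cexp_i b -> exists m : Z, a = b + 2 * PI * IZR m.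
Proof.
  intros H. pose proof PI_RGT_0.
  destruct (real_mod (a - b) 0 (2 * PI)) as [m Hm]; [lra|].
  exists (- m)%Z. rewrite opp_IZR. set (x := a - b + 2 * PI * IZR m) in *.
  assert (Hx : x = 0); [|unfold x in Hx; lra].
  assert (Hc : cos x = 1).
  { pose proof (cexp_periodic (a - b) m) as E. fold x in E. unfold cexp_i in E, H.
    injection E as E1 E2. injection H as H1 H2. rewrite E1, cos_minus, H1, H2.
    pose proof (sin2_cos2 b). unfold Rsqr in *. lra. }
  destruct (Rle_lt_dec x 0) as [|Hx0]; [lra|]. exfalso.
  assert (cos x < 1); [|lra].
  destruct (Rle_lt_dec x PI).
  - rewrite <- cos_0. apply cos_decreasing_1; lra.
  - replace x with (- (2 * PI - x) + 2 * INR 1 * PI) by (simpl; ring).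
    rewrite cos_period, cos_neg, <- cos_0. apply cos_decreasing_1; lra.
Qed.

Lemma cexp_inj_window a b c : cexp_i a = cexp_i b -> c <= a < c + 2 * PI -> c <= b < c + 2 * PI -> a = b.
Proof.
  intros H Ha Hb. pose proof PI_RGT_0. destruct (cexp_eq a b H) as [m ->].
  destruct (Z.eq_dec m 0) as [->|Hm]; [lra|]. exfalso.
  destruct (Z_lt_le_dec m 0).
  - assert (IZR m <= -1) by (apply IZR_le; lia). nra.
  - assert (1 <= IZR m) by (apply IZR_le; lia). nra.
Qed.

Lemma polar (z : C) (c : R) : z <> RtoC 0 -> exists r t, 0 < r /\ c <= t < c + 2 * PI /\
  z = (r * cos t, r * sin t).
Proof.
  intros Hz. assert (Hr : 0 < Cmod z) by (apply Cmod_gt_0, Hz).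
  destruct (on_circle_angle (fst z / Cmod z, snd z / Cmod z) c) as (t & Et & Ht).
  - apply Cmod_eq_1. cbn [fst snd]. pose proof (Cmod_sq z) as E.
    replace (_ + _) with ((fst z ^ 2 + snd z ^ 2) / Cmod z ^ 2) by (field; lra).
    rewrite <- E. field. lra.
  - exists (Cmod z), t. split; [exact Hr|]. split; [exact Ht|].
    unfold cexp_i in Et. injection Et as E1 E2. rewrite <- E1, <- E2.
    destruct z as [x y]. cbn [fst snd]. f_equal; field; lra.
Qed.

(** * Chords *)

Lemma det3_kv a b t : det3 (kv a) (kv b) (kv t) = ccross (klein b - klein a)%C (klein t - klein a)%C.
Proof.
  unfold kv, det3, mcross, mdot, ccross. destruct (klein a), (klein b), (klein t).
  unfold Cminus, Cplus, Copp, Re, Im. cbn [fst snd vx vy vh]. ring.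
Qed.

Lemma klein_cexp t : klein (cexp_i t) = cexp_i t.
Proof.
  rewrite klein_kv, (kv_circle _ (cexp_on_circle t)). reflexivity.
Qed.

(** Half the angular width of the arc cut off to the right of the line through [klein a] in
    direction [psi]: the argument of [acos] is the signed distance of that line from 0 along the
    right normal. *)
Definition chord_width (a : C) (psi : R) : R := acos (fst (klein a) * sin psi - snd (klein a) * cos psi).

Lemma chord_ends a b r psi : in_disk a -> in_disk b -> 0 < r ->
  (klein b - klein a)%C = (r * cos psi, r * sin psi) ->
  let om := chord_width a psi in
  0 < om < PI /\ geod_start a b = cexp_i (psi - PI / 2 - om) /\
  geod_start b a = cexp_i (psi - PI / 2 + om) /\
  forall t, det3 (kv a) (kv b) (kv (cexp_i t)) = r * (cos om - cos (t - (psi - PI / 2))).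
Proof.
  intros Ha Hb Hr Hd om.
  pose proof (kv_timelike a Ha) as [_ Ta]. pose proof (kv_timelike b Hb) as [_ Tb].
  assert (Hne : klein a <> klein b).
  { intros E. rewrite E in Hd. unfold Cminus in Hd. rewrite Cplus_opp_r in Hd. injection Hd as E1 E2.
    pose proof (sin2_cos2 psi). unfold Rsqr in *.
    assert (cos psi = 0) by (apply Rmult_eq_reg_l with r; lra).
    assert (sin psi = 0) by (apply Rmult_eq_reg_l with r; lra). nra. }
  assert (Ecos : forall x, cos (psi - PI / 2 + x) = sin (psi + x)).
  { intros x. rewrite <- cos_shift. rewrite <- cos_neg. f_equal. ring. }
  assert (Esin : forall x, sin (psi - PI / 2 + x) = - cos (psi + x)).
  { intros x. rewrite <- sin_shift. rewrite <- sin_neg. f_equal. ring. }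
  unfold chord_width in om.
  assert (Ka : kv a = V3 (fst (klein a)) (snd (klein a)) 1) by reflexivity.
  assert (Kb : kv b = V3 (fst (klein b)) (snd (klein b)) 1) by reflexivity.
  rewrite Ka in Ta. rewrite Kb in Tb. cbn [vx vy vh] in Ta, Tb.
  pose proof (det3_kv a b) as Hdet.
  destruct (klein a) as [a1 a2] eqn:Ea. destruct (klein b) as [b1 b2] eqn:Eb.
  cbn [fst snd] in *. unfold Cminus, Cplus, Copp in Hd. cbn [fst snd] in Hd. injection Hd as Hd1 Hd2.
  pose proof (sin2_cos2 psi) as Hsc. unfold Rsqr in Hsc.
  (* [h] and [ta] are the coordinates of [klein a] across and along the chord; inside the disk the
     second one ranges between [- sin om] and [sin om]. *)
  set (h := a1 * sin psi - a2 * cos psi) in *. set (ta := a1 * cos psi + a2 * sin psi).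
  assert (Hn : h ^ 2 + ta ^ 2 = a1 ^ 2 + a2 ^ 2).
  { unfold h, ta. replace (_ + _) with ((a1 ^ 2 + a2 ^ 2) * (sin psi * sin psi + cos psi * cos psi)) by ring.
    rewrite Hsc. ring. }
  assert (Ea1 : a1 = h * sin psi + ta * cos psi).
  { unfold h, ta. replace (_ + _) with (a1 * (sin psi * sin psi + cos psi * cos psi)) by ring. rewrite Hsc. ring. }
  assert (Ea2 : a2 = - h * cos psi + ta * sin psi).
  { unfold h, ta. replace (_ + _) with (a2 * (sin psi * sin psi + cos psi * cos psi)) by ring. rewrite Hsc. ring. }
  assert (Eb1 : b1 = h * sin psi + (ta + r) * cos psi) by lra.
  assert (Eb2 : b2 = - h * cos psi + (ta + r) * sin psi) by lra.
  assert (Hnb : h ^ 2 + (ta + r) ^ 2 = b1 ^ 2 + b2 ^ 2).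
  { transitivity ((h ^ 2 + (ta + r) ^ 2) * (sin psi * sin psi + cos psi * cos psi)).
    - rewrite Hsc. ring.
    - rewrite Eb1, Eb2. ring. }
  assert (Hh : -1 < h < 1) by (split; nra).
  assert (Hcos : cos om = h) by (apply cos_acos; lra).
  assert (Hsin : 0 < sin om).
  { unfold om. rewrite sin_acos by lra. apply sqrt_lt_R0. unfold Rsqr. nra. }
  pose proof (sin2_cos2 om) as Hso. unfold Rsqr in Hso. rewrite Hcos in Hso.
  assert (Hom : 0 < om < PI).
  { pose proof (acos_bound h) as Hb'. fold om in Hb'. split.
    - destruct (proj1 Hb') as [H|H]; [exact H|]. rewrite <- H, sin_0 in Hsin. lra.
    - destruct (proj2 Hb') as [H|H]; [exact H|]. rewrite H, sin_PI in Hsin. lra. }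
  set (S := sin om) in *.
  assert (Hta : - S < ta) by nra. assert (Htb : ta + r < S) by nra.
  split; [exact Hom|]. split; [|split].
  - symmetry. apply is_start_geod; [exact Ha | rewrite Ea, Eb; exact Hne |].
    split; [apply cexp_on_circle|]. exists (r / (ta + r + S)), ((ta + S) / (ta + r + S)).
    split; [apply Rdiv_lt_0_compat; lra|]. split; [apply Rdiv_lt_0_compat; lra|].
    rewrite (kv_circle _ (cexp_on_circle _)), Ka, Kb. unfold cexp_i, vadd, vscal. cbn [fst snd vx vy vh].
    replace (psi - PI / 2 - om) with (psi - PI / 2 + - om) by ring.
    rewrite Ecos, Esin. rewrite sin_plus, cos_plus, cos_neg, sin_neg, Hcos. fold S.
    rewrite Eb1, Eb2. apply vec_ext; cbn [vx vy vh].
    + rewrite Ea1 at 1. field. lra.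
    + rewrite Ea2 at 1. field. lra.
    + field. lra.
  - symmetry. apply is_start_geod; [exact Hb | rewrite Ea, Eb; auto |].
    split; [apply cexp_on_circle|]. exists (r / (S - ta)), ((S - (ta + r)) / (S - ta)).
    split; [apply Rdiv_lt_0_compat; lra|]. split; [apply Rdiv_lt_0_compat; lra|].
    rewrite (kv_circle _ (cexp_on_circle _)), Ka, Kb. unfold cexp_i, vadd, vscal. cbn [fst snd vx vy vh].
    rewrite Ecos, Esin. rewrite sin_plus, cos_plus, Hcos. fold S.
    apply vec_ext; cbn [vx vy vh].
    + rewrite Eb1. replace a1 with (h * sin psi + ta * cos psi). field. lra.
    + rewrite Eb2. replace a2 with (- h * cos psi + ta * sin psi). field. lra.
    + field. lra.
  - intros t. rewrite Hdet, klein_cexp. unfold ccross, cexp_i, Cminus, Cplus, Copp, Re, Im.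
    cbn [fst snd]. rewrite Hcos, cos_minus.
    replace (psi - PI / 2) with (psi - PI / 2 + 0) by ring. rewrite Ecos, Esin, Rplus_0_r, Hd1, Hd2.
    unfold h. ring.
Qed.

Lemma cos_lt_abs x y : - PI < x < PI -> 0 < y < PI -> cos y < cos x -> Rabs x < y.
Proof.
  intros Hx Hy H. apply Rnot_le_lt. intros Hle.
  assert (cos x <= cos y); [|lra].
  destruct (Rle_lt_dec 0 x) as [H0|H0].
  - rewrite Rabs_pos_eq in Hle by exact H0. apply cos_decr_1; lra.
  - rewrite Rabs_left in Hle by exact H0. rewrite <- (cos_neg x). apply cos_decr_1; lra.
Qed.

(** * The turning number of a convex polygon *)

(* If the direction passed a full turn at a vertex [X j] other than [X 0], [X 1], this vertex would be
   a local minimum of the height over the first edge, hence lie below [X 0] by convexity. *)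
Lemma turning_number (N : nat) (x y psi r : nat -> R) :
  (2 <= N)%nat ->
  (forall n, 0 < r n) -> (forall n, 0 < psi (S n) - psi n < PI) ->
  (forall n, x (S n) - x n = r n * cos (psi n)) -> (forall n, y (S n) - y n = r n * sin (psi n)) ->
  x N = x 0%nat -> y N = y 0%nat -> x (S N) = x 1%nat -> y (S N) = y 1%nat ->
  (forall n j, (n <= N)%nat -> (j <= N)%nat ->
     0 <= cos (psi n) * (y j - y n) - sin (psi n) * (x j - x n)) ->
  (forall j, (2 <= j < N)%nat ->
     0 < cos (psi 0%nat) * (y j - y 0%nat) - sin (psi 0%nat) * (x j - x 0%nat)) ->
  psi N = psi 0%nat + 2 * PI.
Proof.
  intros HN Hr Hstep Hx Hy Ex Ey Ex1 Ey1 Hleft Hstrict. pose proof PI_RGT_0 as HPI.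
  assert (Hmono : forall n, psi 0%nat <= psi n).
  { induction n as [|n IH]; [lra|]. specialize (Hstep n). lra. }
  assert (Hbound : forall j, (j < N)%nat -> psi j - psi 0%nat < 2 * PI).
  { induction j as [|j IH]; intros Hj; [lra|]. specialize (IH ltac:(lia)).
    apply Rnot_le_lt. intros Hge. pose proof (Hstep j) as Hs.
    destruct j as [|j']; [lra|]. set (j := S j') in *.
    set (ux := x 0%nat - x (S j)). set (uy := y 0%nat - y (S j)).
    assert (C1 : 0 <= cos (psi (S j)) * uy - sin (psi (S j)) * ux) by (apply Hleft; lia).
    assert (C2 : 0 <= cos (psi j) * uy - sin (psi j) * ux).
    { pose proof (Hleft j 0%nat ltac:(lia) ltac:(lia)) as H. unfold ux, uy.
      pose proof (Hx j) as H1. pose proof (Hy j) as H2.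
      replace (x (S j)) with (x j + r j * cos (psi j)) by lra.
      replace (y (S j)) with (y j + r j * sin (psi j)) by lra. lra. }
    assert (C3 : cos (psi 0%nat) * uy - sin (psi 0%nat) * ux < 0).
    { pose proof (Hstrict (S j) ltac:(unfold j in *; lia)) as H. unfold ux, uy. lra. }
    assert (S1 : 0 < sin (psi (S j) - psi j)) by (apply sin_gt_0; lra).
    assert (S2 : sin (psi j - psi 0%nat) <= 0) by (apply sin_le_0; lra).
    assert (S3 : 0 <= sin (psi (S j) - psi 0%nat)).
    { replace (psi (S j) - psi 0%nat) with (psi (S j) - psi 0%nat - 2 * PI + 2 * INR 1 * PI) by (simpl; ring).
      rewrite sin_period. apply sin_ge_0; lra. }
    (* The direction of the first edge is a combination of those of edges [j] and [S j], with sines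
       of angle differences as coefficients; [S1] to [S3] and [C1] to [C3] give the two sides
       incompatible signs. *)
    assert (E : sin (psi (S j) - psi j) * (cos (psi 0%nat) * uy - sin (psi 0%nat) * ux) =
      (cos (psi j) * uy - sin (psi j) * ux) * sin (psi (S j) - psi 0%nat) -
      (cos (psi (S j)) * uy - sin (psi (S j)) * ux) * sin (psi j - psi 0%nat)).
    { rewrite !sin_minus. ring. }
    assert (0 <= (cos (psi j) * uy - sin (psi j) * ux) * sin (psi (S j) - psi 0%nat)) by (apply Rmult_le_pos; lra).
    assert (0 <= (cos (psi (S j)) * uy - sin (psi (S j)) * ux) * - sin (psi j - psi 0%nat)) by (apply Rmult_le_pos; lra).
    nra. }
  (* Edge [N] is edge 0 again, so the directions agree modulo full turns; the bounds leave exactly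
     one turn. *)
  assert (Hexp : cexp_i (psi N) = cexp_i (psi 0%nat)).
  { pose proof (Hx N) as A1. pose proof (Hy N) as A2. rewrite Ex1, Ex in A1. rewrite Ey1, Ey in A2.
    rewrite Hx in A1. rewrite Hy in A2.
    pose proof (sin2_cos2 (psi N)) as T1. pose proof (sin2_cos2 (psi 0%nat)) as T2. unfold Rsqr in *.
    pose proof (Hr N) as R1. pose proof (Hr 0%nat) as R2.
    assert (Er : r N = r 0%nat).
    { assert (r N ^ 2 = r 0%nat ^ 2).
      { transitivity ((r N * cos (psi N)) ^ 2 + (r N * sin (psi N)) ^ 2).
        - replace (_ + _) with (r N ^ 2 * (sin (psi N) * sin (psi N) + cos (psi N) * cos (psi N))) by ring.
          rewrite T1. ring.
        - rewrite <- A1, <- A2.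
          replace (_ + _) with (r 0%nat ^ 2 * (sin (psi 0%nat) * sin (psi 0%nat) + cos (psi 0%nat) * cos (psi 0%nat))) by ring.
          rewrite T2. ring. }
      nra. }
    rewrite Er in *. unfold cexp_i. f_equal; apply Rmult_eq_reg_l with (r 0%nat); lra. }
  destruct (cexp_eq _ _ Hexp) as [m Hm].
  assert (Hlast : psi N - psi 0%nat < 3 * PI).
  { destruct N as [|n]; [lia|]. pose proof (Hbound n ltac:(lia)). pose proof (Hstep n). lra. }
  assert (Hfirst : psi 0%nat < psi N).
  { destruct N as [|n]; [lia|]. pose proof (Hmono n). pose proof (Hstep n). lra. }
  assert (m = 1)%Z as ->.
  { assert (0 < m)%Z by (apply lt_IZR; nra). assert (m < 2)%Z; [|lia].
    apply lt_IZR. nra. }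
  lra.
Qed.

(** * Lifts of Moebius maps of the circle *)

Definition circle_lift (m : mob) (L : R) (f : R -> R) : Prop :=
  (forall t, cexp_i (f t) = mob_act m (cexp_i t)) /\
  (forall t u, t < u -> f t < f u) /\
  (forall t u, t <= u -> f u - f t <= L * (u - t)) /\
  (forall t, f (t + 2 * PI) = f t + 2 * PI).

Lemma polar0 (z : C) : exists r t, 0 <= r /\ z = (r * cos t, r * sin t).
Proof.
  destruct (excluded_middle_informative (z = RtoC 0)) as [->|Hz].
  - exists 0, 0. split; [lra|]. unfold RtoC. f_equal; ring.
  - destruct (polar z 0 Hz) as (r & t & Hr & _ & E). exists r, t. split; [lra | exact E].
Qed.

(* On the circle [m(z) = e^(2 i alpha) z w / conj w] with [alpha = arg a] and
   [w = 1 + (b / a) conj z], which stays in the right half plane. *)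
Lemma mob_circle_lift m : is_disk_mob m -> exists L f, 0 < L /\ circle_lift m L f.
Proof.
  intros Hm. destruct m as [a b].
  destruct (polar0 a) as (A & al & HA & Ea). destruct (polar0 b) as (B & th & HB & Eb).
  assert (HAB : A ^ 2 - B ^ 2 = 1).
  { rewrite Ea, Eb in Hm. unfold is_disk_mob in Hm. rewrite !Cmod_sq in Hm. cbn [fst snd] in Hm.
    pose proof (sin2_cos2 al). pose proof (sin2_cos2 th). unfold Rsqr in *. nra. }
  assert (HA0 : 0 < A) by nra. assert (HBA : B < A) by nra.
  set (rho := B / A).
  assert (Hrho : 0 <= rho < 1).
  { unfold rho. split; [apply Rdiv_le_0_compat; lra|]. apply Rmult_lt_reg_r with A; [exact HA0|].
    unfold Rdiv. rewrite Rmult_assoc, Rinv_l; lra. }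
  assert (EB : B = A * rho) by (unfold rho; field; lra).
  set (chi := fun s => atan (rho * sin s / (1 + rho * cos s))).
  assert (HK : forall s, 0 < 1 + rho * cos s).
  { intros s. pose proof (COS_bound s). nra. }
  assert (HW : forall s, 0 < 1 + 2 * rho * cos s + rho ^ 2).
  { intros s. pose proof (COS_bound s). nra. }
  set (f := fun t => 2 * al + t + 2 * chi (th - al - t)).
  (* The derivative of [f] is a Poisson kernel, hence positive and at most
     [(1 + rho) / (1 - rho)]. *)
  set (Df := fun t => (1 - rho ^ 2) / (1 + 2 * rho * cos (th - al - t) + rho ^ 2)).
  assert (Hder : forall t, is_derive f t (Df t)).
  { intros t. unfold f, chi, Df. auto_derive.
    - apply Rgt_not_eq, HK.
    - replace (th - al + - t) with (th - al - t) by ring. set (s := th - al - t).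
      pose proof (HK s) as K. pose proof (HW s) as W. pose proof (sin2_cos2 s) as E. unfold Rsqr in E.
      assert (Hs : sin s * sin s = 1 - cos s * cos s) by lra.
      assert (HN : (1 + rho * cos s) ^ 2 + (rho * sin s) ^ 2 = 1 + 2 * rho * cos s + rho ^ 2).
      { replace ((rho * sin s) ^ 2) with (rho ^ 2 * (sin s * sin s)) by ring. rewrite Hs. ring. }
      set (c := cos s) in *. set (S := sin s) in *.
      transitivity (1 - 2 * ((rho * c * (1 + rho * c) + rho ^ 2 * (S * S)) / ((1 + rho * c) ^ 2 + (rho * S) ^ 2))).
      + field. rewrite HN. lra.
      + rewrite HN, Hs. field. lra. }
  assert (HDf : forall t, 0 < Df t <= (1 + rho) / (1 - rho)).
  { intros t. unfold Df. set (s := th - al - t). pose proof (HW s) as W. split.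
    - apply Rdiv_lt_0_compat; [nra | exact W].
    - apply Rmult_le_reg_r with (1 + 2 * rho * cos s + rho ^ 2); [exact W|].
      unfold Rdiv at 1. rewrite Rmult_assoc, Rinv_l, Rmult_1_r by lra.
      apply Rmult_le_reg_r with (1 - rho); [lra|].
      replace ((1 + rho) / (1 - rho) * (1 + 2 * rho * cos s + rho ^ 2) * (1 - rho)) with
        ((1 + rho) * (1 + 2 * rho * cos s + rho ^ 2)) by (field; lra).
      replace ((1 - rho ^ 2) * (1 - rho)) with ((1 + rho) * (1 - rho) ^ 2) by ring.
      apply Rmult_le_compat_l; [lra|]. pose proof (COS_bound s). nra. }
  assert (HMVT : forall t u, t < u -> exists c, f u - f t = Df c * (u - t)).
  { intros t u Htu. destruct (MVT_cor2 f Df t u Htu) as (c & Hc & _).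
    - intros c _. apply is_derive_Reals, Hder.
    - exists c. exact Hc. }
  exists ((1 + rho) / (1 - rho)), f. split; [apply Rdiv_lt_0_compat; lra|]. repeat split.
  - intros t. pose proof (mob_den (a, b) (cexp_i t) Hm (on_circle_le _ (cexp_on_circle t))) as Hden.
    set (s := th - al - t). set (x := chi s).
    set (W := sqrt ((1 + rho * cos s) ^ 2 + (rho * sin s) ^ 2)).
    assert (HW0 : 0 < W).
    { apply sqrt_lt_R0. pose proof (HK s). pose proof (pow2_ge_0 (rho * sin s)).
      assert (0 < (1 + rho * cos s) ^ 2) by (apply pow_lt; assumption). lra. }
    assert (Hx : 1 + rho * cos s = W * cos x /\ rho * sin s = W * sin x).
    { unfold x, chi. rewrite cos_atan, sin_atan. set (M := rho * sin s). set (K := 1 + rho * cos s).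
      assert (HK0 : 0 < K) by apply HK.
      assert (E : sqrt (1 + (M / K)²) = W / K).
      { unfold W. fold M K. apply sqrt_lem_1.
        - pose proof (Rle_0_sqr (M / K)). lra.
        - apply Rlt_le, Rdiv_lt_0_compat; assumption.
        - fold M K in W. assert (HWs : sqrt (K ^ 2 + M ^ 2) * sqrt (K ^ 2 + M ^ 2) = K ^ 2 + M ^ 2).
          { apply sqrt_sqrt. pose proof (pow2_ge_0 K). pose proof (pow2_ge_0 M). lra. }
          unfold Rsqr. set (q := sqrt (K ^ 2 + M ^ 2)) in *.
          replace (q / K * (q / K)) with (q * q / (K * K)) by (field; lra). rewrite HWs. field. lra. }
      rewrite E. split; field; lra. }
    destruct Hx as [Hx1 Hx2].
    assert (Hnum : (a * cexp_i t + b)%C = (RtoC (A * W) * cexp_i (al + t + x))%C).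
    { rewrite Ea, Eb. unfold cexp_i, Cmult, Cplus, RtoC. cbn [fst snd].
      replace th with (al + t + s) by (unfold s; ring). rewrite EB.
      f_equal.
      - transitivity (A * (cos (al + t) * (W * cos x) - sin (al + t) * (W * sin x))).
        + rewrite <- Hx1, <- Hx2, (cos_plus (al + t) s), cos_plus, sin_plus. ring.
        + rewrite (cos_plus (al + t) x). ring.
      - transitivity (A * (sin (al + t) * (W * cos x) + cos (al + t) * (W * sin x))).
        + rewrite <- Hx1, <- Hx2, (sin_plus (al + t) s), cos_plus, sin_plus. ring.
        + rewrite (sin_plus (al + t) x). ring. }
    assert (Hdn : (Cconj b * cexp_i t + Cconj a)%C = (RtoC (A * W) * cexp_i (- (al + x)))%C).
    { rewrite Ea, Eb. unfold cexp_i, Cmult, Cplus, Cconj, RtoC. cbn [fst snd].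
      replace t with (th - (al + s)) by (unfold s; ring). rewrite EB, cos_neg, sin_neg.
      pose proof (sin2_cos2 th) as Et. unfold Rsqr in Et.
      f_equal.
      - transitivity (A * (cos al * (W * cos x) - sin al * (W * sin x))).
        + rewrite <- Hx1, <- Hx2, cos_minus, sin_minus.
          transitivity (A * rho * cos (al + s) * (sin th * sin th + cos th * cos th) + A * cos al); [ring|].
          rewrite Et, cos_plus. ring.
        + rewrite (cos_plus al x). ring.
      - transitivity (- (A * (sin al * (W * cos x) + cos al * (W * sin x)))).
        + rewrite <- Hx1, <- Hx2, cos_minus, sin_minus.
          transitivity (- (A * rho * sin (al + s) * (sin th * sin th + cos th * cos th)) - A * sin al); [ring|].
          rewrite Et, sin_plus. ring.
        + rewrite (sin_plus al x). ring. }
    unfold mob_act. cbn [fst snd] in *. rewrite Hnum. rewrite Hdn in *.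
    assert (HAW : RtoC (A * W) <> RtoC 0).
    { intros E. injection E as E. assert (0 < A * W) by (apply Rmult_lt_0_compat; assumption). lra. }
    replace (al + t + x) with (f t + - (al + x)) by (unfold f; fold s; fold x; ring).
    rewrite cexp_add. field. split; [|exact HAW].
    intros E. apply Hden. rewrite E. ring.
  - intros t u Htu. destruct (HMVT t u Htu) as (c & Hc). pose proof (HDf c).
    assert (0 < Df c * (u - t)) by (apply Rmult_lt_0_compat; lra). lra.
  - intros t u [Htu| ->]; [|lra]. destruct (HMVT t u Htu) as (c & ->). pose proof (HDf c).
    apply Rmult_le_compat_r; lra.
  - intros t. unfold f, chi.
    replace (th - al - t) with (th - al - (t + 2 * PI) + 2 * INR 1 * PI) by (simpl; ring).
    rewrite cos_period, sin_period. ring.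
Qed.

(** * Lifting the side pairings to the line *)

Section Lifts.
Context (h : Z) (V : Z -> C) (T : Z -> mob) (sg : Z -> Z) (Z0 : zpolygon h V T sg).

Let HV := zp_V Z0.
Let HT := zp_T Z0.

Definition edge (k : Z) : C := (klein (V (k + 1)%Z) - klein (V k))%C.

Definition has_direction (k : Z) (psi : R) : Prop :=
  0 < Cmod (edge k) /\ edge k = (Cmod (edge k) * cos psi, Cmod (edge k) * sin psi).

Lemma polar_direction k r t : 0 < r -> edge k = (r * cos t, r * sin t) -> has_direction k t.
Proof.
  intros Hr E. assert (Hm : Cmod (edge k) = r).
  { rewrite E. unfold Cmod. cbn [fst snd]. pose proof (sin2_cos2 t) as H. unfold Rsqr in H.
    replace (_ + _) with (r ^ 2 * (sin t * sin t + cos t * cos t)) by ring. rewrite H, Rmult_1_r.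
    apply sqrt_pow2. lra. }
  unfold has_direction. rewrite Hm. split; assumption.
Qed.

Lemma edge_ne k : edge k <> RtoC 0.
Proof.
  intros E. apply (zp_klein_ne _ _ _ _ Z0 k). unfold edge in E.
  transitivity (klein (V (k + 1)%Z) - (klein (V (k + 1)%Z) - klein (V k)))%C; [ring | rewrite E; ring].
Qed.

Lemma direction_exists k : exists psi, has_direction k psi.
Proof.
  destruct (polar (edge k) 0 (edge_ne k)) as (r & t & Hr & _ & E). exists t.
  apply (polar_direction k r t); assumption.
Qed.

Lemma direction_step k psi : has_direction k psi ->
  exists psi', psi < psi' < psi + PI /\ has_direction (k + 1) psi'.
Proof.
  intros [Hr E]. pose proof PI_RGT_0 as HPI.
  destruct (polar (edge (k + 1)) psi (edge_ne (k + 1))) as (r & t & Hr' & Ht & E').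
  exists t. split; [|apply (polar_direction _ r t); assumption].
  pose proof (zp_left_next _ _ _ _ Z0 k) as Hdet. unfold vert in Hdet. rewrite det3_kv in Hdet. fold (edge k) in Hdet.
  replace (klein (V (k + 2)%Z) - klein (V k))%C with (edge k + edge (k + 1))%C in Hdet.
  2:{ unfold edge. replace (k + 1 + 1)%Z with (k + 2)%Z by lia. ring. }
  set (R0 := Cmod (edge k)) in *. rewrite E, E' in Hdet. unfold ccross, Cplus, Re, Im in Hdet.
  cbn [fst snd] in Hdet.
  replace (_ - _) with (R0 * r * sin (t - psi)) in Hdet by (rewrite sin_minus; ring).
  assert (Hs : 0 < sin (t - psi)).
  { apply Rmult_lt_reg_l with (R0 * r); [apply Rmult_lt_0_compat; assumption | lra]. }
  assert (t <> psi) by (intros ->; rewrite Rminus_diag, sin_0 in Hs; lra).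
  split; [lra|]. apply Rnot_le_lt. intros Hge.
  pose proof (sin_le_0 (t - psi) ltac:(lra) ltac:(lra)). lra.
Qed.

(** Each angle is chosen less than half a turn after the preceding one, so the sequence records the
    total rotation of the edges and not only their directions. *)
Fixpoint dir_nat (n : nat) : R :=
  match n with
  | O => epsilon (inhabits 0) (has_direction 0)
  | S n => epsilon (inhabits 0)
      (fun psi' => dir_nat n < psi' < dir_nat n + PI /\ has_direction (Z.of_nat n + 1) psi')
  end.

Lemma dir_nat_spec n : has_direction (Z.of_nat n) (dir_nat n).
Proof.
  induction n as [|n IH].
  - simpl dir_nat. apply epsilon_spec, direction_exists.
  - rewrite Nat2Z.inj_succ. simpl dir_nat.
    apply (epsilon_spec (inhabits 0) (fun psi' => dir_nat n < psi' < dir_nat n + PI /\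
      has_direction (Z.of_nat n + 1) psi')), direction_step, IH.
Qed.

Lemma dir_nat_step n : 0 < dir_nat (S n) - dir_nat n < PI.
Proof.
  destruct (epsilon_spec (inhabits 0) (fun psi' => dir_nat n < psi' < dir_nat n + PI /\
      has_direction (Z.of_nat n + 1) psi')) as [H _]; [apply direction_step, dir_nat_spec|].
  simpl dir_nat. lra.
Qed.

Lemma zp_left_weak n j : 0 <= ccross (edge n) (klein (V j) - klein (V n))%C.
Proof.
  pose proof (zp_h Z0). unfold edge. rewrite <- det3_kv.
  set (i := ((j - n) mod (2 * h))%Z).
  assert (Hj : (j = n + i + (j - n) / (2 * h) * (2 * h))%Z).
  { pose proof (Z.div_mod (j - n) (2 * h) ltac:(lia)). unfold i. lia. }
  pose proof (Z.mod_pos_bound (j - n) (2 * h) ltac:(lia)) as Hi. fold i in Hi.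
  rewrite Hj, (zp_V_perm _ _ _ _ Z0).
  destruct (Z.eq_dec i 0) as [->|H0]; [rewrite Z.add_0_r, det3_12; lra|].
  destruct (Z.eq_dec i 1) as [->|H1]; [rewrite det3_22; lra|].
  pose proof (zp_conv Z0 n (i := i) ltac:(lia)). lra.
Qed.

Lemma dir_nat_full_turn : dir_nat (Z.to_nat (2 * h)) = dir_nat 0 + 2 * PI.
Proof.
  pose proof (zp_h Z0) as Hh.
  assert (Hdir : forall n j, exists c, 0 < c /\
    cos (dir_nat n) * (snd (klein (V j)) - snd (klein (V (Z.of_nat n)))) -
    sin (dir_nat n) * (fst (klein (V j)) - fst (klein (V (Z.of_nat n)))) =
    c * ccross (edge (Z.of_nat n)) (klein (V j) - klein (V (Z.of_nat n)))%C).
  { intros n j. destruct (dir_nat_spec n) as [Hr E]. exists (/ Cmod (edge (Z.of_nat n))).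
    split; [apply Rinv_0_lt_compat, Hr|]. rewrite E at 2.
    unfold ccross, Cminus, Cplus, Copp, Re, Im. cbn [fst snd]. field. lra. }
  apply (turning_number _ (fun n => fst (klein (V (Z.of_nat n)))) (fun n => snd (klein (V (Z.of_nat n))))
    dir_nat (fun n => Cmod (edge (Z.of_nat n)))).
  - lia.
  - intros n. apply dir_nat_spec.
  - apply dir_nat_step.
  - intros n. destruct (dir_nat_spec n) as [_ E]. apply (f_equal fst) in E. unfold edge at 1 in E.
    rewrite Nat2Z.inj_succ. unfold Z.succ. exact E.
  - intros n. destruct (dir_nat_spec n) as [_ E]. apply (f_equal snd) in E. unfold edge at 1 in E.
    rewrite Nat2Z.inj_succ. unfold Z.succ. exact E.
  - rewrite Z2Nat.id by lia. do 2 f_equal. apply (zp_V_per Z0 0).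
  - rewrite Z2Nat.id by lia. do 2 f_equal. apply (zp_V_per Z0 0).
  - rewrite Nat2Z.inj_succ, Z2Nat.id by lia. do 2 f_equal.
    rewrite <- (zp_V_per Z0 (Z.of_nat 1)). f_equal. lia.
  - rewrite Nat2Z.inj_succ, Z2Nat.id by lia. do 2 f_equal.
    rewrite <- (zp_V_per Z0 (Z.of_nat 1)). f_equal. lia.
  - intros n j _ _. destruct (Hdir n (Z.of_nat j)) as (c & Hc & ->).
    apply Rmult_le_pos; [lra | apply zp_left_weak].
  - intros j Hj. destruct (Hdir 0%nat (Z.of_nat j)) as (c & Hc & ->).
    apply Rmult_lt_0_compat; [exact Hc|]. unfold edge. rewrite <- det3_kv.
    apply (zp_left _ _ _ _ Z0). lia.
Qed.

Definition dir (k : Z) : R := dir_nat (Z.to_nat (k mod (2 * h))) + 2 * PI * IZR (k / (2 * h)).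

Lemma dir_per k : dir (k + 2 * h) = dir k + 2 * PI.
Proof.
  pose proof (zp_h Z0). unfold dir.
  replace (k + 2 * h)%Z with (k + 1 * (2 * h))%Z by lia.
  rewrite Z.mod_add, Z.div_add, plus_IZR by lia. ring.
Qed.

Lemma dir_spec k : has_direction k (dir k).
Proof.
  pose proof (zp_h Z0).
  pose proof (dir_nat_spec (Z.to_nat (k mod (2 * h)))) as Hs.
  pose proof (Z.mod_pos_bound k (2 * h) ltac:(lia)) as Hb. rewrite Z2Nat.id in Hs by lia.
  assert (Ee : edge (k mod (2 * h)) = edge k).
  { pose proof (Z.div_mod k (2 * h) ltac:(lia)) as Hk.
    assert (Hk' : k = (k mod (2 * h) + k / (2 * h) * (2 * h))%Z) by lia.
    set (i := (k mod (2 * h))%Z) in *. set (m := (k / (2 * h))%Z) in *.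
    rewrite Hk'. unfold edge.
    replace (i + m * (2 * h) + 1)%Z with (i + 1 + m * (2 * h))%Z by lia.
    rewrite !(zp_V_perm _ _ _ _ Z0). reflexivity. }
  unfold has_direction in *. rewrite Ee in Hs. unfold dir.
  rewrite cos_periodic, sin_periodic. exact Hs.
Qed.

Lemma dir_step k : 0 < dir (k + 1) - dir k < PI.
Proof.
  pose proof (zp_h Z0). unfold dir.
  pose proof (Z.mod_pos_bound k (2 * h) ltac:(lia)) as Hb.
  pose proof (Z.div_mod k (2 * h) ltac:(lia)) as Hk.
  set (i := (k mod (2 * h))%Z) in *. set (m := (k / (2 * h))%Z) in *.
  pose proof (dir_nat_step (Z.to_nat i)) as Hs.
  destruct (Z.eq_dec (i + 1) (2 * h)) as [He|He].
  - replace ((k + 1) mod (2 * h))%Z with 0%Z.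
    2:{ symmetry. replace (k + 1)%Z with (0 + (m + 1) * (2 * h))%Z by lia. rewrite Z.mod_add by lia. reflexivity. }
    replace ((k + 1) / (2 * h))%Z with (m + 1)%Z.
    2:{ symmetry. replace (k + 1)%Z with (0 + (m + 1) * (2 * h))%Z by lia. rewrite Z.div_add by lia. reflexivity. }
    rewrite plus_IZR. pose proof dir_nat_full_turn as Ht.
    replace (Z.to_nat (2 * h)) with (S (Z.to_nat i)) in Ht by lia. simpl Z.to_nat. lra.
  - replace ((k + 1) mod (2 * h))%Z with (i + 1)%Z.
    2:{ symmetry. replace (k + 1)%Z with (i + 1 + m * (2 * h))%Z by lia. rewrite Z.mod_add by lia.
        apply Z.mod_small. lia. }
    replace ((k + 1) / (2 * h))%Z with m.
    2:{ symmetry. replace (k + 1)%Z with (i + 1 + m * (2 * h))%Z by lia. rewrite Z.div_add by lia.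
        rewrite Z.div_small by lia. lia. }
    replace (Z.to_nat (i + 1)) with (S (Z.to_nat i)) by lia. lra.
Qed.

Definition width (k : Z) : R := chord_width (V k) (dir k).

Lemma side_chord k : 0 < width k < PI /\ Pz V k = cexp_i (dir k - PI / 2 - width k) /\
  Qz V (k + 1) = cexp_i (dir k - PI / 2 + width k) /\
  forall t, mdot (nv V k) (kv (cexp_i t)) =
    Cmod (edge k) * (cos (width k) - cos (t - (dir k - PI / 2))).
Proof.
  destruct (dir_spec k) as [Hr E].
  destruct (chord_ends (V k) (V (k + 1)%Z) _ (dir k) (HV _) (HV _) Hr E) as (H1 & H2 & H3 & H4).
  fold (width k) in *. split; [exact H1|]. split; [exact H2|]. split; [|exact H4].
  unfold Qz. replace (k + 1 - 1)%Z with k by lia. exact H3.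
Qed.

(** The arc cut off by side [k] is centred at the angle [dir k - PI / 2] of the outward normal; its
    lower end is [pz k] and its upper end [qz (k + 1)]. *)
Definition pz (k : Z) : R := dir k - PI / 2 - width k.
Definition qz (k : Z) : R := dir (k - 1) - PI / 2 + width (k - 1).

Lemma pz_exp k : cexp_i (pz k) = Pz V k.
Proof. symmetry. apply side_chord. Qed.

Lemma qz_exp k : cexp_i (qz k) = Qz V k.
Proof.
  unfold qz. destruct (side_chord (k - 1)) as (_ & _ & H & _).
  replace (k - 1 + 1)%Z with k in H by lia. symmetry. exact H.
Qed.

Lemma width_per k : width (k + 2 * h) = width k.
Proof.
  unfold width, chord_width. rewrite (zp_V_per Z0), dir_per.
  replace (2 * PI) with (2 * PI * IZR 1) by ring. rewrite cos_periodic, sin_periodic. reflexivity.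
Qed.

Lemma pz_per k : pz (k + 2 * h) = pz k + 2 * PI.
Proof. unfold pz. rewrite dir_per, width_per. ring. Qed.

Lemma qz_per k : qz (k + 2 * h) = qz k + 2 * PI.
Proof.
  unfold qz. replace (k + 2 * h - 1)%Z with (k - 1 + 2 * h)%Z by lia.
  rewrite dir_per, width_per. ring.
Qed.

Lemma start_right X a b n : is_start X a b -> mdot n (kv a) = 0 -> 0 < mdot n (kv b) ->
  mdot n (kv X) < 0.
Proof.
  intros [_ (s & t & Hs & Ht & E)] Ha Hb. rewrite E, mdot_add_r, !mdot_scal_r in Ha.
  assert (0 < t * mdot n (kv b)) by (apply Rmult_lt_0_compat; assumption). nra.
Qed.

Lemma Pz_right k : mdot (nv V k) (kv (Pz V (k + 1))) < 0.
Proof.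
  pose proof (Pz_start _ _ _ _ Z0 (k + 1)) as H. replace (k + 1 + 1)%Z with (k + 2)%Z in H by lia.
  apply (start_right _ _ _ _ H); [apply det3_22 | apply (zp_left_next _ _ _ _ Z0)].
Qed.

Lemma Qz_right k : mdot (nv V k) (kv (Qz V k)) < 0.
Proof.
  apply (start_right _ _ _ _ (Qz_start _ _ _ _ Z0 k)); [apply det3_12 | apply (zp_left_prev _ _ _ _ Z0)].
Qed.

(** The sign of the normal decides membership in the arc on the circle; the window around the centre
    selects the lift. *)
Lemma right_of_side k t : - PI < t - (dir k - PI / 2) < PI -> mdot (nv V k) (kv (cexp_i t)) < 0 ->
  pz k < t < qz (k + 1).
Proof.
  intros Ht Hn. destruct (side_chord k) as (Hw & _ & _ & Hv). destruct (dir_spec k) as [Hr _].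
  rewrite Hv in Hn.
  assert (Hcos : cos (width k) < cos (t - (dir k - PI / 2))).
  { apply Rnot_le_lt. intros Hle.
    assert (0 <= Cmod (edge k) * (cos (width k) - cos (t - (dir k - PI / 2)))) by (apply Rmult_le_pos; lra). lra. }
  apply cos_lt_abs in Hcos; try assumption. apply Rabs_def2 in Hcos.
  unfold pz, qz. replace (k + 1 - 1)%Z with k by lia. lra.
Qed.

(** Extended backwards, side [k + 1] crosses the line of side [k] at their common vertex, so
    [P_(k+1)] lies on the arc cut off by side [k]. *)
Lemma pz_next k : pz k < pz (k + 1) < qz (k + 1).
Proof.
  apply right_of_side.
  - pose proof (dir_step k). destruct (side_chord (k + 1)) as (Hw & _). unfold pz. lra.
  - rewrite pz_exp. apply Pz_right.
Qed.

Lemma qz_next k : pz (k + 1) < qz (k + 1) < qz (k + 2).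
Proof.
  replace (k + 2)%Z with (k + 1 + 1)%Z by lia. apply right_of_side.
  - pose proof (dir_step k). destruct (side_chord k) as (Hw & _). unfold qz.
    replace (k + 1 - 1)%Z with k by lia. lra.
  - rewrite qz_exp. apply Qz_right.
Qed.

(** If it failed, [Q_k] would lie on the closed arc cut off by side [k + 1], and the ray from [V k]
    to [Q_k] on the line of side [k - 1] would meet the line of side [k + 1] beyond side [k]. *)
Lemma qz_pz k : qz k < pz (k + 1).
Proof.
  apply Rnot_le_lt. intros Hle.
  pose proof (qz_next (k - 1)) as H1. replace (k - 1 + 1)%Z with k in H1 by lia.
  replace (k - 1 + 2)%Z with (k + 1)%Z in H1 by lia.
  pose proof (qz_next k) as H2.
  set (L := mdot (nv V (k + 1)) (kv (Qz V k))).
  assert (HL : L <= 0).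
  { unfold L. rewrite <- qz_exp. destruct (side_chord (k + 1)) as (Hw & _ & _ & Hv).
    destruct (dir_spec (k + 1)) as [Hr _]. rewrite Hv.
    assert (Hx : Rabs (qz k - (dir (k + 1) - PI / 2)) <= width (k + 1)).
    { apply Rabs_le. unfold pz in Hle. unfold qz at 3 in H2.
      replace (k + 2 - 1)%Z with (k + 1)%Z in H2 by lia. lra. }
    assert (Hc : cos (width (k + 1)) <= cos (qz k - (dir (k + 1) - PI / 2))).
    { set (y := qz k - (dir (k + 1) - PI / 2)) in *.
      destruct (Rle_lt_dec 0 y) as [Hy|Hy].
      - rewrite Rabs_pos_eq in Hx by exact Hy. apply cos_decr_1; lra.
      - rewrite Rabs_left in Hx by exact Hy. rewrite <- (cos_neg y). apply cos_decr_1; lra. }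
    assert (0 <= Cmod (edge (k + 1)) * (cos (qz k - (dir (k + 1) - PI / 2)) - cos (width (k + 1)))) by
      (apply Rmult_le_pos; lra). lra. }
  set (v := mdot (nv V (k + 1)) (kv (V k))).
  assert (Hv : 0 < v).
  { pose proof (zp_left_prev _ _ _ _ Z0 (k + 1)) as H. replace (k + 1 - 1)%Z with k in H by lia. exact H. }
  assert (HQ : on_circle (Qz V k)) by (rewrite <- qz_exp; apply cexp_on_circle).
  (* The weights [- L] and [v] give the point of the ray at which [nv V (k + 1)] vanishes. If
     [L = 0] this is the ideal point itself, so the null vectors in [fut] matter. *)
  apply (sides_do_not_meet h V T sg Z0 k (vadd (vscal (- L) (kv (V k))) (vscal v (kv (Qz V k))))).
  - apply fut_comb; [apply timelike_fut, kv_timelike, HV | apply kv_circle_fut, HQ | lra | exact Hv].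
  - assert (E1 : mdot (nv V (k - 1)) (kv (V k)) = 0).
    { unfold nv. replace (k - 1 + 1)%Z with k by lia. apply det3_22. }
    destruct (Qz_start _ _ _ _ Z0 k) as [_ (s & t & Hs & Ht & E)].
    assert (E2 : mdot (nv V (k - 1)) (kv (Qz V k)) = 0).
    { assert (E3 : mdot (nv V (k - 1)) (kv (V (k - 1)%Z)) = 0) by apply det3_12.
      rewrite E, mdot_add_r, !mdot_scal_r, E3 in E1. apply Rmult_eq_reg_l with s; lra. }
    rewrite mdot_add_r, !mdot_scal_r, E1, E2. ring.
  - rewrite mdot_add_r, !mdot_scal_r. fold v L. ring.
  - rewrite mdot_add_r, !mdot_scal_r. pose proof (Qz_right k).
    replace (mdot (nv V k) (kv (V k))) with 0 by (symmetry; apply det3_12). nra.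
Qed.

Lemma finite_lipschitz : exists L, 0 < L /\ forall k, exists f, circle_lift (T k) L f.
Proof.
  pose proof (zp_h Z0) as Hh.
  assert (Hmono : forall m L L' f, L <= L' -> circle_lift m L f -> circle_lift m L' f).
  { intros m L L' f HL (A1 & A2 & A3 & A4). repeat split; try assumption.
    intros t u Htu. eapply Rle_trans; [apply A3, Htu|]. apply Rmult_le_compat_r; lra. }
  assert (Hn : forall n, exists L, 0 < L /\ forall k, (0 <= k < Z.of_nat n)%Z -> exists f, circle_lift (T k) L f).
  { induction n as [|n (L & HL & IH)].
    - exists 1. split; [lra|]. intros k Hk. lia.
    - destruct (mob_circle_lift (T (Z.of_nat n)) (HT _)) as (L' & f & HL' & Hf).
      exists (Rmax L L'). split; [eapply Rlt_le_trans; [exact HL | apply Rmax_l]|].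
      intros k Hk. destruct (Z.eq_dec k (Z.of_nat n)) as [->|Hne].
      + exists f. apply (Hmono _ L'); [apply Rmax_r | exact Hf].
      + destruct (IH k ltac:(lia)) as [f' Hf']. exists f'. apply (Hmono _ L); [apply Rmax_l | exact Hf']. }
  destruct (Hn (Z.to_nat (2 * h))) as (L & HL & H). exists L. split; [exact HL|].
  assert (Hper : forall n k, T (k + Z.of_nat n * (2 * h))%Z = T k).
  { induction n as [|n IH]; intros j; [f_equal; lia|].
    replace (j + Z.of_nat (S n) * (2 * h))%Z with (j + Z.of_nat n * (2 * h) + 2 * h)%Z by lia.
    rewrite (zp_T_per Z0). apply IH. }
  intros k. set (i := (k mod (2 * h))%Z). set (m := (k / (2 * h))%Z).
  pose proof (Z.div_mod k (2 * h) ltac:(lia)) as Hk. fold i m in Hk.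
  pose proof (Z.mod_pos_bound k (2 * h) ltac:(lia)) as Hi. fold i in Hi.
  replace (T k) with (T i); [apply H; lia|].
  destruct (Z_le_gt_dec 0 m) as [Hm|Hm].
  - rewrite <- (Hper (Z.to_nat m) i). f_equal. rewrite Z2Nat.id; lia.
  - rewrite <- (Hper (Z.to_nat (- m)) k). f_equal. rewrite Z2Nat.id; lia.
Qed.

Definition lip_const : R := epsilon (inhabits 0) (fun L => 0 < L /\ forall k, exists f, circle_lift (T k) L f).
(** A function of the map and not of its label: labels that differ by a period share this lift, and
    only [lift_shift] distinguishes them. *)
Definition lift0 (m : mob) : R -> R := epsilon (inhabits (fun x => x)) (circle_lift m lip_const).
Definition lift_shift (k : Z) : Z :=
  epsilon (inhabits 0%Z) (fun j => lift0 (T k) (pz k) + 2 * PI * IZR j = qz (sg k + 1)).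
Definition tauz (k : Z) (t : R) : R := lift0 (T k) t + 2 * PI * IZR (lift_shift k).

Lemma lip_const_spec : 0 < lip_const /\ forall k, exists f, circle_lift (T k) lip_const f.
Proof. exact (epsilon_spec (inhabits 0) _ finite_lipschitz). Qed.

Lemma lift0_spec k : circle_lift (T k) lip_const (lift0 (T k)).
Proof. unfold lift0. apply epsilon_spec, lip_const_spec. Qed.

Lemma tauz_pz k : tauz k (pz k) = qz (sg k + 1).
Proof.
  apply (epsilon_spec (inhabits 0%Z) (fun j => lift0 (T k) (pz k) + 2 * PI * IZR j = qz (sg k + 1))).
  destruct (cexp_eq (qz (sg k + 1)) (lift0 (T k) (pz k))) as [m Hm].
  - rewrite qz_exp, (proj1 (lift0_spec k)), pz_exp. symmetry. apply (T_Pz _ _ _ _ Z0).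
  - exists m. symmetry. exact Hm.
Qed.

Lemma tauz_exp k t : cexp_i (tauz k t) = mob_act (T k) (cexp_i t).
Proof. unfold tauz. rewrite cexp_periodic. apply lift0_spec. Qed.

Lemma tauz_inc k t u : t < u -> tauz k t < tauz k u.
Proof. intros Htu. unfold tauz. pose proof (proj1 (proj2 (lift0_spec k)) t u Htu). lra. Qed.

Lemma tauz_shift k t : tauz k (t + 2 * PI) = tauz k t + 2 * PI.
Proof. unfold tauz. rewrite (proj2 (proj2 (proj2 (lift0_spec k)))). ring. Qed.

Lemma pz_grid : grid (2 * h) pz.
Proof.
  pose proof (zp_h Z0). split; [lia|]. split; [|apply pz_per]. intros k. apply pz_next.
Qed.

Lemma pz_lt_qz k : pz k < qz k.
Proof. replace k with (k - 1 + 1)%Z by lia. apply pz_next. Qed.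

Lemma qz_grid : grid (2 * h) qz.
Proof.
  pose proof (zp_h Z0). split; [lia|]. split; [|apply qz_per].
  intros k. pose proof (qz_pz k). pose proof (pz_lt_qz (k + 1)). lra.
Qed.

(** [tauz k] maps the full turn that begins at [pz k] onto the one that begins at [qz (sg k + 1)],
    so an identity on the circle determines the lifted value. *)
Lemma tauz_val k t y : pz k <= t < pz k + 2 * PI -> cexp_i y = mob_act (T k) (cexp_i t) ->
  qz (sg k + 1) <= y < qz (sg k + 1) + 2 * PI -> tauz k t = y.
Proof.
  intros Ht Hy Hy2. apply (cexp_inj_window _ _ (qz (sg k + 1))); [|rewrite <- tauz_pz|exact Hy2].
  - rewrite tauz_exp. symmetry. exact Hy.
  - split.
    + destruct (proj1 Ht) as [H| <-]; [apply Rlt_le, tauz_inc, H | lra].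
    + rewrite <- tauz_shift. apply tauz_inc. lra.
Qed.

Lemma pz_window k j : (k < j <= k + 2 * h)%Z -> qz k <= pz j < qz k + 2 * PI.
Proof.
  intros Hj. split.
  - pose proof (qz_pz k). pose proof (grid_le _ _ (k + 1) j pz_grid ltac:(lia)). lra.
  - rewrite <- qz_per. pose proof (grid_le _ _ j (k + 2 * h) pz_grid ltac:(lia)).
    pose proof (pz_lt_qz (k + 2 * h)). lra.
Qed.

Lemma tauz_qz k : tauz k (qz k) = qz (sg k + 2).
Proof.
  pose proof (zp_h Z0). apply tauz_val.
  - pose proof (pz_lt_qz k). pose proof (qz_pz k). rewrite <- pz_per.
    pose proof (grid_le _ _ (k + 1) (k + 2 * h) pz_grid ltac:(lia)). lra.
  - rewrite !qz_exp. symmetry. apply (T_Qz _ _ _ _ Z0).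
  - rewrite <- qz_per. split; [apply (grid_le (2 * h)) | apply (grid_lt (2 * h))]; try apply qz_grid; lia.
Qed.

Lemma tauz_pz_next k : tauz k (pz (k + 1)) = pz (sg k - 1 + 2 * h).
Proof.
  pose proof (zp_h Z0). apply tauz_val.
  - rewrite <- pz_per. split; [apply (grid_le (2 * h)) | apply (grid_lt (2 * h))]; try apply pz_grid; lia.
  - rewrite pz_per. replace (pz (sg k - 1) + 2 * PI) with (pz (sg k - 1) + 2 * PI * IZR 1) by ring.
    rewrite cexp_periodic, !pz_exp. symmetry. apply (T_Pz_next _ _ _ _ Z0).
  - apply pz_window. lia.
Qed.

Lemma tauz_qz_next k : tauz k (qz (k + 1)) = pz (sg k + 2 * h).
Proof.
  pose proof (zp_h Z0). apply tauz_val.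
  - pose proof (pz_lt_qz (k + 1)). pose proof (pz_next k). pose proof (qz_pz (k + 1)).
    rewrite <- pz_per. pose proof (grid_le _ _ (k + 1 + 1) (k + 2 * h) pz_grid ltac:(lia)). lra.
  - rewrite pz_per. replace (pz (sg k) + 2 * PI) with (pz (sg k) + 2 * PI * IZR 1) by ring.
    rewrite cexp_periodic, pz_exp, qz_exp. symmetry. apply (T_Qz_next _ _ _ _ Z0).
  - apply pz_window. lia.
Qed.

Lemma tauz_per k t : tauz (k + 2 * h) (t + 2 * PI) = tauz k t - 2 * PI.
Proof.
  assert (Hs : forall t, tauz (k + 2 * h) t = tauz k t + 2 * PI * (IZR (lift_shift (k + 2 * h)) - IZR (lift_shift k))).
  { intros s. unfold tauz. rewrite (zp_T_per Z0). ring. }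
  pose proof (tauz_pz (k + 2 * h)) as H. rewrite Hs, pz_per, tauz_shift, tauz_pz in H.
  rewrite (zp_sg_per Z0) in H.
  pose proof (qz_per (sg k - 2 * h + 1)) as Hq.
  replace (sg k - 2 * h + 1 + 2 * h)%Z with (sg k + 1)%Z in Hq by lia.
  rewrite Hs, tauz_shift. lra.
Qed.

Lemma boundary_lift_of_polygon lam :
  3 <= lam -> lam ^ 2 = (IZR (2 * h) - 2) * lam - 1 ->
  (forall k, exists m, (sg (sg (k + 1) + 1) + 1 = sg (sg k - 1 + 2 * h) + m * (2 * h))%Z) ->
  (forall k, exists m, (sg k - 1 + 2 * h - (sg (k + 1) + 1) = m * (2 * h) + h - 1)%Z) ->
  boundary_lift (2 * h) lam pz qz sg tauz.
Proof.
  intros Hlam Hch Hrel Hgap. pose proof (zp_h Z0) as Hh. constructor; try assumption.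
  - lia.
  - apply pz_lt_qz.
  - apply qz_pz.
  - apply pz_per.
  - apply qz_per.
  - apply (zp_sg_per Z0).
  - apply tauz_per.
  - apply tauz_inc.
  - destruct lip_const_spec as [HL _]. exists lip_const. split; [exact HL|].
    intros k t u Htu. pose proof (proj1 (proj2 (proj2 (lift0_spec k))) t u Htu). unfold tauz. lra.
  - apply tauz_pz.
  - apply tauz_qz.
  - apply tauz_pz_next.
  - apply tauz_qz_next.
  - intros k. destruct (Hrel k) as [c Hc]. exists c. intros t Ht.
    set (s := (sg (k + 1) + 1)%Z) in *. set (r := (sg k - 1 + 2 * h)%Z) in *.
    assert (Hle : forall k t u, t <= u -> tauz k t <= tauz k u).
    { intros k' t' u' [H| ->]; [apply Rlt_le, tauz_inc, H | lra]. }
    assert (L1 : qz (sg s + 2) <= tauz s (tauz (k + 1) t) < qz (sg s + 2) + 2 * PI).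
    { assert (Hlo : qz s <= tauz (k + 1) t) by (unfold s; rewrite <- tauz_pz; apply Hle, Ht).
      assert (Hhi : tauz (k + 1) t <= qz (s + 1)).
      { unfold s. replace (sg (k + 1) + 1 + 1)%Z with (sg (k + 1) + 2)%Z by lia.
        rewrite <- tauz_qz. apply Hle, Ht. }
      apply (Hle s) in Hlo. apply (Hle s) in Hhi. rewrite tauz_qz in Hlo. rewrite tauz_qz_next in Hhi.
      pose proof (pz_window (sg s + 2) (sg s + 2 * h) ltac:(lia)). lra. }
    assert (L2 : qz (sg r + 1) <= tauz r (tauz k t) < qz (sg r + 1) + 2 * PI).
    { assert (Hlo : pz r <= tauz k t) by (unfold r; rewrite <- tauz_pz_next; apply Hle, Ht).
      assert (Hhi : tauz k t <= pz (r + 1)).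
      { unfold r. replace (sg k - 1 + 2 * h + 1)%Z with (sg k + 2 * h)%Z by lia.
        rewrite <- tauz_qz_next. apply Hle, Ht. }
      apply (Hle r) in Hlo. apply (Hle r) in Hhi. rewrite tauz_pz in Hlo. rewrite tauz_pz_next in Hhi.
      pose proof (pz_window (sg r + 1) (sg r - 1 + 2 * h) ltac:(lia)). lra. }
    (* The two sides of the vertex relation agree on the circle and lie in windows that differ by
       exactly [c] turns. *)
    assert (Eq : qz (sg s + 2) = qz (sg r + 1) + 2 * PI * IZR c).
    { rewrite <- (grid_per (2 * h)) by apply qz_grid. f_equal. lia. }
    apply (cexp_inj_window _ _ (qz (sg s + 2))); [|exact L1 | lra].
    rewrite cexp_periodic, !tauz_exp.
    replace (T r) with (T (sg k - 1)%Z) by (symmetry; apply (zp_T_per Z0)).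
    apply (zp_rel Z0), cexp_on_circle.
  - intros k. destruct (Hgap k) as [m Hm]. exists m.
    replace (2 * h / 2)%Z with h by (rewrite Z.mul_comm, Z.div_mul; lia). exact Hm.
Qed.

End Lifts.

(** * Integer side labels *)

Definition uZ {X : Type} (N : nat) (u : nat -> X) (k : Z) : X := u (Z.to_nat (k mod Z.of_nat N)).

Lemma uZ_nat {X : Type} N (u : nat -> X) j k m : (0 < N)%nat -> periodic N u ->
  (k = Z.of_nat j + m * Z.of_nat N)%Z -> uZ N u k = u j.
Proof.
  intros HN Hu ->. unfold uZ. rewrite Z.mod_add by lia. rewrite <- Nat2Z.inj_mod, Nat2Z.id.
  rewrite (Nat.div_mod_eq j N) at 2. rewrite Nat.add_comm, Nat.mul_comm.
  induction (j / N)%nat as [|n IH]; [simpl; rewrite Nat.add_0_r; reflexivity|].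
  replace (j mod N + S n * N)%nat with (j mod N + n * N + N)%nat by lia. rewrite Hu. exact IH.
Qed.

Lemma uZ_per {X : Type} N (u : nat -> X) k : (0 < N)%nat -> uZ N u (k + Z.of_nat N) = uZ N u k.
Proof.
  intros HN. unfold uZ. replace (k + Z.of_nat N)%Z with (k + 1 * Z.of_nat N)%Z by lia.
  rewrite Z.mod_add by lia. reflexivity.
Qed.

(* The representative of [k] in [1..N], the range of side labels. *)
Definition idx (N : nat) (k : Z) : nat := S (Z.to_nat ((k - 1) mod Z.of_nat N)).

Lemma idx_spec N k : (0 < N)%nat ->
  (1 <= idx N k <= N)%nat /\ exists m, (k = Z.of_nat (idx N k) + m * Z.of_nat N)%Z.
Proof.
  intros HN. pose proof (Z.mod_pos_bound (k - 1) (Z.of_nat N) ltac:(lia)).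
  pose proof (Z.div_mod (k - 1) (Z.of_nat N) ltac:(lia)). unfold idx. split; [lia|].
  exists ((k - 1) / Z.of_nat N)%Z. lia.
Qed.

Lemma idx_per N k : (0 < N)%nat -> idx N (k + Z.of_nat N) = idx N k.
Proof.
  intros HN. unfold idx. replace (k + Z.of_nat N - 1)%Z with (k - 1 + 1 * Z.of_nat N)%Z by lia.
  rewrite Z.mod_add by lia. reflexivity.
Qed.

(** Without reduction modulo [8 g - 4] the pairing is affine on each parity class, and all
    identities between labels become linear. *)
Definition sgZ (g : nat) (k : Z) : Z :=
  if Z.odd k then (4 * Z.of_nat g - k)%Z else (2 - k)%Z.

Lemma sgZ_odd g k x : (k = 2 * x + 1)%Z -> sgZ g k = (4 * Z.of_nat g - k)%Z.
Proof. intros ->. unfold sgZ. rewrite Z.odd_odd. reflexivity. Qed.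

Lemma sgZ_even g k x : (k = 2 * x)%Z -> sgZ g k = (2 - k)%Z.
Proof. intros ->. unfold sgZ. rewrite Z.odd_even. reflexivity. Qed.

Ltac parity_case k x :=
  let H := fresh "Hpar" in
  destruct (Z.Even_or_Odd k) as [[x H]|[x H]].

Lemma sgZ_sgZ g k : sgZ g (sgZ g k) = k.
Proof.
  parity_case k x.
  - rewrite (sgZ_even g k x Hpar), (sgZ_even g _ (1 - x)) by lia. lia.
  - rewrite (sgZ_odd g k x Hpar), (sgZ_odd g _ (2 * Z.of_nat g - x - 1)) by lia. lia.
Qed.

Lemma sgZ_per g k h : sgZ g (k + 2 * h) = (sgZ g k - 2 * h)%Z.
Proof.
  parity_case k x.
  - rewrite (sgZ_even g k x Hpar), (sgZ_even g _ (x + h)) by lia. lia.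
  - rewrite (sgZ_odd g k x Hpar), (sgZ_odd g _ (x + h)) by lia. lia.
Qed.

Definition half (g : nat) : Z := (4 * Z.of_nat g - 2)%Z.

Lemma sgZ_opp g k : exists m, (sgZ g (sgZ g k + 1) + 1 = k + half g + m * (2 * half g))%Z.
Proof.
  unfold half. parity_case k x.
  - exists 0%Z. rewrite (sgZ_even g k x Hpar), (sgZ_odd g _ (1 - x)) by lia. lia.
  - exists (-1)%Z. rewrite (sgZ_odd g k x Hpar), (sgZ_even g _ (2 * Z.of_nat g - x)) by lia. lia.
Qed.

(** Both products in the vertex relation take vertex [k + 1] to the same vertex: the left label is
    its image under [T_(sg (k + 1) + 1) T_(k + 1)], the right one its image under
    [T_(sg k - 1) T_k], up to full periods. *)
Lemma sgZ_vertex g k : exists m,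
  (sgZ g (sgZ g (k + 1) + 1) + 1 = sgZ g (sgZ g k - 1 + 2 * half g) + m * (2 * half g))%Z.
Proof.
  unfold half. parity_case k x.
  - exists 0%Z. rewrite (sgZ_even g k x Hpar), (sgZ_odd g (k + 1) x) by lia.
    rewrite (sgZ_even g _ (2 * Z.of_nat g - x)) by lia.
    rewrite (sgZ_odd g _ (- x + (4 * Z.of_nat g - 2))) by lia. lia.
  - exists 2%Z. rewrite (sgZ_odd g k x Hpar), (sgZ_even g (k + 1) (x + 1)) by lia.
    rewrite (sgZ_odd g _ (- x)) by lia.
    rewrite (sgZ_even g _ (2 * Z.of_nat g - x - 1 + (4 * Z.of_nat g - 2))) by lia. lia.
Qed.

Lemma sgZ_gap g k : exists m,
  (sgZ g k - 1 + 2 * half g - (sgZ g (k + 1) + 1) = m * (2 * half g) + half g - 1)%Z.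
Proof.
  unfold half. parity_case k x.
  - exists 0%Z. rewrite (sgZ_even g k x Hpar), (sgZ_odd g (k + 1) x) by lia. lia.
  - exists 1%Z. rewrite (sgZ_odd g k x Hpar), (sgZ_even g (k + 1) (x + 1)) by lia. lia.
Qed.

Lemma sigma_sgZ g j k m : (1 <= g)%nat -> (1 <= j <= Nsides g)%nat ->
  (k = Z.of_nat j + m * Z.of_nat (Nsides g))%Z ->
  exists m', (sgZ g k = Z.of_nat (Defs.sigma g j) + m' * Z.of_nat (Nsides g))%Z.
Proof.
  intros Hg Hj Hk. assert (HN : Z.of_nat (Nsides g) = (8 * Z.of_nat g - 4)%Z) by (unfold Nsides; lia).
  unfold Defs.sigma. destruct (Nat.odd j) eqn:Ho.
  - apply Nat.odd_spec in Ho. destruct Ho as [x Hx].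
    rewrite (sgZ_odd g k (Z.of_nat x + m * half g)) by (unfold half; lia).
    pose proof (Nat.div_mod_eq (4 * g + Nsides g - j) (Nsides g)) as E.
    set (q := ((4 * g + Nsides g - j) / Nsides g)%nat) in *.
    set (r := ((4 * g + Nsides g - j) mod Nsides g)%nat) in *.
    exists (Z.of_nat q - 1 - m)%Z. apply (f_equal Z.of_nat) in E.
    rewrite Nat2Z.inj_add, Nat2Z.inj_mul in E. lia.
  - assert (He : Nat.even j = true) by (rewrite <- Nat.negb_odd, Ho; reflexivity).
    apply Nat.even_spec in He. destruct He as [x Hx].
    rewrite (sgZ_even g k (Z.of_nat x + m * half g)) by (unfold half; lia).
    pose proof (Nat.div_mod_eq (2 + Nsides g - j) (Nsides g)) as E.
    set (q := ((2 + Nsides g - j) / Nsides g)%nat) in *.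
    set (r := ((2 + Nsides g - j) mod Nsides g)%nat) in *.
    exists (Z.of_nat q - 1 - m)%Z. apply (f_equal Z.of_nat) in E.
    rewrite Nat2Z.inj_add, Nat2Z.inj_mul in E. lia.
Qed.

Lemma mob_inv_inv m : mob_inv (mob_inv m) = m.
Proof. destruct m as [a b]. unfold mob_inv. cbn [fst snd]. rewrite Cconj_conj. f_equal. ring. Qed.

Lemma mob_act_inv m z : is_disk_mob m -> Cmod z <= 1 -> mob_act m (mob_act (mob_inv m) z) = z.
Proof.
  intros Hm Hz. rewrite <- (mob_inv_inv m) at 1. apply mob_inv_act; [apply mob_inv_disk|]; assumption.
Qed.

Section Translation.
Context (g : nat) (V : nat -> C) (T : nat -> mob) (Hg : (2 <= g)%nat).
Context (HF : fundamental_polygon g V T) (HC : canonical g V).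

Let N := Nsides g.
Let VZ := uZ N V.
(** The maps are given for the labels from 1 to [N], so [idx] is used here and not the residue,
    which takes the value 0. *)
Let TZ (k : Z) : mob := T (idx N k).
Let sg := sgZ g.

Lemma N_pos : (0 < N)%nat.
Proof. unfold N, Nsides. lia. Qed.

Lemma N_half : Z.of_nat N = (2 * half g)%Z.
Proof. unfold N, Nsides, half. lia. Qed.

Lemma VZ_nat j k m : (k = Z.of_nat j + m * Z.of_nat N)%Z -> VZ k = V j.
Proof. apply uZ_nat; [exact N_pos | apply HF]. Qed.

Lemma side_translation k : let j := idx N k in
  (1 <= j <= N)%nat /\ VZ k = V j /\ VZ (k + 1)%Z = V (S j) /\ VZ (k - 1)%Z = V (pred j) /\
  VZ (sg k) = V (Defs.sigma g j) /\ VZ (sg k + 1)%Z = V (S (Defs.sigma g j)) /\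
  VZ (sg k + 2)%Z = V (S (S (Defs.sigma g j))).
Proof.
  intros j. destruct (idx_spec N k N_pos) as (Hj & m & Hm). fold j in Hj, Hm.
  destruct (sigma_sgZ g j k m) as [m' Hm']; [lia | exact Hj | exact Hm |].
  split; [exact Hj|].
  refine (conj _ (conj _ (conj _ (conj _ (conj _ _)))));
    [apply (VZ_nat _ _ m) | apply (VZ_nat _ _ m) | apply (VZ_nat _ _ m) |
    apply (VZ_nat _ _ m') | apply (VZ_nat _ _ m') | apply (VZ_nat _ _ m')]; unfold sg, N in *; lia.
Qed.

Lemma VZ_per k : VZ (k + 2 * half g)%Z = VZ k.
Proof. rewrite <- N_half. apply uZ_per, N_pos. Qed.

Lemma TZ_disk k : is_disk_mob (TZ k).
Proof. destruct (side_translation k) as (Hj & _). apply HF, Hj. Qed.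

Lemma VZ_disk k : in_disk (VZ k).
Proof. apply HF. Qed.

Lemma TZ_start k : mob_act (TZ k) (VZ k) = VZ (sg k + 1)%Z.
Proof.
  destruct (side_translation k) as (Hj & E0 & _ & _ & _ & E1 & _). rewrite E0, E1. apply HF, Hj.
Qed.

Lemma TZ_end k : mob_act (TZ k) (VZ (k + 1)%Z) = VZ (sg k).
Proof.
  destruct (side_translation k) as (Hj & _ & E0 & _ & E1 & _). rewrite E0, E1. apply HF, Hj.
Qed.

(* Both sides map [V (k + 1)] to the same vertex, and the group acts freely. *)
Lemma vertex_relation k x : on_circle x ->
  mob_act (TZ (sg (k + 1) + 1)) (mob_act (TZ (k + 1)) x) =
  mob_act (TZ (sg k - 1)) (mob_act (TZ k) x).
Proof.
  intros Hx. set (s := (sg (k + 1) + 1)%Z). set (r := (sg k - 1)%Z).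
  pose proof (TZ_disk k) as Dk. pose proof (TZ_disk (k + 1)) as Dk1.
  pose proof (TZ_disk s) as Ds. pose proof (TZ_disk r) as Dr.
  pose proof (mob_inv_disk _ Dk1) as Dk1'. pose proof (mob_inv_disk _ Ds) as Ds'.
  set (w := ((idx N (k + 1), true) :: (idx N s, true) :: (idx N r, false) :: (idx N k, false) :: nil)%list).
  assert (Hact : forall z, word_act T w z = mob_act (mob_inv (TZ (k + 1)))
    (mob_act (mob_inv (TZ s)) (mob_act (TZ r) (mob_act (TZ k) z)))) by reflexivity.
  assert (Hok : word_ok N w).
  { intros p Hp. unfold w in Hp. simpl in Hp.
    destruct Hp as [<-|[<-|[<-|[<-|[]]]]]; cbn [fst]; apply side_translation. }
  assert (Hfix : word_act T w (VZ (k + 1)%Z) = VZ (k + 1)%Z).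
  { rewrite Hact, TZ_end. replace (VZ (sg k)) with (VZ (r + 1)%Z) by (f_equal; unfold r; lia).
    rewrite TZ_end.
    assert (Es : VZ (sg r) = mob_act (TZ s) (VZ s)).
    { rewrite TZ_start. destruct (sgZ_vertex g k) as [m Hm].
      assert (Hm' : (sg s + 1 = sg r - 2 * half g + m * (2 * half g))%Z).
      { unfold s, r, sg. rewrite <- sgZ_per, Hm. do 2 f_equal. }
      rewrite Hm', <- N_half.
      unfold VZ, uZ. replace (sg r - Z.of_nat N + m * Z.of_nat N)%Z with (sg r + (m - 1) * Z.of_nat N)%Z by lia.
      pose proof N_pos. rewrite Z.mod_add by lia. reflexivity. }
    rewrite Es, mob_inv_act by (try apply in_disk_le, VZ_disk; assumption).
    unfold s. rewrite <- TZ_start. apply mob_inv_act; [exact Dk1 | apply in_disk_le, VZ_disk]. }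
  destruct HF as (_ & _ & _ & _ & _ & _ & Hfree).
  pose proof (Hfree w (VZ (k + 1)%Z) Hok (VZ_disk _) Hfix) as Hid.
  (* Freeness gives the identity on the open disk only. Multiplied out, the word is a single disk
     automorphism, to which [mob_id_circle] applies. *)
  set (M := mob_mul (mob_inv (TZ (k + 1))) (mob_mul (mob_inv (TZ s)) (mob_mul (TZ r) (TZ k)))).
  assert (DM : is_disk_mob M) by (unfold M; repeat apply mob_mul_disk; assumption).
  assert (HM : forall z, Cmod z <= 1 -> mob_act M z = word_act T w z).
  { intros z Hz. rewrite Hact. unfold M.
    rewrite !mob_mul_act; try assumption; try reflexivity; repeat apply mob_mul_disk; assumption. }
  pose proof (mob_id_circle M x DM) as E.
  rewrite (HM x (on_circle_le x Hx)), Hact in E.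
  assert (E' : mob_act (mob_inv (TZ (k + 1)))
    (mob_act (mob_inv (TZ s)) (mob_act (TZ r) (mob_act (TZ k) x))) = x).
  { apply E; [|exact Hx]. intros u Hu. rewrite HM by (apply in_disk_le, Hu). apply Hid, Hu. }
  assert (C2 : on_circle (mob_act (TZ r) (mob_act (TZ k) x))) by auto using mob_on_circle.
  rewrite <- E' at 1. rewrite mob_act_inv, mob_act_inv;
    auto using on_circle_le, mob_on_circle.
Qed.

Lemma zpolygon_of_canonical : zpolygon (half g) VZ TZ sg.
Proof.
  pose proof N_pos as HN. pose proof N_half as Hh. constructor.
  - unfold half. lia.
  - apply VZ_disk.
  - apply VZ_per.
  - intros k. unfold TZ. rewrite <- Hh, idx_per by exact HN. reflexivity.
  - intros k i Hi. rewrite det3_kv.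
    destruct (side_translation k) as (Hj & E0 & E1 & _).
    destruct (side_translation (k + i)) as (Hj' & E2 & _).
    destruct (idx_spec N k HN) as (_ & m & Hm). destruct (idx_spec N (k + i) HN) as (_ & m' & Hm').
    set (j := idx N k) in *. set (j' := idx N (k + i)) in *.
    rewrite E0, E1, E2. destruct HF as (_ & (_ & Hconv) & _). apply Hconv; try assumption.
    + intros Heq. rewrite Heq in Hm'. assert (i = (m' - m) * Z.of_nat N)%Z by lia.
      assert (0 < m' - m)%Z by nia. assert (m' - m < 1)%Z by nia. lia.
    + intros Heq. fold N in Heq.
      assert (Hc : (Z.of_nat j' = Z.of_nat j + 1 \/ Z.of_nat j' = Z.of_nat j + 1 - Z.of_nat N)%Z).
      { destruct (Nat.eq_dec j N) as [Hjn|Hjn].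
        - right. rewrite Hjn, Nat.Div0.mod_same in Heq. lia.
        - left. rewrite Nat.mod_small in Heq by lia. lia. }
      destruct Hc as [Hc|Hc].
      * assert (i - 1 = (m' - m) * Z.of_nat N)%Z by lia.
        assert (0 < m' - m)%Z by nia. assert (m' - m < 1)%Z by nia. lia.
      * assert (i - 1 = (m' - m - 1) * Z.of_nat N)%Z by lia.
        assert (0 < m' - m - 1)%Z by nia. assert (m' - m - 1 < 1)%Z by nia. lia.
  - apply TZ_disk.
  - apply TZ_start.
  - apply TZ_end.
  - intros k. destruct (side_translation k) as (Hj & E0 & E1 & E2 & E3 & E4 & E5).
    rewrite E0, E1, E2, E3, E4, E5. apply HC, Hj.
  - apply sgZ_sgZ.
  - intros k. apply sgZ_per.
  - apply sgZ_opp.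
  - apply vertex_relation.
Qed.

(** * Cut points and the boundary map *)

Context (A : nat -> C) (f : C -> C) (HAper : periodic N A).
Context (HA : forall k, (1 <= k <= N)%nat -> on_circle (A k) /\ arc_cc (Pt V k) (Qt V k) (A k)).
Context (Hf : is_boundary_map N T A f).

Let AZ := uZ N A.
Let p := pz (half g) VZ.
Let q := qz (half g) VZ.
Let Z0 := zpolygon_of_canonical.

Lemma cut_exists k : exists t, p k <= t <= q k /\ cexp_i t = AZ k.
Proof.
  destruct (side_translation k) as (Hj & E0 & E1 & E2 & _).
  destruct (idx_spec N k N_pos) as (_ & m & Hm).
  destruct (HA _ Hj) as (_ & t & s & Hts & Hs & EA & EQ).
  assert (EA' : AZ k = A (idx N k)) by (apply (uZ_nat N A _ _ m N_pos HAper Hm)).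
  assert (EP : Pt V (idx N k) = cexp_i (p k)).
  { unfold p. rewrite (pz_exp _ _ _ _ Z0). unfold Pt, Pz. rewrite <- E0, <- E1. reflexivity. }
  assert (EQ' : Qt V (idx N k) = cexp_i (q k)).
  { unfold q. rewrite (qz_exp _ _ _ _ Z0). unfold Qt, Qz. rewrite <- E0, <- E2.
    apply geod_end_start; [apply VZ_disk | apply VZ_disk |].
    intros E. apply (zp_klein_ne' _ _ _ _ Z0 k). symmetry. exact E. }
  rewrite EP, <- cexp_add in EA. rewrite EP, EQ', <- cexp_add in EQ.
  (* The arc in the hypothesis is known only on the circle; both candidates for its end lie less
     than a full turn after [p k], so they agree. *)
  assert (Hq : q k = p k + s).
  { apply (cexp_inj_window _ _ (p k)); [exact EQ | | lra].
    pose proof (pz_lt_qz _ _ _ _ Z0 k). pose proof (qz_pz _ _ _ _ Z0 k).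
    pose proof (grid_le _ _ (k + 1) (k + 2 * half g) (pz_grid _ _ _ _ Z0) ltac:(unfold half; lia)) as Hp.
    rewrite (pz_per _ _ _ _ Z0) in Hp. unfold p, q. lra. }
  exists (p k + t). split; [lra|]. rewrite EA', EA. reflexivity.
Qed.

Definition cut (k : Z) : R := epsilon (inhabits 0) (fun t => p k <= t <= q k /\ cexp_i t = AZ k).

Lemma cut_spec k : p k <= cut k <= q k /\ cexp_i (cut k) = AZ k.
Proof. unfold cut. apply epsilon_spec, cut_exists. Qed.

Lemma cut_window k : q k < p k + 2 * PI.
Proof.
  pose proof (qz_pz _ _ _ _ Z0 k).
  pose proof (grid_le _ _ (k + 1) (k + 2 * half g) (pz_grid _ _ _ _ Z0) ltac:(unfold half; lia)) as Hp.
  rewrite (pz_per _ _ _ _ Z0) in Hp. unfold p, q. lra.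
Qed.

Lemma cut_grid : grid (2 * half g) cut.
Proof.
  split; [unfold half; lia|]. split.
  - intros k. pose proof (cut_spec k). pose proof (cut_spec (k + 1)).
    pose proof (qz_pz _ _ _ _ Z0 k) as H1. fold p q in H1. lra.
  - intros k. destruct (cut_spec k) as [H1 E1]. destruct (cut_spec (k + 2 * half g)) as [H2 E2].
    pose proof (cut_window (k + 2 * half g)) as Hw.
    pose proof (pz_per _ _ _ _ Z0 k) as Hp. pose proof (qz_per _ _ _ _ Z0 k) as Hq. fold p q in Hp, Hq.
    apply (cexp_inj_window _ _ (p (k + 2 * half g)%Z)); try lra.
    replace (cut k + 2 * PI) with (cut k + 2 * PI * IZR 1) by ring.
    rewrite cexp_periodic, E1, E2. unfold AZ. rewrite <- N_half. apply uZ_per, N_pos.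
Qed.

Lemma boundary_map_lift t :
  f (cexp_i t) = cexp_i (lift_map (tauz (half g) VZ TZ sg) cut t).
Proof.
  unfold lift_map. set (k := piece cut t). pose proof (piece_spec _ _ t cut_grid) as Ht. fold k in Ht.
  rewrite (tauz_exp _ _ _ _ Z0).
  destruct (side_translation k) as (Hj & _). destruct (idx_spec N k N_pos) as (_ & m & Hm).
  apply Hf; [exact Hj | apply cexp_on_circle |].
  assert (E1 : A (idx N k) = cexp_i (cut k)).
  { rewrite (proj2 (cut_spec k)). symmetry. apply (uZ_nat N A _ _ m N_pos HAper Hm). }
  assert (E2 : A (S (idx N k)) = cexp_i (cut (k + 1))).
  { rewrite (proj2 (cut_spec (k + 1))). symmetry. apply (uZ_nat N A _ _ m N_pos HAper). lia. }
  rewrite E1, E2. exists (t - cut k), (cut (k + 1) - cut k).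
  pose proof (cut_spec k). pose proof (cut_spec (k + 1)). pose proof (cut_window (k + 1)).
  pose proof (grid_lt _ _ (k + 1) (k + 2 * half g) cut_grid ltac:(unfold half; lia)) as Hc.
  rewrite (proj2 (proj2 cut_grid)) in Hc.
  split; [lra|]. split; [lra|]. split; rewrite <- cexp_add; f_equal; ring.
Qed.

Lemma htop_boundary_map :
  htop f = Finite (ln (INR (4 * g - 3) + sqrt ((INR (4 * g - 3)) ^ 2 - 1))).
Proof.
  set (x := INR (4 * g - 3)). set (lam := x + sqrt (x ^ 2 - 1)).
  assert (Hx5 : 5 <= x) by (unfold x; rewrite INR_IZR_INZ; apply IZR_le; lia).
  assert (Hsq : sqrt (x ^ 2 - 1) ^ 2 = x ^ 2 - 1) by (apply pow2_sqrt; nra).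
  assert (Hs0 : 0 <= sqrt (x ^ 2 - 1)) by apply sqrt_pos.
  assert (Hlam : 3 <= lam) by (unfold lam; lra).
  (* The number of sides minus 2 is [2 * (4 g - 3)], and [lam] is the larger root of
     [z ^ 2 - 2 * x * z + 1]. *)
  assert (Hch : lam ^ 2 = (IZR (2 * half g) - 2) * lam - 1).
  { assert (EN : IZR (2 * half g) - 2 = 2 * x).
    { unfold x. rewrite INR_IZR_INZ, <- minus_IZR, <- mult_IZR. f_equal. unfold half. lia. }
    rewrite EN. unfold lam. nra. }
  pose proof (boundary_lift_of_polygon _ _ _ _ Z0 lam Hlam Hch (sgZ_vertex g) (sgZ_gap g)) as B.
  assert (Hpc : forall k, p k <= cut k) by (intros k; apply cut_spec).
  assert (Hcq : forall k, cut k <= q k) by (intros k; apply cut_spec).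
  assert (HNl : 0 <= IZR (2 * half g) * lam).
  { apply Rmult_le_pos; [apply IZR_le; unfold half; lia | lra]. }
  apply htop_of_bounds.
  - lra.
  - intros eps Heps. exists (1 + IZR (2 * half g) * lam), (4 * PI / eps). split; [lra|]. split.
    { apply Rdiv_le_0_compat; [pose proof PI_RGT_0; lra | exact Heps]. }
    intros n E HE.
    pose proof (circle_upper _ _ _ _ _ _ B cut cut_grid Hpc Hcq f boundary_map_lift eps n E Heps HE) as H.
    eapply Rle_trans; [exact H|]. apply Req_le. field. lra.
  - exact (circle_lower _ _ _ _ _ _ B cut cut_grid Hpc Hcq f boundary_map_lift).
Qed.

End Translation.

Theorem theorem1 (g : nat) (V : nat -> C) (T : nat -> mob) (A : nat -> C) (f : C -> C) :
  (2 <= g)%nat ->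
  fundamental_polygon g V T ->
  canonical g V ->
  periodic (Nsides g) A ->
  (forall k, (1 <= k <= Nsides g)%nat ->
     on_circle (A k) /\ arc_cc (Pt V k) (Qt V k) (A k)) ->
  is_boundary_map (Nsides g) T A f ->
  htop f = Finite (ln (INR (4 * g - 3) + sqrt ((INR (4 * g - 3))^2 - 1))).
Proof.
  intros Hg HF HC HAper HA Hf. exact (htop_boundary_map g V T Hg HF HC A f HAper HA Hf).
Qed.
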